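(* Let $M\subset\mathbb{C}^2$ be a real-analytic (or formal) hypersurface with $p\in M$. Assume that the invariant set $\Lambda_M\subset\mathbb{N}^3$ contains at least two points and that at least one of them, say $(\alpha,n,\mu)$, satisfies $\alpha\neq n$. Then the group $\mathrm{Aut}_f(M,p)$ of all formal automorphisms of $(M,p)$ embeds, via its jet evaluation $H\mapsto j^k_pH$, as a closed Lie subgroup of some jet group $J_p^k(\mathbb{C}^2)$, and it satisfies $$\dim_{\mathbb{R}}\mathrm{Aut}_f(M,p)\le 1 .$$ Moreover: (a) Suppose that either $\alpha+n=\alpha'+n'$ for some $(\alpha',n',\mu')\in\Lambda_M$ with $(\alpha',n',\mu')\neq(\alpha,n,\mu)$, or the number $$\frac{(\alpha'+n')\mu-(\alpha+n)\mu'}{(\alpha'+n')-(\alpha+n)}\qquad( * )$$ is not the same positive integer for all choices of $(\alpha',n',\mu')\in\Lambda_M$ with $(\alpha',n',\mu')\ne(\alpha,n,\mu)$. Then $\mathrm{Aut}_f(M,p)$ embeds as a finite subgroup of $\mathsf{U}(1)\times\mathsf{U}(1)$, more precisely as a subgroup of the finite group $N_M$. In particular, $$\#\mathrm{Aut}_f(M,p)\le 2(n-\alpha).$$ (b) If $\alpha+n\neq\alpha'+n'$ for all $(\alpha',n',\mu')\in\Lambda_M$ with $(\alpha',n',\mu')\neq(\alpha,n,\mu)$, and the number $( * )$ is the same positive integer $k$ for all such $(\alpha',n',\mu')$, then $\mathrm{Aut}_f(M,p)$ embeds (via jet evaluation) into $J^k_p(\mathbb{C}^2)$ for this $k$.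
   Context: $\mathbb{N}=\{0,1,2,\dots\}$. A bar over a power series means that its coefficients are conjugated. Formal hypersurfaces: a formal hypersurface $M$ through $p\in\mathbb{C}^2$ is given by a formal power series $\rho(Z,\bar Z)=\sum_{I,J}\rho_{I\bar J}(Z-p)^I\overline{(Z-p)^J}$ with $\rho_{I\bar J}=\overline{\rho_{J\bar I}}$, zero constant term, and $d\rho\neq0$ at $p$. A germ of a real-analytic hypersurface is identified with the formal hypersurface given by the Taylor series of a defining function. A formal invertible map is a pair of formal power series in $Z-p$ with invertible Jacobian matrix at $p$. A formal automorphism of $(M,p)$ is a formal invertible map $H:(\mathbb{C}^2,p)\to(\mathbb{C}^2,p)$ with $\rho(H(Z),\overline{H(Z)})=a(Z,\bar Z)\rho(Z,\bar Z)$ for some formal power series $a$ in $Z-p$, $\overline{Z-p}$; these form the group $\mathrm{Aut}_f(M,p)$. $J^k_p(\mathbb{C}^2)$ is the group of $k$-jets at $p$ of invertible holomorphic maps $(\mathbb{C}^2,p)\to(\mathbb{C}^2,p)$. Normal coordinates: these are (formal or local) holomorphic coordinates $(z,w)$ vanishing at $p$ in which $M$ is given by $\operatorname{Im}w=\varphi(z,\bar z,\operatorname{Re}w)$, with $\varphi(z,\chi,s)=\bar\varphi(\chi,z,s)$ and $\varphi(z,0,s)\equiv\varphi(0,\chi,s)\equiv0$. They always exist. Expand $\varphi(z,\chi,s)=\sum_{\alpha\ge1,\mu\ge0}\varphi_{\alpha,\mu}(\chi)z^\alpha s^\mu$. Invariant set: on $\mathbb{N}^2$ let $(\alpha,\mu)\preceq(\beta,\nu)$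 iff $\alpha+\mu\le\beta+\nu$ and $\mu\le\nu$; let $\prec$ mean $\preceq$ and $\neq$. A pair $(\alpha_0,\mu_0)$ is an invariant pair of $M$ if $\varphi_{\alpha_0,\mu_0}\not\equiv0$ but $\varphi_{\alpha,\mu}\equiv0$ for every $(\alpha,\mu)\prec(\alpha_0,\mu_0)$. $Q_M$ is the set of invariant pairs. For $(\alpha,\mu)\in Q_M$ let $n(\alpha,\mu):=\min\{n:\frac{d^n\varphi_{\alpha,\mu}}{d\chi^n}(0)\neq0\}$ (one has $n(\alpha,\mu)\ge\alpha$), and let $\Lambda_M:=\{(\alpha,n,\mu)\in\mathbb{N}^3:(\alpha,\mu)\in Q_M,\ n=n(\alpha,\mu)\}$. The sets $Q_M,\Lambda_M$ do not depend on the choice of normal coordinates. The group $N_M$: for integers $k,l$ let $D(k,l):=\{(\gamma,\delta)\in\mathsf{U}(1)\times\{-1,1\}:\gamma^k\delta^l=1\}$, and let $N_M:=\bigcap_{(\alpha,n,\mu)\in\Lambda_M}D(n-\alpha,\mu-1)$. *)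

(* Defs.v *)
From HB Require Import structures.
From mathcomp Require Import all_boot all_order all_algebra.
From mathcomp Require Import complex.
From mathcomp Require Import all_classical all_reals all_analysis.
Import Order.TTheory GRing.Theory Num.Theory.
Import numFieldNormedType.Exports.

Set Implicit Arguments.
Unset Strict Implicit.
Unset Printing Implicit Defensive.

Local Open Scope classical_set_scope.
Local Open Scope ring_scope.
Local Open Scope complex_scope.

Section FormalPowerSeries.
Variable K : comNzRingType.

Definition midx (n : nat) := {ffun 'I_n -> nat}.

Definition mdeg n (m : midx n) : nat := (\sum_i m i)%N.

Definition midx0 n : midx n := [ffun=> 0%N].

Definition midx1 n (i : 'I_n) : midx n := [ffun j => nat_of_bool (j == i)].

(* The multi-indices with all entries < d, as the image of a finite type. *)
Definition bounded_midx n d (b : {ffun 'I_n -> 'I_d}) : midx n :=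
  [ffun i => nat_of_ord (b i)].

(* [f m] is the coefficient of X^m.  The pointwise product that functions into
   a ring inherit is not the product of series, which is [fps_mul]. *)
Definition fps (n : nat) := midx n -> K.

Definition fps_one n : fps n := fun m => (m == midx0 n)%:R.

Definition fps_var n (i : 'I_n) : fps n := fun m => (m == midx1 i)%:R.

Definition fps_mul n (f g : fps n) : fps n := fun m =>
  \sum_(b : {ffun 'I_n -> 'I_(mdeg m).+1} | [forall i, (b i <= m i)%N])
     f (bounded_midx b) * g [ffun i => (m i - b i)%N].

Definition fps_exp n (f : fps n) (k : nat) : fps n :=
  iter k (fps_mul f) (@fps_one n).

Definition fps_monomial n m (G : 'I_n -> fps m) (I : midx n) : fps m :=
  \big[@fps_mul m / @fps_one m]_(i < n) fps_exp (G i) (I i).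

(* F(G_1, ..., G_n), for G_i without constant term: then G^I has order at
   least |I|, so the coefficient of X^m only involves the I with |I| <= |m|,
   all of which have their entries < |m| + 1. *)
Definition fps_comp n m (F : fps n) (G : 'I_n -> fps m) : fps m := fun e =>
  \sum_(b : {ffun 'I_n -> 'I_(mdeg e).+1})
     F (bounded_midx b) * fps_monomial G (bounded_midx b) e.

End FormalPowerSeries.

Section FormalMaps.
Variable R : realType.
Local Notation C := R[i].

(* Everything is expressed in the coordinates Z - p, so that p is the origin:
   H stands for the map Z |-> p + H(Z - p). *)
Definition formal_map := 'I_2 -> fps C 2.

Definition jacobian0 (H : formal_map) : 'M[C]_2 :=
  \matrix_(i, j) H i (midx1 j).

Definition formal_invertible (H : formal_map) : Prop :=
  (forall i, H i (midx0 2) = 0) /\ jacobian0 H \in unitmx.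

Definition formal_id : formal_map := fun i => fps_var C i.

Definition map_comp (H G : formal_map) : formal_map := fun i => fps_comp (H i) G.

Definition fps_conj n (f : fps C n) : fps C n := fun m => (f m)^*%R.

(* Series in Z, \bar Z are series in 2 + 2 independent variables; the last two
   stand for the components of \bar Z. *)
Definition swap_bar (m : midx (2 + 2)) : midx (2 + 2) :=
  [ffun i => match fintype.split i with
             | inl j => m (rshift 2 j)
             | inr j => m (lshift 2 j)
             end].

Definition formal_hypersurface (rho : fps C (2 + 2)) : Prop :=
  [/\ forall m, rho m = (rho (swap_bar m))^*%R,
      rho (midx0 _) = 0
    & exists i, rho (midx1 i) != 0].

(* (Z, \bar Z) |-> (H(Z), \bar H(\bar Z)) *)
Definition with_bar (H : formal_map) : 'I_(2 + 2) -> fps C (2 + 2) := fun i =>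
  match fintype.split i with
  | inl j => fps_comp (H j) (fun l => fps_var C (lshift 2 l))
  | inr j => fps_comp (fps_conj (H j)) (fun l => fps_var C (rshift 2 l))
  end.

Definition pullback (rho : fps C (2 + 2)) (H : formal_map) : fps C (2 + 2) :=
  fps_comp rho (with_bar H).

Definition Autf (rho : fps C (2 + 2)) : set formal_map :=
  [set H | formal_invertible H /\
           exists a : fps C (2 + 2), pullback rho H = fps_mul a rho].

End FormalMaps.

Section NormalCoordinates.
Variable R : realType.
Local Notation C := R[i].

(* phi is a series in (z, chi, s), in this order. *)
Definition coef3 (phi : fps C 3) (alpha n mu : nat) : C :=
  phi [ffun i : 'I_3 => tnth [tuple alpha; n; mu] i].

Definition normal_series (phi : fps C 3) : Prop :=
  [/\ forall alpha n mu, coef3 phi alpha n mu = (coef3 phi n alpha mu)^*%R,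
      forall alpha mu, coef3 phi alpha 0 mu = 0
    & forall n mu, coef3 phi 0 n mu = 0].

(* Im w - phi(z, \bar z, Re w) as a series in (z, w, \bar z, \bar w) *)
Definition normal_defining_series (phi : fps C 3) : fps C (2 + 2) :=
  let z := fps_var C (lshift 2 (0 : 'I_2)) in
  let w := fps_var C (lshift 2 (1 : 'I_2)) in
  let chi := fps_var C (rshift 2 (0 : 'I_2)) in
  let tau := fps_var C (rshift 2 (1 : 'I_2)) in
  let re_w : fps C (2 + 2) := fun m => (w m + tau m) / 2%:R in
  fun m => (w m - tau m) / (2%:R * 'i)
           - fps_comp phi (fun i : 'I_3 => tnth [tuple z; chi; re_w] i) m.

(* Z - p = T(z, w) introduces normal coordinates (z, w) in which the
   hypersurface is given by phi.  The factor a is automatically a unit, both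
   series having a nonzero differential at 0. *)
Definition normal_coordinates (rho : fps C (2 + 2)) (T : formal_map R)
    (phi : fps C 3) : Prop :=
  [/\ formal_invertible T, normal_series phi
    & exists a : fps C (2 + 2),
        pullback rho T = fps_mul a (normal_defining_series phi)].

(* phi_{alpha,mu}(chi), a series in one variable *)
Definition phi_coef (phi : fps C 3) (am : nat * nat) : nat -> C :=
  fun n => coef3 phi am.1 n am.2.

Definition deriv_series (f : nat -> C) : nat -> C := fun n => f n.+1 *+ n.+1.

Definition preceq (x y : nat * nat) : Prop :=
  (x.1 + x.2 <= y.1 + y.2)%N /\ (x.2 <= y.2)%N.

Definition prec (x y : nat * nat) : Prop := preceq x y /\ x <> y.

Definition invariant_pair (phi : fps C 3) (x : nat * nat) : Prop :=
  (exists n, phi_coef phi x n != 0) /\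
  (forall y, prec y x -> forall n, phi_coef phi y n = 0).

(* n = min {n | (d^n f / d chi^n)(0) <> 0} *)
Definition is_first_derivative (f : nat -> C) (n : nat) : Prop :=
  iter n deriv_series f 0%N != 0 /\
  (forall m, (m < n)%N -> iter m deriv_series f 0%N = 0).

(* Triples are ordered (alpha, n, mu). *)
Definition Lambda (phi : fps C 3) : set (nat * nat * nat) :=
  [set t | let '(alpha, n, mu) := t in
     invariant_pair phi (alpha, mu) /\
     is_first_derivative (phi_coef phi (alpha, mu)) n].

Definition D_group (k l : int) : set (C * C) :=
  [set x | [/\ `|x.1| = 1, x.2 = 1 \/ x.2 = -1 & x.1 ^ k * x.2 ^ l = 1]].

Definition N_group (phi : fps C 3) : set (C * C) :=
  [set x | forall alpha n mu, Lambda phi (alpha, n, mu) ->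
     D_group (n%:Z - alpha%:Z) (mu%:Z - 1) x].

Definition embeds_in_N_group (rho : fps C (2 + 2)) (phi : fps C 3) : Prop :=
  exists F : formal_map R -> C * C,
    [/\ forall H, Autf rho H -> N_group phi (F H),
        forall H G, Autf rho H -> Autf rho G ->
          F (map_comp H G) = ((F H).1 * (F G).1, (F H).2 * (F G).2)
      & forall H G, Autf rho H -> Autf rho G -> F H = F G -> H = G].

Definition slope (t t' : nat * nat * nat) : rat :=
  let '(alpha, n, mu) := t in
  let '(alpha', n', mu') := t' in
  (((alpha' + n') * mu)%:R - ((alpha + n) * mu')%:R)
    / ((alpha' + n')%:R - (alpha + n)%:R).

End NormalCoordinates.

Section Submanifolds.
Variable R : realType.

Fixpoint Ck_on (k : nat) n m (U : set 'rV[R]_n) (f : 'rV[R]_n -> 'rV[R]_m)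
    : Prop :=
  (forall x, U x -> {for x, continuous f}) /\
  (if k is k'.+1 then
     forall v, (forall x, U x -> derivable f x v) /\
               Ck_on k' U (fun x => 'D_v f x)
   else True).

Definition smooth_on n m (U : set 'rV[R]_n) (f : 'rV[R]_n -> 'rV[R]_m) : Prop :=
  forall k, Ck_on k U f.

(* Around each point of S some smooth diffeomorphism f : U -> V between open
   sets, with inverse g, carries S to the linear subspace R^d x 0. *)
Definition embedded_submanifold n (d : nat) (S : set 'rV[R]_n) : Prop :=
  (d <= n)%N /\
  forall x, S x -> exists (U V : set 'rV[R]_n) (f g : 'rV[R]_n -> 'rV[R]_n),
    [/\ [/\ open U, open V & U x],
        smooth_on U f /\ smooth_on V g,
        (forall y, U y -> V (f y)) /\ (forall y, V y -> U (g y)),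
        (forall y, U y -> g (f y) = y) /\ (forall y, V y -> f (g y) = y)
      & forall y, U y ->
          (S y <-> forall i : 'I_n, (d <= i)%N -> f y 0 i = 0)].

End Submanifolds.

Section Jets.
Variables (R : realType) (k : nat).
Local Notation C := R[i].

(* A k-jet is the vector of the real (true: imaginary) parts of the Taylor
   coefficients of order 1, ..., k of the two components; the index (i, b, c)
   refers to the coefficient of multi-index b in the component i. *)
Definition jet_index : {set 'I_2 * {ffun 'I_2 -> 'I_k.+1} * bool} :=
  [set x | (0 < mdeg (bounded_midx x.1.2) <= k)%N].

Definition jet (H : formal_map R) : 'rV[R]_#|jet_index| :=
  \row_(j < #|jet_index|)
    (let: (i, b, c) := (enum_val j : 'I_2 * {ffun 'I_2 -> 'I_k.+1} * bool) in
     let a : C := H i (bounded_midx b) in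
     if c then complex.Im a else complex.Re a).

(* The polynomial map of degree at most k with k-jet v. *)
Definition jet_rep (v : 'rV[R]_#|jet_index|) : formal_map R := fun i m =>
  \sum_(j < #|jet_index|)
    (let: (i', b, c) := (enum_val j : 'I_2 * {ffun 'I_2 -> 'I_k.+1} * bool) in
     if (i' == i) && (bounded_midx b == m)
     then (if c then 'i else 1) * (v 0 j)%:C else 0).

Definition jet_group : set 'rV[R]_#|jet_index| :=
  [set jet H | H in [set H | formal_invertible H]].

Definition jet_mul (u v : 'rV[R]_#|jet_index|) : 'rV[R]_#|jet_index| :=
  jet (map_comp (jet_rep u) (jet_rep v)).

Definition jet_one : 'rV[R]_#|jet_index| := jet (@formal_id R).

Definition jet_subgroup (S : set 'rV[R]_#|jet_index|) : Prop :=
  [/\ S `<=` jet_group,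
      S jet_one,
      forall u v, S u -> S v -> S (jet_mul u v)
    & forall u, S u ->
        exists2 v, S v & jet_mul u v = jet_one /\ jet_mul v u = jet_one].

(* The jet group is open in the vector space of all jets, so its submanifolds
   are those of that space; S has only to be closed relatively to it. *)
Definition closed_lie_subgroup (d : nat) (S : set 'rV[R]_#|jet_index|) : Prop :=
  [/\ jet_subgroup S,
      closure S `&` jet_group `<=` S
    & embedded_submanifold d S].

(* Jet evaluation embeds Autf as a closed Lie subgroup of real dimension d. *)
Definition jet_embedding (rho : fps C (2 + 2)) (d : nat) : Prop :=
  [/\ forall H G, Autf rho H -> Autf rho G ->
        jet (map_comp H G) = jet_mul (jet H) (jet G),
      forall H G, Autf rho H -> Autf rho G -> jet H = jet G -> H = G
    & closed_lie_subgroup d [set jet H | H in Autf rho]].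

End Jets.

(* Main.v *)
Require Import Defs.
From HB Require Import structures.
From mathcomp Require Import all_boot all_order all_algebra.
From mathcomp Require Import complex perm.
From mathcomp Require Import all_classical all_reals all_analysis.
Import Order.TTheory GRing.Theory Num.Theory.
Import numFieldNormedType.Exports.
From mathcomp Require Import zify ring lra.

Set Implicit Arguments.
Unset Strict Implicit.
Unset Printing Implicit Defensive.

Local Open Scope classical_set_scope.
Local Open Scope ring_scope.
Local Open Scope complex_scope.

(** In normal coordinates the hypersurface is the set of Im w = phi(z, \bar z,
    Re w). Treating z, chi = \bar z and s = Re w as independent variables, a
    formal map H = (f, g) is an automorphism if and only if its defect Im g -
    phi(f, \bar f, Re g) vanishes as a series in (z, chi, s) (Autf_normal).
    All the information is read off at the exponents (alpha, n, mu) of the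
    invariant set: below such an exponent phi has no terms, so that only
    finitely many explicit products reach it.

    Linear parts. Let gamma = f_z(0) and delta = g_w(0). The terms on chi = s =
    0 show g_z(0) = 0, the term in s alone shows that delta is real, and the
    leading exponents give delta = gamma^alpha \bar gamma^n delta^mu for all
    points of the invariant set (linear_part_relation). Thus the phases
    (gamma/|gamma|, delta/|delta|) form a homomorphism to N_M (phase_N), and N_M
    is finite as alpha <> n (N_group_seq). Its kernel consists of the positive
    automorphisms, with gamma, delta > 0. The logarithms of gamma and delta then
    solve a linear system, which has a nonzero solution only if all the numbers
    ( * ) are defined and equal to 1 (Autf_weights).

    One-parameter groups. Substitution by a positive automorphism H is
    triangular for a suitable order of the monomials, with positive eigenvalues.
    By Newton interpolation the coefficients of the m-th iterate of H are
    exponential polynomials in m, so that the iterates H^t make sense for real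
    t. Their defect vanishes for natural t, and an exponential polynomial that
    vanishes at all natural numbers is zero: all the H^t are automorphisms
    (flow_aut).

    Tangent fields. If gamma = delta = 1, the derivative of H^t at t = 0 is a
    vector field (xi, eta) tangent to the hypersurface, and nonzero unless H is
    the identity (log_field_tangent, tangent_to_identity). The leading exponents
    are compared one power w^j at a time: alpha x + n \bar x = (j + 1 - mu) y,
    where x and y are the coefficients of z w^j in xi and of w^(j+1) in eta, and
    y is real. As alpha <> n, also x is real, and (alpha + n) x = (j + 1 - mu) y
    for all points of the invariant set. Either x = y = 0, and then the whole
    level vanishes, or all the numbers ( * ) are equal to j + 1 (tangent_rigid).

    So without a common value k of the numbers ( * ) only the identity is
    positive, and the group is a subgroup of N_M. With a common value k, an
    automorphism is determined by its k-jet (Autf_jet_inj), and the k-jets of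
    the positive automorphisms are trivial or form a line for k >= 2, and a
    curve s |-> s V + s^theta W with s > 0 for k = 1 (positive_sheet). The jets
    of the whole group are finitely many disjoint translates of this arc, one
    for each phase. They are closed among the invertible jets, because the
    boundary points of the arcs are degenerate; hence they form a closed
    submanifold of dimension one (arcs_submanifold, jet_embedding_arcs). *)

(** * The ring of formal power series *)

Section MultiIndices.
Variable n : nat.
Implicit Types (m a e : midx n).

Definition madd a (b : midx n) : midx n := [ffun i => a i + b i]%N.

Lemma maddE a b i : madd a b i = (a i + b i)%N.
Proof. by rewrite ffunE. Qed.

Lemma maddC a b : madd a b = madd b a.
Proof. by apply/ffunP => i; rewrite !ffunE addnC. Qed.

Lemma maddA a b e : madd a (madd b e) = madd (madd a b) e.
Proof. by apply/ffunP => i; rewrite !ffunE addnA. Qed.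

Lemma madd0 a : madd (midx0 n) a = a.
Proof. by apply/ffunP => i; rewrite !ffunE. Qed.

Lemma maddI a : injective (madd a).
Proof.
move=> b e /ffunP eq_be; apply/ffunP => i.
by move: (eq_be i); rewrite !ffunE => /addnI.
Qed.

Lemma mdegD a b : mdeg (madd a b) = (mdeg a + mdeg b)%N.
Proof.
by rewrite /mdeg -big_split; apply: eq_bigr => i _; rewrite ffunE.
Qed.

Lemma leq_mdeg a i : (a i <= mdeg a)%N.
Proof. by rewrite /mdeg (bigD1 i) //= leq_addr. Qed.

Lemma mdeg0 : mdeg (midx0 n) = 0%N.
Proof. by rewrite /mdeg big1 // => i _; rewrite ffunE. Qed.

Lemma mdeg_eq0 a : (mdeg a == 0%N) = (a == midx0 n).
Proof.
apply/eqP/eqP => [a0|->]; last exact: mdeg0.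
apply/ffunP => i; rewrite ffunE; apply/eqP.
by rewrite -leqn0 -a0 leq_mdeg.
Qed.

Lemma mdeg1 i : mdeg (midx1 i : midx n) = 1%N.
Proof.
rewrite /mdeg (bigD1 i) //= ffunE eqxx big1 ?addn0 // => j /negbTE ij.
by rewrite ffunE ij.
Qed.

(** Indexing products by a list of pairs, instead of the bounded tuples that
    subtract from m, makes the index set symmetric and reindexing possible. *)
Definition splits m : seq (midx n * midx n) :=
  [seq (bounded_midx b, [ffun i => (m i - b i)%N] : midx n)
     | b <- enum [pred b : {ffun 'I_n -> 'I_(mdeg m).+1}
                  | [forall i, (b i <= m i)%N]]].

Lemma bounded_midx_inj d : injective (@bounded_midx n d).
Proof.
move=> /= b c /ffunP bc; apply/ffunP => i; apply: val_inj.
by move: (bc i); rewrite !ffunE.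
Qed.

Lemma splits_uniq m : uniq (splits m).
Proof.
by rewrite map_inj_uniq ?enum_uniq // => b c [/bounded_midx_inj].
Qed.

Lemma mem_splits m a b : ((a, b) \in splits m) = (madd a b == m).
Proof.
apply/mapP/eqP => [[c]|<-].
  rewrite mem_enum inE => /forallP cm [-> ->].
  by apply/ffunP => i; rewrite !ffunE subnKC.
have ha i : (a i < (mdeg (madd a b)).+1)%N.
  by rewrite ltnS (leq_trans _ (leq_mdeg _ i)) // ffunE leq_addr.
exists [ffun i => Ordinal (ha i)].
  by rewrite mem_enum inE; apply/forallP => i; rewrite !ffunE /= leq_addr.
by congr pair; apply/ffunP => i; rewrite !ffunE //= addKn.
Qed.

Lemma splitsP m p : reflect (madd p.1 p.2 = m) (p \in splits m).
Proof. by case: p => a b; rewrite mem_splits; apply: eqP. Qed.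

Definition box d : seq (midx n) :=
  [seq bounded_midx b | b <- enum {: {ffun 'I_n -> 'I_d}}].

Lemma box_uniq d : uniq (box d).
Proof. by rewrite map_inj_uniq ?enum_uniq //; apply: bounded_midx_inj. Qed.

Lemma mem_box d a : (a \in box d) = [forall i, (a i < d)%N].
Proof.
apply/mapP/forallP => [[b _ ->] i|ha]; first by rewrite ffunE.
exists [ffun i => Ordinal (ha i)]; first by rewrite mem_enum.
by apply/ffunP => i; rewrite !ffunE.
Qed.

Lemma mem_box_mdeg d a : (mdeg a < d)%N -> a \in box d.
Proof.
by move=> ad; rewrite mem_box; apply/forallP => i; apply: leq_ltn_trans ad; apply: leq_mdeg.
Qed.

Lemma notin_box_mdeg d a : a \notin box d -> (d <= mdeg a)%N.
Proof. by rewrite leqNgt; apply: contra; apply: mem_box_mdeg. Qed.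

End MultiIndices.

Section SeriesRing.
Variables (K : comNzRingType) (n : nat).
Implicit Types (f g h : fps K n) (m a b e : midx n).

HB.instance Definition _ := gen_eqMixin (fps K n).
HB.instance Definition _ := gen_choiceMixin (fps K n).

Definition fps_add f g : fps K n := fun m => f m + g m.
Definition fps_opp f : fps K n := fun m => - f m.
Definition fps_zero : fps K n := fun=> 0.

Fact fps_addA : associative fps_add.
Proof. by move=> f g h; apply/funext => m; apply: addrA. Qed.
Fact fps_addC : commutative fps_add.
Proof. by move=> f g; apply/funext => m; apply: addrC. Qed.
Fact fps_add0 : left_id fps_zero fps_add.
Proof. by move=> f; apply/funext => m; apply: add0r. Qed.
Fact fps_addN : left_inverse fps_zero fps_opp fps_add.
Proof. by move=> f; apply/funext => m; apply: addNr. Qed.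

HB.instance Definition _ :=
  GRing.isZmodule.Build (fps K n) fps_addA fps_addC fps_add0 fps_addN.

Lemma fps_mulE f g m : fps_mul f g m = \sum_(p <- splits m) f p.1 * g p.2.
Proof. by rewrite /fps_mul big_map big_enum. Qed.

Fact fps_mulA : associative (@fps_mul K n).
Proof.
move=> f g h; apply/funext => m; rewrite !fps_mulE.
under eq_bigr => p _ do rewrite fps_mulE mulr_sumr.
under [RHS]eq_bigr => p _ do rewrite fps_mulE mulr_suml.
pose F (t : midx n * midx n * midx n) := f t.1.1 * (g t.1.2 * h t.2).
transitivity (\sum_(t <- [seq (p.1, q.1, q.2) | p <- splits m,
    q <- splits p.2]) F t); first by rewrite big_allpairs_dep.
transitivity (\sum_(t <- [seq (q.1, q.2, p.2) | p <- splits m,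
    q <- splits p.1]) F t); last first.
  by rewrite big_allpairs_dep; do 2 apply: eq_bigr => ? _; rewrite /F mulrA.
apply: perm_big; apply: uniq_perm.
- apply: allpairs_uniq_dep => [|p _|]; rewrite ?splits_uniq //.
  move=> u v /allpairsPdep[[p1 p2] [[q1 q2] [_ /splitsP /= <- ->]]].
  by move=> /allpairsPdep[[p1' p2'] [[q1' q2'] [_ /splitsP /= <- ->]]] [-> -> ->].
- apply: allpairs_uniq_dep => [|p _|]; rewrite ?splits_uniq //.
  move=> u v /allpairsPdep[[p1 p2] [[q1 q2] [_ /splitsP /= <- ->]]].
  by move=> /allpairsPdep[[p1' p2'] [[q1' q2'] [_ /splitsP /= <- ->]]] [-> -> ->].
move=> [[a b] c]; apply/allpairsPdep/allpairsPdep.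
  move=> [[p1 p2] [[q1 q2] [/splitsP /= <- /splitsP /= <- [-> -> ->]]]].
  by exists (madd p1 q1, q2), (p1, q1); rewrite !mem_splits /= maddA !eqxx.
move=> [[p1 p2] [[q1 q2] [/splitsP /= <- /splitsP /= <- [-> -> ->]]]].
by exists (q1, madd q2 p2), (q2, p2); rewrite !mem_splits /= maddA !eqxx.
Qed.

Fact fps_mulC : commutative (@fps_mul K n).
Proof.
move=> f g; apply/funext => m; rewrite !fps_mulE.
rewrite (perm_big [seq (p.2, p.1) | p <- splits m]) /=; last first.
  apply: uniq_perm; rewrite ?splits_uniq //.
    by rewrite map_inj_uniq ?splits_uniq // => -[a b] [a' b'] [-> ->].
  move=> [a b]; rewrite mem_splits; apply/eqP/mapP => [<-|[[c d]]].
    by exists (b, a) => //; rewrite mem_splits maddC.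
  by move=> /splitsP <- [-> ->]; rewrite maddC.
by rewrite big_map; apply: eq_bigr => p _; rewrite mulrC.
Qed.

Fact fps_mul1 : left_id (@fps_one K n) (@fps_mul K n).
Proof.
move=> f; apply/funext => m; rewrite fps_mulE.
rewrite (bigD1_seq (midx0 n, m)) ?splits_uniq ?mem_splits ?madd0 //=.
rewrite /fps_one eqxx mul1r big_seq_cond big1 ?addr0 // => -[a b] /=.
rewrite mem_splits xpair_eqE => /andP[/eqP <-].
by have [->|] := eqVneq a; rewrite ?mul0r ?madd0 ?eqxx.
Qed.

Fact fps_mulDl : left_distributive (@fps_mul K n) +%R.
Proof.
move=> f g h; apply/funext => m.
transitivity (fps_mul f h m + fps_mul g h m); last by [].
by rewrite !fps_mulE -big_split; apply: eq_bigr => p _; apply: mulrDl.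
Qed.

Fact fps_one_neq0 : @fps_one K n != 0.
Proof.
apply/eqP => /(congr1 (fun f => f (midx0 n))); rewrite /fps_one eqxx.
by move/eqP; rewrite oner_eq0.
Qed.

HB.instance Definition _ := GRing.Zmodule_isComNzRing.Build (fps K n)
  fps_mulA fps_mulC fps_mul1 fps_mulDl fps_one_neq0.

Lemma fpsD f g m : (f + g) m = f m + g m. Proof. by []. Qed.
Lemma fpsN f m : (- f) m = - f m. Proof. by []. Qed.
Lemma fpsB f g m : (f - g) m = f m - g m. Proof. by []. Qed.
Lemma fps0 m : (0 : fps K n) m = 0. Proof. by []. Qed.
Lemma fps1 m : (1 : fps K n) m = (m == midx0 n)%:R. Proof. by []. Qed.
Lemma fpsM f g m : (f * g) m = \sum_(p <- splits m) f p.1 * g p.2.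
Proof. exact: fps_mulE. Qed.

Lemma fpsMn f k m : (f *+ k) m = f m *+ k.
Proof. by elim: k => // k IH; rewrite !mulrS fpsD IH. Qed.

Lemma fps_sum (I : Type) (r : seq I) (P : pred I) (F : I -> fps K n) m :
  (\sum_(i <- r | P i) F i) m = \sum_(i <- r | P i) F i m.
Proof. by elim/big_rec2: _ => // i x y _ <-. Qed.

Lemma fps_expE f k : fps_exp f k = f ^+ k.
Proof. by elim: k => //= k ->; rewrite exprS. Qed.

Lemma fps_monomialE N (G : 'I_N -> fps K n) (I : midx N) :
  fps_monomial G I = \prod_i G i ^+ I i.
Proof. by apply: eq_bigr => i _; apply: fps_expE. Qed.

Definition fcst (c : K) : fps K n := fun m => if m == midx0 n then c else 0.

Lemma fcstM c f m : (fcst c * f) m = c * f m.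
Proof.
rewrite fpsM (bigD1_seq (midx0 n, m)) ?splits_uniq ?mem_splits ?madd0 //=.
rewrite /fcst eqxx big_seq_cond big1 ?addr0 // => -[a b] /=.
rewrite mem_splits xpair_eqE => /andP[/eqP <-].
by have [->|] := eqVneq a; rewrite ?mul0r ?madd0 ?eqxx.
Qed.

Fact fcst_additive : additive fcst.
Proof.
by move=> c d; apply/funext => m; rewrite fpsB /fcst; case: eqP; rewrite ?subr0.
Qed.
HB.instance Definition _ :=
  GRing.isAdditive.Build K (fps K n) fcst fcst_additive.

Fact fcst_multiplicative : multiplicative fcst.
Proof.
split=> [c d|]; apply/funext => m; last by rewrite fps1 /fcst; case: eqP.
by rewrite fcstM /fcst; case: eqP; rewrite ?mulr0.
Qed.
HB.instance Definition _ :=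
  GRing.isMultiplicative.Build K (fps K n) fcst fcst_multiplicative.

(** Supports add up under products. All the coefficients along the hypersurface
    are computed by excluding exponents in this way. *)
Lemma fpsM_neq0 f g m : (f * g) m != 0 ->
  exists a b, [/\ madd a b = m, f a != 0 & g b != 0].
Proof.
rewrite fpsM; apply: contra_neqP => nex; rewrite big_seq big1 // => -[a b].
rewrite mem_splits => /eqP abm; apply/eqP; apply: contra_notT nex.
by move=> fg; exists a, b; split=> //; apply: contra_neq fg => /= ->;
   rewrite ?mul0r ?mulr0.
Qed.

Definition order_ge (d : nat) f := forall m, (mdeg m < d)%N -> f m = 0.

Lemma order_ge0 f : order_ge 0 f. Proof. by []. Qed.

Lemma order_geW d d' f : (d <= d')%N -> order_ge d' f -> order_ge d f.
Proof. by move=> dd' fd' m md; apply: fd'; apply: leq_trans dd'. Qed.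

Lemma order_ge1 f : order_ge 1 f <-> f (midx0 n) = 0.
Proof.
split=> [|f0 m]; first by apply; rewrite mdeg0.
by rewrite ltnS leqn0 mdeg_eq0 => /eqP ->.
Qed.

Lemma order_geD d f g : order_ge d f -> order_ge d g -> order_ge d (f + g).
Proof. by move=> fd gd m md; rewrite fpsD fd ?gd ?addr0. Qed.

Lemma order_geN d f : order_ge d f -> order_ge d (- f).
Proof. by move=> fd m md; rewrite fpsN fd ?oppr0. Qed.

Lemma order_ge_sum (I : Type) (r : seq I) (P : pred I) (F : I -> fps K n) d :
  (forall i, P i -> order_ge d (F i)) -> order_ge d (\sum_(i <- r | P i) F i).
Proof.
move=> hF; elim/big_rec: _ => [//|i g Pi gd].
by apply: order_geD gd; apply: hF.
Qed.

Lemma order_geM d d' f g : order_ge d f -> order_ge d' g ->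
  order_ge (d + d') (f * g).
Proof.
move=> fd ge m md; rewrite fpsM big_seq big1 // => -[a b].
rewrite mem_splits => /eqP abm; move: md; rewrite -abm mdegD /=.
have [ad _|da] := ltnP (mdeg a) d; first by rewrite fd ?mul0r.
by rewrite -(leq_add2r (mdeg b)) in da; move=> /(leq_ltn_trans da); rewrite ltn_add2l => be; rewrite ge ?mulr0.
Qed.

Lemma order_geMl d f g : order_ge d g -> order_ge d (f * g).
Proof. by move=> gd; apply: (@order_geM 0). Qed.

Lemma order_geX d f k : order_ge d f -> order_ge (k * d) (f ^+ k).
Proof.
move=> fd; elim: k => [|k IH]; first by rewrite mul0n.
by rewrite exprS mulSn; apply: order_geM.
Qed.

End SeriesRing.

Arguments fcst {K} n c.

(** * Composition of power series *)

Section Composition.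
Variable K : comNzRingType.

Definition mpow n m (G : 'I_n -> fps K m) (a : midx n) : fps K m :=
  \prod_i G i ^+ a i.

(** The tuples that can be substituted into power series. *)
Definition null n m (G : 'I_n -> fps K m) := forall i, G i (midx0 m) = 0.

Section Basics.
Variables n m : nat.
Implicit Types (F : fps K n) (G : 'I_n -> fps K m).

Lemma mpowD G a b : mpow G (madd a b) = mpow G a * mpow G b.
Proof.
by rewrite /mpow -big_split; apply: eq_bigr => i _; rewrite maddE exprD.
Qed.

Lemma mpow0 G : mpow G (midx0 n) = 1.
Proof. by rewrite /mpow big1 // => i _; rewrite ffunE expr0. Qed.

Lemma mpow1 G i : mpow G (midx1 i) = G i.
Proof.
rewrite /mpow (bigD1 i) //= ffunE eqxx expr1 big1 ?mulr1 // => j /negbTE ij.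
by rewrite ffunE ij expr0.
Qed.

Lemma order_ge_mpow G a : null G -> order_ge (mdeg a) (mpow G a).
Proof.
move=> G0; rewrite /mpow /mdeg; elim/big_rec2: _ => [|i f d _ fd].
  exact: order_ge0.
by apply: order_geM fd; rewrite -[d in order_ge d]muln1; apply: order_geX; apply/order_ge1.
Qed.

Lemma big_box_sub (V : zmodType) d d' (f : midx n -> V) : (d <= d')%N ->
  \sum_(a <- box n d) f a = \sum_(a <- box n d' | a \in box n d) f a.
Proof.
move=> dd'; rewrite -[RHS]big_filter; apply: perm_big; apply: uniq_perm.
- exact: box_uniq.
- by rewrite filter_uniq ?box_uniq.
move=> a; rewrite mem_filter; have [|//] := boolP (a \in box n d).
rewrite !mem_box => /forallP ad; apply/esym/forallP => i.
exact: leq_trans dd'.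
Qed.

(** The range of summation may be enlarged at will, since monomials of degree
    beyond that of e do not reach X^e. So a single range serves all the
    coefficients and all the series of an identity. *)
Lemma fps_compE d F G e : null G -> (mdeg e < d)%N ->
  fps_comp F G e = \sum_(a <- box n d) F a * mpow G a e.
Proof.
move=> G0 ed; rewrite [RHS](bigID (mem (box n (mdeg e).+1))) /=.
rewrite -big_box_sub // [X in _ + X]big1 ?addr0; last first.
  by move=> a /notin_box_mdeg ea; rewrite order_ge_mpow ?mulr0.
rewrite /fps_comp big_map big_enum; apply: eq_bigr => b _.
by rewrite fps_monomialE.
Qed.

Lemma fps_compD F F' G : fps_comp (F + F') G = fps_comp F G + fps_comp F' G.
Proof.
apply/funext => e; rewrite fpsD /fps_comp -big_split.
by apply: eq_bigr => b _; rewrite fpsD mulrDl.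
Qed.

Lemma fps_compN F G : fps_comp (- F) G = - fps_comp F G.
Proof.
apply/funext => e; rewrite fpsN /fps_comp -sumrN.
by apply: eq_bigr => b _; rewrite fpsN mulNr.
Qed.

Lemma fps_compB F F' G : fps_comp (F - F') G = fps_comp F G - fps_comp F' G.
Proof. by rewrite fps_compD fps_compN. Qed.

Lemma fps_comp0 G : fps_comp 0 G = 0.
Proof. by rewrite -(subrr 0) fps_compB subrr. Qed.

Lemma fps_comp_sum (I : Type) (r : seq I) (P : pred I) (F : I -> fps K n) G :
  fps_comp (\sum_(i <- r | P i) F i) G = \sum_(i <- r | P i) fps_comp (F i) G.
Proof.
elim/big_rec2: _ => [|i x y _ <-]; first exact: fps_comp0.
by rewrite fps_compD.
Qed.

Lemma order_ge_comp d F G : null G -> order_ge d F -> order_ge d (fps_comp F G).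
Proof.
move=> G0 Fd e ed; rewrite (@fps_compE d) // big1_seq // => a _.
have [ad|da] := ltnP (mdeg a) d; first by rewrite Fd ?mul0r.
by rewrite order_ge_mpow ?mulr0 //; apply: leq_trans da.
Qed.

(** The product of two polynomial truncations is a sum over pairs; grouping the
    pairs by their sum gives the truncation of the product. *)
Lemma fps_compM F F' G : null G ->
  fps_comp (F * F') G = fps_comp F G * fps_comp F' G.
Proof.
move=> G0; apply/funext => e; rewrite fpsM; set d := (mdeg e).+1.
rewrite (@fps_compE d) //.
pose T (p : midx n * midx n) := F p.1 * F' p.2 * mpow G (madd p.1 p.2) e.
transitivity (\sum_(p <- [seq q | c <- box n d, q <- splits c]) T p).
  rewrite big_allpairs_dep; apply: eq_bigr => c _; rewrite fpsM mulr_suml.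
  by rewrite !big_seq; apply: eq_bigr => p /splitsP <-.
transitivity (\sum_(p <- [seq (a, b) | a <- box n d, b <- box n d]) T p).
  rewrite [RHS](bigID (fun p => madd p.1 p.2 \in box n d)) /=.
  rewrite [X in _ = _ + X]big1 ?addr0 => [|p /notin_box_mdeg pd]; last first.
    by rewrite /T order_ge_mpow ?mulr0.
  rewrite -[RHS]big_filter; apply: perm_big; apply: uniq_perm.
  - apply: allpairs_uniq_dep => [|c _|]; rewrite ?splits_uniq ?box_uniq //.
    move=> u v /allpairsPdep[c [q [_ /splitsP <- ->]]].
    by move=> /allpairsPdep[c' [q' [_ /splitsP <- ->]]] /= ->.
  - rewrite filter_uniq //; apply: allpairs_uniq; rewrite ?box_uniq //.
    by move=> [a b] [a' b'] _ _ [-> ->].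
  move=> [a b]; rewrite mem_filter /=; apply/allpairsPdep/andP.
    move=> [c [[p q] [cd /splitsP /= pqc [-> ->]]]]; subst c; split=> //.
    apply/allpairsP; exists (p, q); move: cd; rewrite !mem_box /= => /forallP h.
    by split=> //; apply/forallP => i; apply: leq_ltn_trans (h i);
      rewrite maddE ?leq_addr ?leq_addl.
  move=> [abd _]; exists (madd a b), (a, b).
  by rewrite mem_splits eqxx.
rewrite big_allpairs_dep.
transitivity (\sum_(p <- splits e) \sum_(a <- box n d) \sum_(b <- box n d)
    (F a * mpow G a p.1) * (F' b * mpow G b p.2)).
  rewrite [RHS]exchange_big; apply: eq_bigr => a _ /=.
  rewrite [RHS]exchange_big; apply: eq_bigr => b _ /=.
  rewrite /T mpowD fpsM mulr_sumr; apply: eq_bigr => p _ /=; ring.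
rewrite !big_seq; apply: eq_bigr => -[a b]; rewrite mem_splits => /eqP abe.
rewrite !(@fps_compE d) //= ?/d ?ltnS -?abe ?mdegD ?leq_addr ?leq_addl //.
by rewrite mulr_suml; apply: eq_bigr => c _; rewrite mulr_sumr.
Qed.

Lemma fps_comp_cst c G : null G -> fps_comp (fcst n c) G = fcst m c.
Proof.
move=> G0; apply/funext => e; rewrite (@fps_compE (mdeg e).+1) //.
rewrite (bigD1_seq (midx0 n)) ?box_uniq //= ?mem_box_mdeg ?mdeg0 //.
rewrite mpow0 fps1 big1 ?addr0 => [|a /negbTE a0]; last first.
  by rewrite /fcst a0 mul0r.
by rewrite /fcst eqxx; case: eqP; rewrite ?mulr1 ?mulr0.
Qed.

Lemma fps_comp1 G : null G -> fps_comp 1 G = 1.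
Proof.
by move=> G0; have := fps_comp_cst 1 G0; rewrite !rmorph1.
Qed.

Lemma fps_compX F G k : null G -> fps_comp (F ^+ k) G = fps_comp F G ^+ k.
Proof.
move=> G0; elim: k => [|k IH]; first by rewrite !expr0 fps_comp1.
by rewrite !exprS fps_compM // IH.
Qed.

Lemma fps_comp_prod (I : Type) (r : seq I) (F : I -> fps K n) G : null G ->
  fps_comp (\prod_(i <- r) F i) G = \prod_(i <- r) fps_comp (F i) G.
Proof.
move=> G0; elim/big_rec2: _ => [|i x y _ <-]; first exact: fps_comp1.
by rewrite fps_compM.
Qed.

Lemma fps_comp_var i G : null G -> fps_comp (fps_var K i) G = G i.
Proof.
move=> G0; apply/funext => e; rewrite (@fps_compE (mdeg e).+2) //.
rewrite (bigD1_seq (midx1 i)) ?box_uniq //= ?mem_box_mdeg ?mdeg1 //.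
rewrite mpow1 big1 ?addr0 => [|a /negbTE a0]; last first.
  by rewrite /fps_var a0 mul0r.
by rewrite /fps_var eqxx mul1r.
Qed.

Lemma fps_comp_const F G : null G -> fps_comp F G (midx0 m) = F (midx0 n).
Proof.
move=> G0; rewrite (@fps_compE 1) ?mdeg0 //.
rewrite (bigD1_seq (midx0 n)) ?box_uniq //= ?mem_box_mdeg ?mdeg0 //.
rewrite mpow0 fps1 eqxx mulr1 big1 ?addr0 // => a.
rewrite -mdeg_eq0 -lt0n => a0; rewrite order_ge_mpow ?mulr0 //.
by rewrite mdeg0.
Qed.

Lemma null_comp k (G : 'I_k -> fps K n) (H : 'I_n -> fps K m) :
  null G -> null H -> null (fun i => fps_comp (G i) H).
Proof. by move=> G0 H0 i; rewrite fps_comp_const. Qed.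

End Basics.

Lemma mpow_comp k n m (G : 'I_k -> fps K n) (H : 'I_n -> fps K m) a :
  null H -> fps_comp (mpow G a) H = mpow (fun i => fps_comp (G i) H) a.
Proof.
by move=> H0; rewrite fps_comp_prod //; apply: eq_bigr => i _; rewrite fps_compX.
Qed.

(** Both sides are continuous in F, so that it may be replaced by a
    polynomial. *)
Lemma fps_compA k n m (F : fps K k) (G : 'I_k -> fps K n) (H : 'I_n -> fps K m) :
  null G -> null H ->
  fps_comp (fps_comp F G) H = fps_comp F (fun i => fps_comp (G i) H).
Proof.
move=> G0 H0; apply/funext => e; set d := (mdeg e).+1.
have GH0 := null_comp G0 H0.
pose p : fps K n := \sum_(a <- box k d) fcst n (F a) * mpow G a.
have Fp : order_ge d (fps_comp F G - p).
  move=> b bd; rewrite fpsB (@fps_compE _ _ d) // /p fps_sum.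
  by under [X in _ - X]eq_bigr => a _ do rewrite fcstM; rewrite subrr.
have -> : fps_comp (fps_comp F G) H e = fps_comp p H e.
  apply/eqP; rewrite -subr_eq0 -fpsB -fps_compB; apply/eqP.
  exact: order_ge_comp Fp _ _.
rewrite fps_comp_sum fps_sum (@fps_compE _ _ d) //; apply: eq_bigr => a _.
by rewrite fps_compM // fps_comp_cst // fcstM mpow_comp.
Qed.

Lemma mpow_var n (a : midx n) : mpow (@fps_var K n) a = fun e => (e == a)%:R.
Proof.
have mono (b : midx n) (f : fps K n) (e : midx n) i :
    f = (fun e => (e == b)%:R) ->
    (fps_var K i * f) e = (e == madd (midx1 i) b)%:R.
  move=> ->; rewrite fpsM; have [->|neq] := eqVneq e.
    rewrite (bigD1_seq (midx1 i, b)) ?splits_uniq ?mem_splits //=.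
    rewrite /fps_var !eqxx mulr1 big1 ?addr0 // => -[c d].
    rewrite xpair_eqE negb_and => /orP[|] /negbTE /= ->; by rewrite ?mul0r ?mulr0.
  rewrite big_seq big1 // => -[c d]; rewrite mem_splits => /eqP cde /=.
  rewrite /fps_var; have [c1|] := eqVneq c; last by rewrite mul0r.
  have [d1|] := eqVneq d; last by rewrite mulr0.
  by move: neq; rewrite -cde c1 d1 eqxx.
have [d] := ubnP (mdeg a); elim: d a => // d IH a.
have [->|a0 ad] := eqVneq a (midx0 n).
  by move=> _; rewrite mpow0; apply/funext.
have [i ai] : exists i, (0 < a i)%N.
  apply/existsP; apply: contraNT a0 => /existsPn h; apply/eqP/ffunP => i.
  by rewrite ffunE; have := h i; rewrite -eqn0Ngt => /eqP.
pose b : midx n := [ffun j => (a j - (j == i))%N].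
have abE : a = madd (midx1 i) b.
  apply/ffunP => j; rewrite !ffunE subnKC //.
  by case: eqP => // ->.
rewrite {1}abE mpowD mpow1; apply/funext => e.
rewrite (mono b) -?abE // IH //; move: ad; rewrite {1}abE mdegD mdeg1.
by rewrite add1n ltnS.
Qed.

Lemma null_var n : null (@fps_var K n).
Proof.
move=> i; rewrite /fps_var; case: eqP => // /ffunP /(_ i).
by rewrite !ffunE eqxx.
Qed.

Lemma fps_comp_id n (F : fps K n) : fps_comp F (@fps_var K n) = F.
Proof.
apply/funext => e; rewrite (@fps_compE _ _ (mdeg e).+1) //; last exact: null_var.
rewrite (bigD1_seq e) ?box_uniq //= ?mem_box_mdeg // mpow_var eqxx mulr1.
by rewrite big1 ?addr0 // => a /negbTE ae; rewrite mpow_var eq_sym ae mulr0.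
Qed.

End Composition.

Section CoefficientMaps.
Variables (K L : comNzRingType) (s : {rmorphism K -> L}).

Definition fps_map n (f : fps K n) : fps L n := fun m => s (f m).

Lemma fps_map1 n : fps_map (1 : fps K n) = 1.
Proof. by apply/funext => m; rewrite /fps_map !fps1 rmorph_nat. Qed.

Lemma fps_mapM n (f g : fps K n) : fps_map (f * g) = fps_map f * fps_map g.
Proof.
apply/funext => m; rewrite /fps_map !fpsM rmorph_sum.
by apply: eq_bigr => p _; rewrite rmorphM.
Qed.

Lemma fps_mapX n (f : fps K n) k : fps_map (f ^+ k) = fps_map f ^+ k.
Proof.
by elim: k => [|k IH]; rewrite ?expr0 ?fps_map1 // !exprS fps_mapM IH.
Qed.

Lemma fps_map_var n (i : 'I_n) : fps_map (fps_var K i) = fps_var L i.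
Proof. by apply/funext => m; rewrite /fps_map /fps_var rmorph_nat. Qed.

Lemma fps_map_comp n m (F : fps K n) (G : 'I_n -> fps K m) :
  fps_map (fps_comp F G) = fps_comp (fps_map F) (fun i => fps_map (G i)).
Proof.
apply/funext => e; rewrite {1}/fps_map /fps_comp rmorph_sum.
apply: eq_bigr => b _; rewrite rmorphM; congr (_ * _).
rewrite !fps_monomialE -[LHS]/(fps_map _ e); congr (_ e).
elim/big_rec2: _ => [|i x y _ <-]; first exact: fps_map1.
by rewrite fps_mapM fps_mapX.
Qed.

End CoefficientMaps.

(** * Inverses of formal maps *)

Section UnitMultiIndices.
Variable n : nat.

Lemma midx1_inj : injective (@midx1 n).
Proof.
by move=> i k /ffunP /(_ i); rewrite !ffunE eqxx; case: eqP.
Qed.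

Lemma mdeg1E (a : midx n) : mdeg a = 1%N -> exists i, a = midx1 i.
Proof.
move=> a1; have [i ai] : exists i, (0 < a i)%N.
  apply/existsP; apply: contraT => /existsPn h.
  suff : mdeg a = 0%N by rewrite a1.
  by rewrite /mdeg big1 // => i _; apply/eqP; rewrite -leqn0 leqNgt h.
exists i; move: a1; rewrite /mdeg (bigD1 i) //= => a1.
have ai1 : a i = 1%N.
  by apply/eqP; rewrite eqn_leq ai andbT -a1 leq_addr.
apply/ffunP => j; rewrite ffunE; have [->|ji] := eqVneq j i; first by rewrite ai1.
move: a1; rewrite ai1 (bigD1 j) //= => /eqP.
by rewrite -[X in _ == X]addn0 eqn_add2l addn_eq0 => /andP[/eqP].
Qed.

End UnitMultiIndices.

Section Convergence.
Variables (K : comNzRingType) (n : nat).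

(** With order_ge k (F k) for all k, the terms beyond the degree of e do not
    contribute to the coefficient of X^e. *)
Definition fsum (F : nat -> fps K n) : fps K n := fun e =>
  \sum_(k < (mdeg e).+1) F k e.

Lemma fsum_partial F d : (forall k, order_ge k (F k)) ->
  order_ge d (fsum F - \sum_(k < d) F k).
Proof.
move=> Fk e ed; rewrite fpsB fps_sum /fsum; symmetry; apply/eqP.
rewrite eq_sym subr_eq0; apply/eqP.
rewrite -!(big_mkord xpredT (fun k => F k e)) (big_cat_nat_idem _ (n := (mdeg e).+1) (p := d)) ?addr0 //=.
rewrite [X in _ + X]big_nat [X in _ + X]big1 ?addr0 // => k /andP[ek _].
  exact: Fk.
by rewrite addr0.
Qed.

Lemma order_ge_all (f : fps K n) : (forall d, order_ge d f) -> f = 0.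
Proof. by move=> fd; apply/funext => e; apply: (fd (mdeg e).+1). Qed.

End Convergence.

Section FormalInverses.
Variables (K : fieldType) (n : nat).
Implicit Types (F : fps K n) (T G H : 'I_n -> fps K n).

(** The geometric series of 1 - u / u(0) converges. *)
Lemma fps_unit (u : fps K n) : u (midx0 n) != 0 -> exists v, u * v = 1.
Proof.
set c := u _ => c0; pose h := 1 - fcst n c^-1 * u.
have h1 : order_ge 1 h.
  apply/order_ge1; rewrite /h fpsB fcstM fps1 eqxx -/c mulVf //.
  by rewrite subrr.
have hk k : order_ge k (h ^+ k) by rewrite -[k in order_ge k]muln1; apply: order_geX.
exists (fcst n c^-1 * fsum (GRing.exp h)); apply/eqP; rewrite -subr_eq0; apply/eqP.
apply: order_ge_all => d; set s := \sum_(k < d) h ^+ k.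
have -> : u * (fcst n c^-1 * fsum (GRing.exp h)) - 1
    = u * fcst n c^-1 * (fsum (GRing.exp h) - s) - h ^+ d.
  have -> : h ^+ d = 1 - (1 - h) * s.
    by rewrite -[1 - h]opprB mulNr opprK -subrX1; ring.
  by rewrite /h; ring.
apply: order_geD; last by apply: order_geN.
by apply: order_geMl; apply: fsum_partial.
Qed.

Definition jac T : 'M[K]_n := \matrix_(i, j) T i (midx1 j).

Lemma fps_comp_lin m (F : fps K m) (G : 'I_m -> fps K n) j : null G ->
  fps_comp F G (midx1 j) = \sum_i F (midx1 i) * G i (midx1 j).
Proof.
move=> G0; rewrite (@fps_compE _ _ _ 2) ?mdeg1 //.
rewrite (bigID (fun a => mdeg a == 1%N)) /= [X in _ + X]big1 ?addr0; last first.
  move=> a a1; have [a2|] := ltnP 1 (mdeg a).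
    by rewrite order_ge_mpow ?mulr0 // mdeg1.
  rewrite leq_eqVlt (negbTE a1) ltnS leqn0 mdeg_eq0 /= => /eqP ->.
  rewrite mpow0 fps1; case: eqP => [h|]; last by rewrite mulr0.
  by have := mdeg1 j; rewrite h mdeg0.
rewrite -big_filter (perm_big [seq midx1 i | i <- enum 'I_m]) /=; last first.
  apply: uniq_perm; rewrite ?filter_uniq ?box_uniq //.
    by rewrite map_inj_uniq ?enum_uniq //; apply: midx1_inj.
  move=> a; rewrite mem_filter; apply/andP/mapP => [[/eqP a1 _]|[i _ ->]].
    by have [i ->] := mdeg1E a1; exists i; rewrite ?mem_enum.
  by rewrite mdeg1 mem_box_mdeg ?mdeg1.
rewrite big_map big_enum; apply: eq_bigr => i _; by rewrite mpow1.
Qed.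

Lemma jac_comp T G : null G -> jac (fun i => fps_comp (T i) G) = jac T *m jac G.
Proof.
move=> G0; apply/matrixP => i j; rewrite !mxE fps_comp_lin //.
by apply: eq_bigr => k _; rewrite !mxE.
Qed.

Lemma jac_var : jac (@fps_var K n) = 1%:M.
Proof.
apply/matrixP => i j; rewrite !mxE /fps_var; congr (_%:R).
by rewrite (inj_eq (@midx1_inj n)) eq_sym.
Qed.

(** Each factor T i ^+ k differs from the power of the variable by a multiple
    of T i - X_i and of k - 1 further series without constant term. *)
Lemma mpow_near_id c T a : null T ->
    (forall i, order_ge c.+1 (T i - fps_var K i)) ->
  order_ge (mdeg a + c) (mpow T a - mpow (@fps_var K n) a).
Proof.
move=> T0 Tc.
have aux i k : order_ge (k + c) (T i ^+ k - fps_var K i ^+ k).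
  elim: k => [|k IH]; first by rewrite !expr0 subrr.
  have -> : T i ^+ k.+1 - fps_var K i ^+ k.+1 =
      (T i - fps_var K i) * T i ^+ k + fps_var K i * (T i ^+ k - fps_var K i ^+ k).
    by rewrite !exprS; ring.
  apply: order_geD.
    rewrite addSn addnC -addSn; apply: order_geM => //.
    by rewrite -[k in order_ge k]muln1; apply: order_geX; apply/order_ge1.
  rewrite addSn -add1n; apply: order_geM => //.
  by apply/order_ge1; apply: null_var.
rewrite /mpow /mdeg.
suff : order_ge (\sum_i a i + c)%N (\prod_i T i ^+ a i - \prod_i fps_var K i ^+ a i) /\
       order_ge (\sum_i a i)%N (\prod_i T i ^+ a i) by case.
elim/big_rec3: _ => [|i x y d _ [IH IH']].
  by rewrite subrr; split=> // m.
have Tia : order_ge (a i) (T i ^+ a i).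
  by rewrite -[in order_ge (a i)](muln1 (a i)); apply: order_geX; apply/order_ge1.
split; last by apply: order_geM.
have -> : T i ^+ a i * y - fps_var K i ^+ a i * x =
    (T i ^+ a i - fps_var K i ^+ a i) * y + fps_var K i ^+ a i * (y - x).
  by ring.
apply: order_geD; first by rewrite addnAC; apply: order_geM.
rewrite -addnA; apply: order_geM => //.
by rewrite -[in order_ge (a i)](muln1 (a i)); apply: order_geX; apply/order_ge1; apply: null_var.
Qed.

Lemma comp_near_id c T F d : null T ->
    (forall i, order_ge c.+1 (T i - fps_var K i)) -> order_ge d F ->
  order_ge (d + c) (fps_comp F T - F).
Proof.
move=> T0 Tc Fd e ed; rewrite -{2}(fps_comp_id F) fpsB.
rewrite !(@fps_compE _ _ _ (d + c)) //; last exact: null_var.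
rewrite -sumrB big1_seq // => a _; rewrite -mulrBr -fpsB.
have [ad|da] := ltnP (mdeg a) d; first by rewrite Fd ?mul0r.
rewrite (mpow_near_id T0 Tc) ?mulr0 //; apply: leq_trans ed _.
by rewrite leq_add2r.
Qed.

Lemma comp_tangent_id T F d : null T ->
    (forall i, order_ge 2 (T i - fps_var K i)) -> order_ge d F ->
  order_ge d.+1 (fps_comp F T - F).
Proof. by move=> T0 T2 Fd; rewrite -addn1; apply: comp_near_id. Qed.

(** If T is tangent to the identity, then F - F o T has larger order than F,
    and the equation G o T = F is solved by a geometric series. *)
Lemma comp_surj T F : null T -> (forall i, order_ge 2 (T i - fps_var K i)) ->
  exists G : fps K n, fps_comp G T = F.
Proof.
move=> T0 T2; pose W (G : fps K n) := G - fps_comp G T.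
pose G := fsum (fun k => iter k W F).
have Wk k : order_ge k (iter k W F).
  elim: k => [|k IH]; first exact: order_ge0.
  by rewrite iterS /W -opprB; apply/order_geN/comp_tangent_id.
exists G; apply/eqP; rewrite -subr_eq0; apply/eqP; apply: order_ge_all => d.
pose s := \sum_(k < d) iter k W F.
have -> : fps_comp G T - F = fps_comp (G - s) T - iter d W F.
  rewrite fps_compB -addrA; congr (_ + _).
  suff -> : iter d W F = F - fps_comp s T by rewrite opprB addrA addNr add0r.
  rewrite /s; elim: (d) => [|k IH]; first by rewrite big_ord0 fps_comp0 subr0.
  by rewrite iterS {1}/W {1}IH big_ord_recr fps_compD opprD addrA.
apply: order_geD; last by apply: order_geN.
by apply: order_ge_comp => //; apply: fsum_partial.
Qed.

(** A linear change of coordinates makes T tangent to the identity. *)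
Lemma left_inverse T : null T -> jac T \in unitmx ->
  exists2 L, null L & forall i, fps_comp (L i) T = fps_var K i.
Proof.
move=> T0 TU; pose J : 'I_n -> fps K n := fun i =>
  \sum_j fcst n (invmx (jac T) i j) * fps_var K j.
have J0 : null J.
  by move=> i; rewrite /J fps_sum big1 // => j _; rewrite fcstM null_var mulr0.
have jacJ : jac J = invmx (jac T).
  apply/matrixP => i j; rewrite !mxE /J fps_sum (bigD1 j) //= fcstM /fps_var eqxx mulr1.
  rewrite big1 ?addr0 // => k kj; rewrite fcstM; case: eqP; rewrite ?mulr0 //.
  by move/ffunP => /(_ k); rewrite !ffunE eqxx (negbTE kj).
pose S i := fps_comp (J i) T.
have S0 : null S by apply: null_comp.
have S2 i : order_ge 2 (S i - fps_var K i).
  move=> a; rewrite ltnS leq_eqVlt => /orP[/eqP /mdeg1E[j ->]|].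
    rewrite fpsB; have := jac_comp J T0; rewrite jacJ mulVmx // -jac_var.
    by move/matrixP => /(_ i j); rewrite !mxE -/(S i) => ->; rewrite subrr.
  by rewrite ltnS leqn0 mdeg_eq0 => /eqP ->; rewrite fpsB S0 null_var subrr.
have [G GS] := boolp.choice (fun i => comp_surj (fps_var K i) S0 S2).
have G0 : null G by move=> i; rewrite -(fps_comp_const (G i) S0) GS null_var.
exists (fun i => fps_comp (G i) J); first exact: null_comp.
by move=> i; rewrite fps_compA.
Qed.

(** The left inverse of a left inverse of T is T itself, so that left
    inverses are right inverses. *)
Lemma two_sided_inverse T : null T -> jac T \in unitmx ->
  exists L, [/\ null L, jac L \in unitmx,
    forall i, fps_comp (L i) T = fps_var K i
  & forall i, fps_comp (T i) L = fps_var K i].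
Proof.
move=> T0 TU; have [L L0 LT] := left_inverse T0 TU.
have LU : jac L \in unitmx.
  have := jac_comp L T0; rewrite (_ : (fun i => _) = @fps_var K n); last exact/funext.
  by rewrite jac_var => /esym/mulmx1_unit[].
have [S S0 SL] := left_inverse L0 LU.
exists L; split=> // i; rewrite -SL; congr (fps_comp _ L).
rewrite -[LHS](fps_comp_var i T0) -SL fps_compA //.
have -> : (fun j => fps_comp (L j) T) = @fps_var K n by apply/funext.
exact: fps_comp_id.
Qed.

End FormalInverses.

(** * Formal maps of the plane *)

Notation mcomp := Defs.map_comp.

Definition t2 (T : Type) (a b : T) : 'I_2 -> T := fun i => tnth [tuple a; b] i.
Definition t3 (T : Type) (a b c : T) : 'I_3 -> T :=
  fun i => tnth [tuple a; b; c] i.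
Definition t22 (T : Type) (f g : 'I_2 -> T) : 'I_(2 + 2) -> T :=
  fun i => match fintype.split i with inl j => f j | inr j => g j end.
Definition mi2 a b : midx 2 := [ffun i => t2 a b i].
Definition mi3 a b c : midx 3 := [ffun i => t3 a b c i].

Section Tuples.
Variable T : Type.

Lemma t22l (f g : 'I_2 -> T) j : t22 f g (lshift 2 j) = f j.
Proof. by rewrite /t22 (unsplitK (inl j)). Qed.

Lemma t22r (f g : 'I_2 -> T) j : t22 f g (rshift 2 j) = g j.
Proof. by rewrite /t22 (unsplitK (inr j)). Qed.

Lemma ord2P (P : 'I_2 -> Prop) : P 0 -> P 1 -> forall i, P i.
Proof.
move=> P0 P1; case=> -[|[|//]] i; first by rewrite (_ : Ordinal i = 0) //; apply: val_inj.
by rewrite (_ : Ordinal i = 1) //; apply: val_inj.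
Qed.

Lemma ord3P (P : 'I_3 -> Prop) : P 0 -> P 1 -> P ord_max -> forall i, P i.
Proof.
move=> P0 P1 P2; case=> -[|[|[|//]]] i.
- by rewrite (_ : Ordinal i = 0) //; apply: val_inj.
- by rewrite (_ : Ordinal i = 1) //; apply: val_inj.
by rewrite (_ : Ordinal i = ord_max) //; apply: val_inj.
Qed.

Lemma ord22P (P : 'I_(2 + 2) -> Prop) :
  (forall j, P (lshift 2 j)) -> (forall j, P (rshift 2 j)) -> forall i, P i.
Proof.
by move=> Pl Pr i; rewrite -(splitK i); case: (fintype.split i) => j /=.
Qed.

Lemma t2E0 (a b : T) : t2 a b 0 = a. Proof. by []. Qed.
Lemma t2E1 (a b : T) : t2 a b 1 = b. Proof. by []. Qed.
Lemma t3E0 (a b c : T) : t3 a b c 0 = a. Proof. by []. Qed.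
Lemma t3E1 (a b c : T) : t3 a b c 1 = b. Proof. by []. Qed.
Lemma t3E2 (a b c : T) : t3 a b c ord_max = c. Proof. by []. Qed.

End Tuples.

Lemma mi2E (e : midx 2) : e = mi2 (e 0) (e 1).
Proof. by apply/ffunP; apply: ord2P; rewrite ffunE. Qed.

Lemma mi3E (e : midx 3) : e = mi3 (e 0) (e 1) (e ord_max).
Proof. by apply/ffunP; apply: ord3P; rewrite ffunE. Qed.

Lemma mi2_inj a b a' b' : mi2 a b = mi2 a' b' -> a = a' /\ b = b'.
Proof. by move/ffunP => h; have := (h 0, h 1); rewrite !ffunE => -[]. Qed.

Lemma mi3_inj a b c a' b' c' :
  mi3 a b c = mi3 a' b' c' -> [/\ a = a', b = b' & c = c'].
Proof.
by move/ffunP => h; have := (h 0, h 1, h ord_max); rewrite !ffunE => -[[]].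
Qed.

Lemma madd_mi3 a b c a' b' c' :
  madd (mi3 a b c) (mi3 a' b' c') = mi3 (a + a') (b + b') (c + c').
Proof. by apply/ffunP; apply: ord3P; rewrite !ffunE. Qed.

Lemma mdeg_mi2 a b : mdeg (mi2 a b) = (a + b)%N.
Proof. by rewrite /mdeg !big_ord_recl big_ord0 !ffunE /= addn0. Qed.

Lemma mdeg_mi3 a b c : mdeg (mi3 a b c) = (a + b + c)%N.
Proof. by rewrite /mdeg !big_ord_recl big_ord0 !ffunE /= addn0 addnA. Qed.

Lemma midx0_2 : midx0 2 = mi2 0 0.
Proof. by apply/ffunP; apply: ord2P; rewrite !ffunE. Qed.

Lemma midx0_3 : midx0 3 = mi3 0 0 0.
Proof. by apply/ffunP; apply: ord3P; rewrite !ffunE. Qed.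

Lemma midx1_20 : midx1 (0 : 'I_2) = mi2 1 0.
Proof. by apply/ffunP; apply: ord2P; rewrite !ffunE. Qed.

Lemma midx1_21 : midx1 (1 : 'I_2) = mi2 0 1.
Proof. by apply/ffunP; apply: ord2P; rewrite !ffunE. Qed.

Lemma mpow_t2 (K : comNzRingType) m (F G : fps K m) a b :
  mpow (t2 F G) (mi2 a b) = F ^+ a * G ^+ b.
Proof.
by rewrite /mpow !big_ord_recl big_ord0 mulr1 !ffunE.
Qed.

Lemma mpow_t3 (K : comNzRingType) m (F G H : fps K m) a b c :
  mpow (t3 F G H) (mi3 a b c) = F ^+ a * G ^+ b * H ^+ c.
Proof.
by rewrite /mpow !big_ord_recl big_ord0 mulr1 !ffunE mulrA.
Qed.

Section NullTuples.
Variables (K : comNzRingType) (m : nat).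

Lemma null_t2 (F G : fps K m) :
  F (midx0 m) = 0 -> G (midx0 m) = 0 -> null (t2 F G).
Proof. by move=> F0 G0; apply: ord2P. Qed.

Lemma null_t3 (F G H : fps K m) :
  F (midx0 m) = 0 -> G (midx0 m) = 0 -> H (midx0 m) = 0 -> null (t3 F G H).
Proof. by move=> F0 G0 H0; apply: ord3P. Qed.

Lemma null_t22 (F G : 'I_2 -> fps K m) : null F -> null G -> null (t22 F G).
Proof. by move=> F0 G0; apply: ord22P => j; rewrite ?t22l ?t22r. Qed.

Lemma fpsM_null (f g : fps K m) : g (midx0 m) = 0 -> (f * g) (midx0 m) = 0.
Proof. by move=> /order_ge1 g1; apply/order_ge1; apply: order_geMl. Qed.

End NullTuples.

Section FormalMapGroup.
Variable R : realType.
Local Notation C := R[i].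
Implicit Types H G T : formal_map R.

Lemma jac_jacobian0 H : jacobian0 H = jac H. Proof. by []. Qed.

Lemma formal_invertible_null H : formal_invertible H -> null H.
Proof. by case. Qed.

Lemma mcompA H G T : null G -> null T ->
  mcomp (mcomp H G) T = mcomp H (mcomp G T).
Proof. by move=> G0 T0; apply/funext => i; apply: fps_compA. Qed.

Lemma mcomp1 H : mcomp H (@formal_id R) = H.
Proof. by apply/funext => i; apply: fps_comp_id. Qed.

Lemma m1comp H : null H -> mcomp (@formal_id R) H = H.
Proof. by move=> H0; apply/funext => i; apply: fps_comp_var. Qed.

Lemma null_mcomp H G : null H -> null G -> null (mcomp H G).
Proof. exact: null_comp. Qed.

Lemma formal_invertible_comp H G :
  formal_invertible H -> formal_invertible G -> formal_invertible (mcomp H G).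
Proof.
move=> [H0 HU] [G0 GU]; split; first exact: null_comp.
by rewrite jac_jacobian0 jac_comp // unitmx_mul; apply/andP.
Qed.

Lemma formal_invertible_id : formal_invertible (@formal_id R).
Proof.
split; first exact: null_var.
by rewrite jac_jacobian0 (jac_var _ 2) unitmx1.
Qed.

Lemma formal_inverse H : formal_invertible H -> exists L,
  [/\ formal_invertible L, mcomp L H = @formal_id R & mcomp H L = @formal_id R].
Proof.
move=> [H0 HU]; have [L [L0 LU LH HL]] := two_sided_inverse H0 HU.
by exists L; split; [|apply/funext|apply/funext].
Qed.

Lemma fps_conj_comp n m (F : fps C n) (G : 'I_n -> fps C m) :
  fps_conj (fps_comp F G) = fps_comp (fps_conj F) (fun i => fps_conj (G i)).
Proof. exact: (fps_map_comp Num.conj). Qed.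

Lemma fps_conj_null n m (G : 'I_n -> fps C m) :
  null G -> null (fun i => fps_conj (G i)).
Proof. by move=> G0 i; rewrite /fps_conj G0 rmorph0. Qed.

Lemma null_with_bar H : null H -> null (with_bar H).
Proof.
by move=> H0; apply: ord22P => j; rewrite -[with_bar H]/(t22 _ _) ?t22l ?t22r
  fps_comp_const ?H0 ?fps_conj_null // => i; apply: null_var.
Qed.

Lemma with_bar_comp H G : null G ->
  with_bar (mcomp H G) = fun i => fps_comp (with_bar H i) (with_bar G).
Proof.
move=> G0; have Gb0 := null_with_bar G0.
have nl : null (fun l : 'I_2 => fps_var C (lshift 2 l)) by move=> i; apply: null_var.
have nr : null (fun l : 'I_2 => fps_var C (rshift 2 l)) by move=> i; apply: null_var.
apply/funext; apply: ord22P => j.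
  rewrite -[with_bar (mcomp H G)]/(t22 _ _) -[with_bar H]/(t22 _ _) !t22l.
  rewrite !fps_compA //; congr fps_comp; apply/funext => i.
  by rewrite fps_comp_var // -[with_bar G]/(t22 _ _) t22l.
rewrite -[with_bar (mcomp H G)]/(t22 _ _) -[with_bar H]/(t22 _ _) !t22r.
rewrite fps_conj_comp !fps_compA //; last exact: fps_conj_null.
congr fps_comp; apply/funext => i.
by rewrite fps_comp_var // -[with_bar G]/(t22 _ _) t22r.
Qed.

Lemma pullback_comp rho H G : null H -> null G ->
  pullback rho (mcomp H G) = pullback (pullback rho H) G.
Proof.
move=> H0 G0; rewrite /pullback with_bar_comp // fps_compA //.
  exact: null_with_bar.
exact: null_with_bar.
Qed.

Lemma pullbackM rho rho' H : null H ->
  pullback (rho * rho') H = pullback rho H * pullback rho' H.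
Proof. by move=> H0; apply/fps_compM/null_with_bar. Qed.

Lemma pullback_id rho : pullback rho (@formal_id R) = rho.
Proof.
rewrite /pullback (_ : with_bar _ = @fps_var C _) ?fps_comp_id //.
apply/funext; apply: ord22P => j; rewrite -[with_bar _]/(t22 _ _) ?t22l ?t22r.
  by rewrite fps_comp_var // => i; apply: null_var.
rewrite /formal_id -[fps_conj _]/(fps_map Num.conj _) fps_map_var.
by rewrite fps_comp_var // => i; apply: null_var.
Qed.

End FormalMapGroup.

(** * Tangency to a hypersurface in normal coordinates *)

Section Tangency.
Variables (R : realType) (phi : fps R[i] 3).
Local Notation C := R[i].
Hypothesis phiN : normal_series phi.
Implicit Types (H G T : formal_map R).

Let r := normal_defining_series phi.

Definition zv : fps C 3 := fps_var C 0.
Definition chiv : fps C 3 := fps_var C 1.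
Definition sv : fps C 3 := fps_var C ord_max.

(** The complexified hypersurface is parametrized by (z, chi, s), where s is
    the real part of w: then w = s + i phi and its conjugate is s - i phi. *)
Definition wpar (k : C) : fps C 3 := sv + fcst 3 k * phi.

Definition ev (F : fps C 2) : fps C 3 := fps_comp F (t2 zv (wpar 'i)).
Definition evb (F : fps C 2) : fps C 3 :=
  fps_comp (fps_conj F) (t2 chiv (wpar (- 'i))).

Definition re_part (g gb : fps C 3) : fps C 3 := fcst 3 2%:R^-1 * (g + gb).
Definition im_part (g gb : fps C 3) : fps C 3 :=
  fcst 3 (2%:R * 'i)^-1 * (g - gb).

(** For H = (f, g) this is Im g - phi(f, \bar f, Re g), restricted to the
    complexified hypersurface. *)
Definition defect H : fps C 3 :=
  im_part (ev (H 1)) (evb (H 1))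
  - fps_comp phi (t3 (ev (H 0)) (evb (H 0)) (re_part (ev (H 1)) (evb (H 1)))).

Lemma coef3E a n m : coef3 phi a n m = phi (mi3 a n m). Proof. by []. Qed.

Lemma phi_null : phi (midx0 3) = 0.
Proof. by rewrite midx0_3 -coef3E; case: phiN => _ ->. Qed.

Lemma null_wpar k : wpar k (midx0 3) = 0.
Proof. by rewrite /wpar fpsD /sv null_var fcstM phi_null mulr0 addr0. Qed.

Lemma null_par : null (t2 zv (wpar 'i)).
Proof. by apply: null_t2; [apply: null_var|apply: null_wpar]. Qed.

Lemma null_parb : null (t2 chiv (wpar (- 'i))).
Proof. by apply: null_t2; [apply: null_var|apply: null_wpar]. Qed.

Lemma null_ev F : F (midx0 2) = 0 -> ev F (midx0 3) = 0.
Proof. by move=> F0; rewrite /ev fps_comp_const //; apply: null_par. Qed.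

Lemma null_evb F : F (midx0 2) = 0 -> evb F (midx0 3) = 0.
Proof.
by move=> F0; rewrite /evb fps_comp_const ?/fps_conj ?F0 ?rmorph0 //; apply: null_parb.
Qed.

Lemma normal_comp m (A B : 'I_2 -> fps C m) : null A -> null B ->
  fps_comp r (t22 A B) = fcst m (2%:R * 'i)^-1 * (A 1 - B 1)
    - fps_comp phi (t3 (A 0) (B 0) (fcst m 2%:R^-1 * (A 1 + B 1))).
Proof.
move=> A0 B0; have AB0 := null_t22 A0 B0.
pose re4 : fps C (2 + 2) := fcst _ 2%:R^-1 *
  (fps_var C (lshift 2 (1 : 'I_2)) + fps_var C (rshift 2 (1 : 'I_2))).
have -> : r = fcst _ (2%:R * 'i)^-1 *
    (fps_var C (lshift 2 (1 : 'I_2)) - fps_var C (rshift 2 (1 : 'I_2)))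
    - fps_comp phi (t3 (fps_var C (lshift 2 (0 : 'I_2)))
        (fps_var C (rshift 2 (0 : 'I_2))) re4).
  apply/funext => e; rewrite fpsB fcstM fpsB mulrC; congr (_ - fps_comp _ _ e).
  apply/funext; apply: ord3P => //; apply/funext => e'.
  by rewrite t3E2 /re4 fcstM fpsD mulrC.
have re40 : re4 (midx0 _) = 0 by rewrite /re4 fcstM fpsD ?/w ?/tau !null_var addr0 mulr0.
rewrite fps_compB fps_compM // fps_comp_cst // fps_compB !fps_comp_var //.
rewrite t22l t22r fps_compA //; last by apply: null_t3 => //; apply: null_var.
congr (_ - fps_comp _ _); apply/funext; apply: ord3P.
- by rewrite !t3E0 fps_comp_var // t22l.
- by rewrite !t3E1 fps_comp_var // t22r.
by rewrite !t3E2 fps_compM // fps_comp_cst // fps_compD !fps_comp_var // t22l t22r.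
Qed.

Lemma normal_null : r (midx0 _) = 0.
Proof.
have n2 j j' : null (t2 (fps_var C j) (fps_var C j' : fps C (2 + 2))).
  by apply: null_t2; apply: null_var.
have := normal_comp (n2 (lshift 2 (0 : 'I_2)) (lshift 2 (1 : 'I_2)))
  (n2 (rshift 2 (0 : 'I_2)) (rshift 2 (1 : 'I_2))).
rewrite (_ : t22 _ _ = @fps_var C (2 + 2)); last first.
  by apply/funext; apply: ord22P => j; rewrite ?t22l ?t22r; move: j; apply: ord2P.
rewrite fps_comp_id => ->; rewrite fpsB fcstM fpsB !t2E1 !null_var subr0 mulr0.
rewrite fps_comp_const ?phi_null ?subr0 //; apply: null_t3; rewrite ?t2E0 ?null_var //.
by rewrite fcstM fpsD !null_var addr0 mulr0.
Qed.

Lemma var3_id : t3 zv chiv sv = @fps_var C 3.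
Proof. by apply/funext; apply: ord3P. Qed.

Definition par4 := t22 (t2 zv (wpar 'i)) (t2 chiv (wpar (- 'i))).

Lemma null_par4 : null par4.
Proof. by apply: null_t22; [apply: null_par|apply: null_parb]. Qed.

Lemma two_i_neq0 : 2%:R * 'i != 0 :> C.
Proof. by rewrite mulf_neq0 ?neq0Ci // pnatr_eq0. Qed.

Lemma re_par : re_part (wpar 'i) (wpar (- 'i)) = sv.
Proof.
rewrite /re_part /wpar rmorphN; apply/funext => m.
rewrite fcstM !fpsD mulNr fpsN.
have -> : sv m + (fcst 3 'i * phi) m + (sv m - (fcst 3 'i * phi) m) = sv m * 2%:R by ring.
by rewrite mulrC mulfK // pnatr_eq0.
Qed.

Lemma im_par : im_part (wpar 'i) (wpar (- 'i)) = phi.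
Proof.
rewrite /im_part /wpar rmorphN; apply/funext => m.
rewrite fcstM fpsB !fpsD mulNr fpsN fcstM.
have -> : sv m + 'i * phi m - (sv m - 'i * phi m) = 2%:R * 'i * phi m by ring.
by rewrite mulrA mulVf ?mul1r ?two_i_neq0.
Qed.

Lemma normal_par : fps_comp r par4 = 0.
Proof.
rewrite normal_comp; [|exact: null_par|exact: null_parb].
rewrite !t2E0 !t2E1 -/(im_part _ _) -/(re_part _ _) re_par im_par var3_id.
by rewrite fps_comp_id subrr.
Qed.

Lemma pullback_par H : null H -> fps_comp (pullback r H) par4 = defect H.
Proof.
move=> H0; rewrite fps_compA; [|exact: null_with_bar|exact: null_par4].
have -> : (fun i => fps_comp (with_bar H i) par4) =
    t22 (fun j => ev (H j)) (fun j => evb (H j)).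
  have nl : null (fun l : 'I_2 => fps_var C (lshift 2 l)) by move=> i; apply: null_var.
  have nr : null (fun l : 'I_2 => fps_var C (rshift 2 l)) by move=> i; apply: null_var.
  apply/funext; apply: ord22P => j; rewrite -[with_bar H]/(t22 _ _) ?t22l ?t22r.
    rewrite fps_compA //; last exact: null_par4.
    congr fps_comp; apply/funext => l; rewrite fps_comp_var; last exact: null_par4.
    by rewrite /par4 t22l.
  rewrite fps_compA //; last exact: null_par4.
  congr fps_comp; apply/funext => l; rewrite fps_comp_var; last exact: null_par4.
  by rewrite /par4 t22r.
have A0 : null (fun j => ev (H j)) by move=> j; apply: null_ev; apply: H0.
have B0 : null (fun j => evb (H j)) by move=> j; apply: null_evb; apply: H0.
exact: normal_comp.
Qed.

(** In the coordinates (z, chi, s, sigma) with w = s + i (sigma + phi), the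
    defining series is sigma, so that a series vanishing on the hypersurface
    is a multiple of it. *)
Lemma normal_dvd (F : fps C (2 + 2)) : fps_comp F par4 = 0 ->
  exists a, F = a * r.
Proof.
move=> F0; pose z4 : fps C (2 + 2) := fps_var C (lshift 2 (0 : 'I_2)).
pose s4 : fps C (2 + 2) := fps_var C (lshift 2 (1 : 'I_2)).
pose c4 : fps C (2 + 2) := fps_var C (rshift 2 (0 : 'I_2)).
pose i3 : 'I_(2 + 2) := rshift 2 (1 : 'I_2).
pose g4 : fps C (2 + 2) := fps_var C i3.
have n3 : null (t3 z4 c4 s4) by apply: null_t3; apply: null_var.
pose phi4 := fps_comp phi (t3 z4 c4 s4).
have phi40 : phi4 (midx0 _) = 0 by rewrite /phi4 fps_comp_const ?phi_null.
pose w4 k : fps C (2 + 2) := s4 + fcst _ k * (g4 + phi4).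
have w40 k : w4 k (midx0 _) = 0.
  by rewrite /w4 fpsD fcstM fpsD phi40 /s4 /g4 !null_var !(addr0, mulr0).
pose B := t22 (t2 z4 (w4 'i)) (t2 c4 (w4 (- 'i))).
have B0 : null B by apply: null_t22; apply: null_t2; rewrite ?w40 //; apply: null_var.
(* kill is the restriction to sigma = 0, where w = s + i phi. *)
pose kill : 'I_(2 + 2) -> fps C (2 + 2) := t22 (t2 z4 s4) (t2 c4 0).
have kill0 : null kill.
  by apply: null_t22; apply: null_t2 => //; apply: null_var.
pose E := fps_comp F B.
have E0 : fps_comp E kill = 0.
  rewrite fps_compA //.
  pose j3 := t3 z4 c4 s4.
  have -> : (fun i => fps_comp (B i) kill) = fun i => fps_comp (par4 i) j3.
    have w4k k : fps_comp (w4 k) kill = fps_comp (wpar k) j3.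
      rewrite !fps_compD !fps_compM // !fps_comp_cst // fps_compD.
      rewrite !fps_comp_var // /kill t22l t22r !t2E1 add0r /j3 t3E2; congr (_ + _ * _).
      rewrite fps_compA //; congr fps_comp; apply/funext; apply: ord3P;
        rewrite ?t3E0 ?t3E1 ?t3E2 fps_comp_var // ?t22l ?t22r ?t2E0 ?t2E1 //.
    apply/funext; apply: ord22P => j; rewrite /B /par4 ?t22l ?t22r; move: j; apply: ord2P.
    - by rewrite !t2E0 !fps_comp_var // /kill t22l.
    - by rewrite !t2E1 w4k.
    - by rewrite !t2E0 !fps_comp_var // /kill t22r.
    by rewrite !t2E1 w4k.
  by rewrite -fps_compA ?F0 ?fps_comp0 //; apply: null_par4.
(* a' is the quotient of E by sigma, up to the terms without sigma. *)
pose a' : fps C (2 + 2) := fun m => E (madd (midx1 i3) m).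
pose D : fps C (2 + 2) := E - g4 * a'.
have Dsupp (m : midx (2 + 2)) : m i3 != 0%N -> D m = 0.
  move=> m3; rewrite /D fpsB fpsM.
  pose m' : midx (2 + 2) := [ffun i => (m i - midx1 i3 i)%N].
  have mE : madd (midx1 i3) m' = m.
    apply/ffunP => i; rewrite !ffunE subnKC //.
    by case: eqP => // ->; rewrite lt0n.
  rewrite (bigD1_seq (midx1 i3, m')) ?splits_uniq ?mem_splits ?mE //=.
  rewrite /g4 /fps_var eqxx mul1r /a' mE big_seq_cond big1 ?addr0 ?subrr //.
  move=> [b c]; rewrite mem_splits xpair_eqE => /andP[/eqP bc] /=.
  have [b1|] := eqVneq b; last by rewrite mul0r.
  by rewrite -mE b1 in bc; rewrite (maddI bc) eqxx.
have Dkill : fps_comp D kill = D.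
  rewrite -[RHS]fps_comp_id; apply/funext => e.
  rewrite !(@fps_compE _ _ _ (mdeg e).+1) //; last exact: null_var.
  apply: eq_bigr => a _; have [a3|a3] := eqVneq (a i3) 0%N; last first.
    by rewrite Dsupp ?mul0r.
  congr (_ * _ e); rewrite /mpow; apply: eq_bigr => i _.
  have [->|] := eqVneq i i3; first by rewrite a3 !expr0.
  move: i; apply: ord22P => j; rewrite /kill ?t22l ?t22r; move: j; apply: ord2P => //.
have D0 : D = 0.
  rewrite -Dkill /D fps_compB E0 fps_compM // fps_comp_var // /kill t22r t2E1.
  by rewrite mul0r subr0.
have EE : E = g4 * a' by apply/eqP; rewrite -subr_eq0 -/D D0.
pose w : fps C (2 + 2) := fps_var C (lshift 2 (1 : 'I_2)).
pose tau : fps C (2 + 2) := fps_var C (rshift 2 (1 : 'I_2)).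
pose re4 := fcst (2 + 2) 2%:R^-1 * (w + tau).
have rE : r = fcst _ (2%:R * 'i)^-1 * (w - tau) - fps_comp phi (t3 z4 c4 re4).
  by rewrite -[LHS]fps_comp_id -[@fps_var C (2 + 2)](_ : t22 (t2 z4 w) (t2 c4 tau) = _)
    ?normal_comp //; [apply: null_t2; apply: null_var|apply: null_t2; apply: null_var
    |apply/funext; apply: ord22P => j; rewrite ?t22l ?t22r; move: j; apply: ord2P].
have re40 : re4 (midx0 _) = 0 by rewrite /re4 fcstM fpsD ?/w ?/tau !null_var addr0 mulr0.
have r0 := normal_null.
pose Bi : 'I_(2 + 2) -> fps C (2 + 2) := t22 (t2 z4 re4) (t2 c4 r).
have Bi0 : null Bi by apply: null_t22; apply: null_t2 => //; apply: null_var.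
have BBi : (fun i => fps_comp (B i) Bi) = @fps_var C (2 + 2).
  have phi4i : fps_comp phi4 Bi = fps_comp phi (t3 z4 c4 re4).
    rewrite fps_compA //; congr fps_comp; apply/funext; apply: ord3P;
      by rewrite ?t3E0 ?t3E1 ?t3E2 fps_comp_var // /Bi ?t22l ?t22r.
  have w4i k : fps_comp (w4 k) Bi = re4 + fcst _ (k / (2%:R * 'i)) * (w - tau).
    rewrite fps_compD fps_compM // fps_comp_cst // fps_compD phi4i.
    rewrite !fps_comp_var // /Bi t22l t22r !t2E1 rE subrK.
    by rewrite rmorphM mulrA.
  have q : 'i / (2%:R * 'i) = 2%:R^-1 :> C.
    by rewrite invfM mulrCA divff ?neq0Ci // mulr1.
  have half (f : fps C (2 + 2)) : fcst _ 2%:R^-1 * (f + f) = f.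
    apply/funext => m; rewrite fcstM fpsD.
    have -> : f m + f m = 2%:R * f m by ring.
    by rewrite mulKf ?pnatr_eq0.
  have wE : fps_comp (w4 'i) Bi = w.
    rewrite w4i q /re4 -mulrDr -[RHS]half; congr (_ * _).
    by rewrite addrACA subrr addr0.
  have tauE : fps_comp (w4 (- 'i)) Bi = tau.
    rewrite w4i mulNr q rmorphN mulNr -mulrN /re4 -mulrDr -[RHS]half.
    by congr (_ * _); rewrite opprB [w + _]addrC addrACA subrr addr0.
  apply/funext; apply: ord22P => j; rewrite /B ?t22l ?t22r; move: j; apply: ord2P.
  - by rewrite t2E0 fps_comp_var // /Bi t22l.
  - by rewrite t2E1 wE.
  - by rewrite t2E0 fps_comp_var // /Bi t22r.
  by rewrite t2E1 tauE.
exists (fps_comp a' Bi).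
rewrite -[LHS]fps_comp_id -BBi -fps_compA // -/E EE fps_compM // fps_comp_var //.
by rewrite /Bi t22r t2E1 mulrC.
Qed.

(** The series that vanish on the hypersurface are the multiples of its
    defining series, so being an automorphism is a condition on restrictions. *)
Theorem Autf_normal H : Autf r H <-> formal_invertible H /\ defect H = 0.
Proof.
split=> [[HI [a ha]]|[HI d0]]; split=> //.
  have H0 := formal_invertible_null HI.
  rewrite -pullback_par // ha -[fps_mul _ _]/(a * r) fps_compM; last exact: null_par4.
  by rewrite normal_par mulr0.
by have [a ->] := normal_dvd (etrans (pullback_par (formal_invertible_null HI)) d0); exists a.
Qed.

End Tangency.

Section Conjugation.
Variables (R : realType) (rho rho' : fps R[i] (2 + 2)) (T L : formal_map R).
Local Notation C := R[i].
Hypotheses (TI : formal_invertible T) (LI : formal_invertible L).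
Hypothesis TL : mcomp T L = @formal_id R.
Variable u : fps C (2 + 2).
Hypotheses (u0 : u (midx0 _) != 0) (Tu : pullback rho T = u * rho').

(** The factor u is a unit, and so is its pullback: it can be cancelled. *)
Lemma Autf_conj H : Autf rho H -> Autf rho' (mcomp L (mcomp H T)).
Proof.
move=> [HI [a ha]].
have [[T0 L0] H0] := (formal_invertible_null TI, formal_invertible_null LI, formal_invertible_null HI).
have HI' : formal_invertible (mcomp L (mcomp H T)).
  by do !apply: formal_invertible_comp.
set H' := mcomp L _ in HI' *; have H'0 := formal_invertible_null HI'.
split=> //.
have HT0 : null (mcomp H T) by apply: null_mcomp.
have TH' : mcomp T H' = mcomp H T by rewrite /H' -mcompA // TL m1comp.
have [v uv] : exists v, pullback u H' * v = 1.
  by apply: fps_unit; rewrite /pullback fps_comp_const //; apply: null_with_bar.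
exists (v * pullback a T * u).
change (pullback rho' H' = v * pullback a T * u * rho').
have e1 : pullback u H' * pullback rho' H' = pullback a T * (u * rho').
  rewrite -pullbackM // -Tu -pullback_comp // TH' pullback_comp // ha Tu.
  by rewrite -Tu -pullbackM.
rewrite -[LHS]mul1r -uv mulrAC -!mulrA -e1; ring.
Qed.

End Conjugation.

Section ChangeOfCoordinates.
Variables (R : realType) (rho : fps R[i] (2 + 2)) (T : formal_map R).
Variable phi : fps R[i] 3.
Local Notation C := R[i].

(** The differential of rho at 0 does not vanish, and that of a product of two
    series without constant terms does. *)
Lemma normal_factor_unit u : formal_hypersurface rho -> formal_invertible T ->
  normal_series phi ->
  pullback rho T = u * normal_defining_series phi -> u (midx0 _) != 0.
Proof.
move=> [_ rho0 [i rhoi]] TI phiN Tu; apply: contraNneq rhoi => u0.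
have [L [LI LT TL]] := formal_inverse TI.
have [T0 L0] := (formal_invertible_null TI, formal_invertible_null LI).
have -> : rho = pullback u L * pullback (normal_defining_series phi) L.
  by rewrite -pullbackM // -Tu -pullback_comp // TL pullback_id.
have -> : (pullback u L * pullback (normal_defining_series phi) L) (midx1 i) = 0 => //.
apply: (@order_geM _ _ 1 1); rewrite ?mdeg1 //; apply/order_ge1.
  by rewrite /pullback fps_comp_const //; apply: null_with_bar.
by rewrite /pullback fps_comp_const ?normal_null //; apply: null_with_bar.
Qed.

End ChangeOfCoordinates.

(** * Coefficients below a leading term *)

Section ProductCoefficients.
Variable K : comNzRingType.

Section General.
Variable n : nat.
Implicit Types (f g : fps K n) (m a b : midx n).

Lemma fpsM_eq0 f g m :
  (forall a b, madd a b = m -> f a != 0 -> g b != 0 -> False) -> (f * g) m = 0.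
Proof.
move=> h; apply/eqP; apply: contraT => /fpsM_neq0[a [b [ab fa gb]]].
by case: (h a b).
Qed.

Lemma fpsM_single f g a b :
  (forall a' b', madd a' b' = madd a b -> f a' != 0 -> g b' != 0 -> a' = a) ->
  (f * g) (madd a b) = f a * g b.
Proof.
move=> h; rewrite fpsM (bigD1_seq (a, b)) ?splits_uniq ?mem_splits //=.
rewrite big_seq_cond big1 ?addr0 // => -[a' b'] /=.
rewrite mem_splits xpair_eqE => /andP[/eqP e].
have [->|fa] := eqVneq (f a') 0; first by rewrite mul0r.
have [->|gb] := eqVneq (g b') 0; first by rewrite mulr0.
have aa := h _ _ e fa gb; rewrite aa eqxx in e *.
by rewrite (maddI e) eqxx.
Qed.

Lemma varM i f m : (fps_var K i * f) m =
  if (0 < m i)%N then f [ffun j => (m j - (j == i))%N] else 0.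
Proof.
case: ifPn => [mi|]; last first.
  rewrite -eqn0Ngt => /eqP mi; apply: fpsM_eq0 => a b ab.
  rewrite /fps_var; have [a1 _ _|_] := eqVneq a (midx1 i); last by rewrite eqxx.
  by move: mi; rewrite -ab a1 !ffunE eqxx.
set m' : midx n := finfun _.
have mE : madd (midx1 i) m' = m.
  apply/ffunP => j; rewrite !ffunE subnKC //.
  by case: eqP => // ->.
rewrite -{1}mE fpsM_single; first by rewrite /fps_var eqxx mul1r.
by move=> a b _; rewrite /fps_var; have [//|_] := eqVneq a (midx1 i); rewrite eqxx.
Qed.

End General.

Lemma fpsM3_neq0 (f g : fps K 3) b c v : (f * g) (mi3 b c v) != 0 ->
  exists b1 c1 v1 b2 c2 v2,
    [/\ b1 + b2 = b, c1 + c2 = c & v1 + v2 = v]%N /\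
    f (mi3 b1 c1 v1) != 0 /\ g (mi3 b2 c2 v2) != 0.
Proof.
move=> /fpsM_neq0[a [a' [aa fa ga]]].
rewrite (mi3E a) in fa aa; rewrite (mi3E a') in ga aa.
rewrite madd_mi3 in aa; case/mi3_inj: aa => *.
by do 6!eexists; split; first split; eauto.
Qed.

Lemma fpsM3_eq0 (f g : fps K 3) b c v :
  (forall b1 c1 v1 b2 c2 v2,
    (b1 + b2)%N = b -> (c1 + c2)%N = c -> (v1 + v2)%N = v ->
    f (mi3 b1 c1 v1) != 0 -> g (mi3 b2 c2 v2) != 0 -> False) ->
  (f * g) (mi3 b c v) = 0.
Proof.
move=> h; apply/eqP; apply: contraT => /fpsM3_neq0.
by move=> [b1 [c1 [v1 [b2 [c2 [v2 [[eb ec ev] [fa gb]]]]]]]]; case: (h b1 c1 v1 b2 c2 v2).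
Qed.

Lemma fpsM3_single (f g : fps K 3) b1 c1 v1 b2 c2 v2 :
  (forall b1' c1' v1' b2' c2' v2',
    (b1' + b2' = b1 + b2)%N -> (c1' + c2' = c1 + c2)%N ->
    (v1' + v2' = v1 + v2)%N ->
    f (mi3 b1' c1' v1') != 0 -> g (mi3 b2' c2' v2') != 0 ->
    [/\ b1' = b1, c1' = c1 & v1' = v1]) ->
  (f * g) (mi3 (b1 + b2) (c1 + c2) (v1 + v2)) =
    f (mi3 b1 c1 v1) * g (mi3 b2 c2 v2).
Proof.
move=> h; rewrite -madd_mi3; apply: fpsM_single => a a'.
rewrite (mi3E a) (mi3E a') !madd_mi3 => /mi3_inj[eb ec ev] fa ga.
by have [-> -> ->] := h _ _ _ _ _ _ eb ec ev fa ga.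
Qed.

End ProductCoefficients.

Section ThreeVariables.
Variable R : realType.
Local Notation C := R[i].
Implicit Types (f g : fps C 3).

Lemma zM f b c v : (zv R * f) (mi3 b c v) =
  if (0 < b)%N then f (mi3 b.-1 c v) else 0.
Proof.
rewrite /zv varM !ffunE /=; case: ifP => // _; congr f.
by apply/ffunP; apply: ord3P; rewrite !ffunE ?subn0 ?subn1.
Qed.

Lemma chiM f b c v : (chiv R * f) (mi3 b c v) =
  if (0 < c)%N then f (mi3 b c.-1 v) else 0.
Proof.
rewrite /chiv varM !ffunE /=; case: ifP => // _; congr f.
by apply/ffunP; apply: ord3P; rewrite !ffunE ?subn0 ?subn1.
Qed.

Lemma sM f b c v : (sv R * f) (mi3 b c v) =
  if (0 < v)%N then f (mi3 b c v.-1) else 0.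
Proof.
rewrite /sv varM !ffunE /=; case: ifP => // _; congr f.
by apply/ffunP; apply: ord3P; rewrite !ffunE ?subn0 ?subn1.
Qed.

Lemma zXM f i b c v : (zv R ^+ i * f) (mi3 b c v) =
  if (i <= b)%N then f (mi3 (b - i) c v) else 0.
Proof.
elim: i b => [|i IH] b; first by rewrite expr0 mul1r subn0.
rewrite exprS -mulrA zM; case: b => [|b] //=.
Qed.

Lemma chiXM f i b c v : (chiv R ^+ i * f) (mi3 b c v) =
  if (i <= c)%N then f (mi3 b (c - i) v) else 0.
Proof.
elim: i c => [|i IH] c; first by rewrite expr0 mul1r subn0.
rewrite exprS -mulrA chiM; case: c => [|c] //=.
Qed.

Lemma svE b c v : sv R (mi3 b c v) = [&& b == 0, c == 0 & v == 1]%N%:R.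
Proof.
rewrite /sv /fps_var; congr ((nat_of_bool _)%:R).
have -> : midx1 ord_max = mi3 0 0 1.
  by apply/ffunP; apply: ord3P; rewrite !ffunE.
by apply/idP/idP => [/eqP/mi3_inj[-> -> ->]|/and3P[/eqP-> /eqP-> /eqP->]].
Qed.

Lemma one3E b c v : (1 : fps C 3) (mi3 b c v) = [&& b == 0, c == 0 & v == 0]%N%:R.
Proof.
rewrite fps1 midx0_3; congr ((nat_of_bool _)%:R).
by apply/idP/idP => [/eqP/mi3_inj[-> -> ->]|/and3P[/eqP-> /eqP-> /eqP->]].
Qed.

End ThreeVariables.

Section LeadingTerms.
Variables (R : realType) (phi : fps R[i] 3).
Local Notation C := R[i].

(** What a point (al, n, mu) of the invariant set says about the support of
    phi. The condition 2 <= al + mu only excludes (1, n, 0), whose pair lies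
    below all the other ones: a second point in the invariant set rules it out. *)
Record leading (al n mu : nat) : Prop := Leading {
  lead_supp : forall b c v, phi (mi3 b c v) != 0 ->
    (0 < b)%N /\ (0 < c)%N /\
    ((mu < v)%N \/ (al + mu < b + v)%N \/ (b = al /\ v = mu));
  lead_neq0 : phi (mi3 al n mu) != 0;
  lead_min : forall c, phi (mi3 al c mu) != 0 -> (n <= c)%N;
  lead_deg : (2 <= al + mu)%N }.

Variables (al n mu : nat).
Hypothesis L : leading al n mu.

Lemma lead_al_gt0 : (0 < al)%N.
Proof. by have [] := lead_supp L (lead_neq0 L). Qed.

Lemma lead_n_gt0 : (0 < n)%N.
Proof. by have [_ []] := lead_supp L (lead_neq0 L). Qed.

Ltac lead h := let h1 := fresh in let h2 := fresh in
  have [h1 [h2 ?]] := lead_supp L h.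

Section Powers.
Variable k : C.
(* W l is the restriction of w^l (for k = i) or of \bar w^l (for k = -i). The
   next lemmas bound its support: a factor phi of a term of W l raises the
   exponent of z or, by at least mu + 1, that of s. *)
Let W l : fps C 3 := wpar phi k ^+ l.

Lemma wpar_neq0 b c v : wpar phi k (mi3 b c v) != 0 ->
  [/\ b = 0%N, c = 0%N & v = 1%N] \/ phi (mi3 b c v) != 0.
Proof.
rewrite /wpar fpsD fcstM svE.
have [->|] := eqVneq (phi _) 0; last by right.
by rewrite mulr0 addr0 pnatr_eq0 eqb0 negbK => /and3P[/eqP-> /eqP-> /eqP->]; left.
Qed.

Lemma WS l : W l.+1 = sv R * W l + fcst 3 k * (phi * W l).
Proof. by rewrite /W exprS /wpar; ring. Qed.

Lemma W_z0 l c v : W l (mi3 0 c v) = ((c == 0) && (v == l))%N%:R.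
Proof.
elim: l v => [|l IH] v; first by rewrite /W expr0 one3E.
rewrite WS fpsD sM fcstM (_ : (phi * W l) _ = 0) ?mulr0 ?addr0; last first.
  by apply: fpsM3_eq0 => b1 c1 v1 b2 c2 v2 e _ _ p; lead p; lia.
by case: v => [|v] //=; rewrite ?andbF //.
Qed.

Lemma W_chi0 l b v : W l (mi3 b 0 v) = ((b == 0) && (v == l))%N%:R.
Proof.
elim: l v => [|l IH] v; first by rewrite /W expr0 one3E.
rewrite WS fpsD sM fcstM (_ : (phi * W l) _ = 0) ?mulr0 ?addr0; last first.
  by apply: fpsM3_eq0 => b1 c1 v1 b2 c2 v2 _ e _ p; lead p; lia.
by case: v => [|v] //=; rewrite ?andbF //.
Qed.

Lemma W_split l b c v : W l.+1 (mi3 b c v) != 0 ->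
  exists b1 c1 v1 b2 c2 v2,
    [/\ b1 + b2 = b, c1 + c2 = c & v1 + v2 = v]%N /\
    ([/\ b1 = 0%N, c1 = 0%N & v1 = 1%N] \/ phi (mi3 b1 c1 v1) != 0) /\
    W l (mi3 b2 c2 v2) != 0.
Proof.
rewrite /W exprS => /fpsM3_neq0[b1 [c1 [v1 [b2 [c2 [v2 [e [p q]]]]]]]].
by exists b1, c1, v1, b2, c2, v2; split=> //; split=> //; apply: wpar_neq0.
Qed.

Lemma W_z0_neq0 l c v : W l (mi3 0 c v) != 0 -> c = 0%N /\ v = l.
Proof.
by rewrite W_z0 pnatr_eq0 eqb0 negbK => /andP[/eqP-> /eqP->].
Qed.

Lemma W_deg l b c v : W l (mi3 b c v) != 0 -> (l <= b + v)%N.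
Proof.
elim: l b c v => [//|l IH] b c v /W_split.
move=> [b1 [c1 [v1 [b2 [c2 [v2 [[eb ec ev] [[[? ? ?]|p] /IH q]]]]]]]].
  lia.
by lead p; lia.
Qed.

Lemma W_lt l b c v : (b < al)%N -> W l (mi3 b c v) != 0 -> (l <= v)%N.
Proof.
elim: l b c v => [//|l IH] b c v bal /W_split.
move=> [b1 [c1 [v1 [b2 [c2 [v2 [[eb ec ev] [p /IH q]]]]]]]].
have {q} := q ltac:(lia); case: p => [[? ? ?]|p]; first lia.
by lead p; lia.
Qed.

Lemma W_le l b c v : (b <= al)%N -> W l (mi3 b c v) != 0 -> (l <= v.+1)%N.
Proof.
elim: l b c v => [//|l IH] b c v bal /W_split.
move=> [b1 [c1 [v1 [b2 [c2 [v2 [[eb ec ev] [p q]]]]]]]].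
have q' := IH _ _ _ (ltac:(lia) : (b2 <= al)%N) q.
case: p => [[? ? ?]|p]; first lia.
lead p; have [b1al|] := ltnP b1 al; first lia.
move=> b1al; have b20 : b2 = 0%N by lia.
by rewrite b20 in q; have [_ v2l] := W_z0_neq0 q; lia.
Qed.

Lemma W_mid l b c v : (0 < b < al)%N -> W l (mi3 b c v) != 0 ->
  (l + mu <= v)%N.
Proof.
elim: l b c v => [|l IH] b c v /andP[b0 bal].
  by rewrite /W expr0 one3E (gtn_eqF b0) eqxx.
move=> /W_split[b1 [c1 [v1 [b2 [c2 [v2 [[eb ec ev] [p q]]]]]]]].
have [b20|b20] := posnP b2.
  rewrite b20 in q; have [_ v2l] := W_z0_neq0 q.
  by case: p => [[? ? ?]|p]; [lia|lead p; lia].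
have q' := IH _ _ _ (ltac:(lia) : (0 < b2 < al)%N) q.
by case: p => [[? ? ?]|p]; [lia|lead p; lia].
Qed.

(** To first order in phi, w^l is s^l + l k s^(l-1) phi, and at the exponent al
    of z the terms of higher order start beyond s^(l + mu). *)
Lemma W_al l c v : (v < l + mu)%N -> W l (mi3 al c v) =
  if v.+1 == (l + mu)%N then l%:R * k * phi (mi3 al c mu) else 0.
Proof.
have al0 := lead_al_gt0.
elim: l v => [|l IH] v vl.
  by rewrite /W expr0 one3E (gtn_eqF al0) mul0r mul0r if_same.
rewrite WS fpsD sM fcstM.
have -> : (phi * W l) (mi3 al c v) =
    if v == (l + mu)%N then phi (mi3 al c mu) else 0.
  have supp b1 c1 v1 b2 c2 v2 : (b1 + b2)%N = al -> (v1 + v2)%N = v ->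
      phi (mi3 b1 c1 v1) != 0 -> W l (mi3 b2 c2 v2) != 0 ->
      [/\ b1 = al, b2 = 0, c2 = 0, v1 = mu & v2 = l]%N.
    move=> eb ev p q; lead p.
    have [b20|b20] := posnP b2.
      rewrite b20 in q; have [-> v2l] := W_z0_neq0 q.
      by split=> //; lia.
    have := W_mid (ltac:(lia) : (0 < b2 < al)%N) q; lia.
  case: eqP => [vE|nv].
    have -> : mi3 al c v = mi3 (al + 0) (c + 0) (mu + l).
      by rewrite vE !addn0 addnC.
    rewrite fpsM3_single.
      by rewrite W_z0 !eqxx mulr1.
    move=> b1 c1 v1 b2 c2 v2 eb ec ev p q.
    have [] := supp _ _ _ _ _ _ (ltac:(lia) : (b1 + b2)%N = al) (ltac:(lia) : (v1 + v2)%N = v) p q.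
    by move=> *; split; lia.
  apply: fpsM3_eq0 => b1 c1 v1 b2 c2 v2 eb ec ev p q.
  by have [] := supp _ _ _ _ _ _ eb ev p q; lia.
case: v vl => [|v] vl /=.
  rewrite add0r; case: eqP => e; last first.
    by rewrite mulr0; case: eqP => // ?; lia.
  have [l0 mu0] : l = 0%N /\ mu = 0%N by lia.
  by rewrite l0 mu0 /= mul1r.
rewrite IH ?addSn ?eqSS; last by lia.
by case: eqP => _; rewrite ?mulr0 ?addr0 // -[l.+1]addn1 natrD; ring.
Qed.

End Powers.
End LeadingTerms.

(** * Series restricted to the hypersurface *)

Section SeriesAlongHypersurface.
Variables (R : realType) (phi : fps R[i] 3).
Local Notation C := R[i].
Hypothesis phiN : normal_series phi.
Implicit Types (F : fps C 2).

Lemma monomial_par k i l b c v : (zv R ^+ i * wpar phi k ^+ l) (mi3 b c v) =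
  if (i <= b)%N then (wpar phi k ^+ l) (mi3 (b - i) c v) else 0.
Proof. exact: zXM. Qed.

Lemma monomial_parb k i l b c v : (chiv R ^+ i * wpar phi k ^+ l) (mi3 b c v) =
  if (i <= c)%N then (wpar phi k ^+ l) (mi3 b (c - i) v) else 0.
Proof. exact: chiXM. Qed.

(** Used to read off coefficients of ev and evb: the support of the powers of w
    singles out one term of F. *)
Lemma fps_comp2_single n (F : fps C 2) (x y : fps C n) e i0 l0 :
  null (t2 x y) ->
  (forall i l, F (mi2 i l) != 0 -> (x ^+ i * y ^+ l) e != 0 -> i = i0 /\ l = l0) ->
  fps_comp F (t2 x y) e = F (mi2 i0 l0) * (x ^+ i0 * y ^+ l0) e.
Proof.
move=> xy0 h; rewrite (@fps_compE _ _ _ (mdeg e + i0 + l0).+1) //; last by rewrite ltnS -addnA leq_addr.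
rewrite (bigD1_seq (mi2 i0 l0)) ?box_uniq //=; last first.
  by rewrite mem_box_mdeg // mdeg_mi2 ltnS -addnA leq_addl.
rewrite mpow_t2 big1_seq ?addr0 // => a /andP[aN _].
rewrite (mi2E a) mpow_t2; apply/eqP; rewrite mulf_eq0; apply: contraR aN.
rewrite negb_or => /andP[Fa xa]; apply/eqP.
by rewrite (mi2E a); have [-> ->] := h _ _ Fa xa.
Qed.

Lemma fps_comp2_neq0 n (F : fps C 2) (x y : fps C n) e : null (t2 x y) ->
  fps_comp F (t2 x y) e != 0 ->
  exists i l, F (mi2 i l) != 0 /\ (x ^+ i * y ^+ l) e != 0.
Proof.
move=> xy0; apply: contra_neqP => h; rewrite (@fps_comp2_single _ _ _ _ _ 0%N 0%N) //.
  have [-> |F0] := eqVneq (F (mi2 0 0)) 0; first by rewrite mul0r.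
  have [-> |x0] := eqVneq ((x ^+ 0 * y ^+ 0) e) 0; first by rewrite mulr0.
  by case: h; exists 0%N, 0%N.
by move=> i l Fi xi; case: h; exists i, l.
Qed.

Lemma ev_neq0 F b c v : ev phi F (mi3 b c v) != 0 ->
  exists i l, [/\ F (mi2 i l) != 0, (i <= b)%N &
    (wpar phi 'i ^+ l) (mi3 (b - i) c v) != 0].
Proof.
move=> /(fps_comp2_neq0 (null_par phiN))[i [l [Fi]]].
by rewrite monomial_par; case: ifP; rewrite ?eqxx // => ib h; exists i, l.
Qed.

Lemma evb_neq0 F b c v : evb phi F (mi3 b c v) != 0 ->
  exists i l, [/\ F (mi2 i l) != 0, (i <= c)%N &
    (wpar phi (- 'i) ^+ l) (mi3 b (c - i) v) != 0].
Proof.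
move=> /(fps_comp2_neq0 (null_parb phiN))[i [l [Fi]]].
rewrite monomial_parb; case: ifP; rewrite ?eqxx // => ib h; exists i, l.
by split=> //; apply: contra_neq Fi; rewrite /fps_conj => ->; rewrite rmorph0.
Qed.

Lemma ev_single F b c v i0 l0 :
  (forall i l, F (mi2 i l) != 0 -> (i <= b)%N ->
     (wpar phi 'i ^+ l) (mi3 (b - i) c v) != 0 -> i = i0 /\ l = l0) ->
  (i0 <= b)%N ->
  ev phi F (mi3 b c v) = F (mi2 i0 l0) * (wpar phi 'i ^+ l0) (mi3 (b - i0) c v).
Proof.
move=> h i0b; rewrite /ev (@fps_comp2_single _ _ _ _ _ i0 l0) ?monomial_par ?i0b //.
  exact: null_par.
by move=> i l Fi; rewrite monomial_par; case: ifP; rewrite ?eqxx // => ib; apply: h.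
Qed.

Lemma evb_single F b c v i0 l0 :
  (forall i l, F (mi2 i l) != 0 -> (i <= c)%N ->
     (wpar phi (- 'i) ^+ l) (mi3 b (c - i) v) != 0 -> i = i0 /\ l = l0) ->
  (i0 <= c)%N ->
  evb phi F (mi3 b c v) =
    (F (mi2 i0 l0))^*%R * (wpar phi (- 'i) ^+ l0) (mi3 b (c - i0) v).
Proof.
move=> h i0b; rewrite /evb (@fps_comp2_single _ _ _ _ _ i0 l0) ?monomial_parb ?i0b //.
  exact: null_parb.
move=> i l Fi; rewrite monomial_parb; case: ifP; rewrite ?eqxx // => ib; apply: h => //.
by apply: contra_neq Fi; rewrite /fps_conj => ->; rewrite rmorph0.
Qed.

Lemma im_partE g gb e : im_part g gb e = (2%:R * 'i)^-1 * (g e - gb e) :> C.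
Proof. by rewrite /im_part fcstM. Qed.

Lemma re_partE g gb e : re_part g gb e = 2%:R^-1 * (g e + gb e) :> C.
Proof. by rewrite /re_part fcstM. Qed.

Lemma im_part_eq0 g gb e : im_part g gb e = 0 :> C -> g e = gb e.
Proof.
rewrite im_partE => /eqP; rewrite mulf_eq0 invr_eq0 (negbTE (two_i_neq0 R)) /=.
by rewrite subr_eq0 => /eqP.
Qed.

Lemma re_part_neq0 g gb e : re_part g gb e != 0 :> C -> g e != 0 \/ gb e != 0.
Proof.
rewrite re_partE; have [->|] := eqVneq (g e) 0; last by left.
by rewrite add0r => h; right; apply: contra_neq h => ->; rewrite mulr0.
Qed.

Section WithLeadingTerm.
Variables (al n mu : nat).
Hypothesis L : leading phi al n mu.

Lemma ev_z0 F c v : ev phi F (mi3 0 c v) = F (mi2 0 v) * (c == 0)%N%:R.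
Proof.
rewrite (ev_single (i0 := 0) (l0 := v)) ?(W_z0 L) ?eqxx ?andbT // => i l _.
rewrite leqn0 => /eqP ->; rewrite (W_z0 L) pnatr_eq0 eqb0 negbK.
by move=> /andP[_ /eqP].
Qed.

Lemma ev_chi0 F b v : ev phi F (mi3 b 0 v) = F (mi2 b v).
Proof.
rewrite (ev_single (i0 := b) (l0 := v)) ?(W_chi0 L) ?subnn ?eqxx ?mulr1 // => i l _ ib.
rewrite (W_chi0 L) pnatr_eq0 eqb0 negbK => /andP[/eqP e /eqP ->]; split=> //.
by apply/eqP; rewrite eqn_leq ib -subn_eq0 e.
Qed.

Lemma evb_z0 F c v : evb phi F (mi3 0 c v) = (F (mi2 c v))^*%R.
Proof.
rewrite (evb_single (i0 := c) (l0 := v)) ?(W_z0 L) ?subnn ?eqxx ?mulr1 // => i l _ ib.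
rewrite (W_z0 L) pnatr_eq0 eqb0 negbK => /andP[/eqP e /eqP ->]; split=> //.
by apply/eqP; rewrite eqn_leq ib -subn_eq0 e.
Qed.

Lemma evb_chi0 F b v : evb phi F (mi3 b 0 v) = (F (mi2 0 v))^*%R * (b == 0)%N%:R.
Proof.
rewrite (evb_single (i0 := 0) (l0 := v)) ?(W_chi0 L) ?eqxx ?andbT // => i l _.
rewrite leqn0 => /eqP ->; rewrite (W_chi0 L) pnatr_eq0 eqb0 negbK.
by move=> /andP[_ /eqP].
Qed.

Lemma ev_lt F j b c v : (forall i l, (l < j)%N -> F (mi2 i l) = 0) ->
  (b < al)%N -> ev phi F (mi3 b c v) != 0 -> (j <= v)%N.
Proof.
move=> Fj bal /ev_neq0[i [l [Fi ib /(W_lt L (leq_ltn_trans (leq_subr _ _) bal)) lv]]].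
by apply: leq_trans lv; rewrite leqNgt; apply: contra_neqN Fi; apply: Fj.
Qed.

Lemma evb_lt F j b c v : (forall i l, (l < j)%N -> F (mi2 i l) = 0) ->
  (b < al)%N -> evb phi F (mi3 b c v) != 0 -> (j <= v)%N.
Proof.
move=> Fj bal /evb_neq0[i [l [Fi ib /(W_lt L bal) lv]]].
by apply: leq_trans lv; rewrite leqNgt; apply: contra_neqN Fi; apply: Fj.
Qed.

Lemma ev_le F j b c v : (forall i l, (l < j)%N -> F (mi2 i l) = 0) ->
  F (mi2 0 j) = 0 -> (0 < b <= al)%N -> ev phi F (mi3 b c v) != 0 -> (j <= v)%N.
Proof.
move=> Fj F0 /andP[b0 bal] /ev_neq0[i [l [Fi ib W]]].
have jl : (j <= l)%N by rewrite leqNgt; apply: contra_neqN Fi; apply: Fj.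
have [i0|i0] := posnP i.
  have := W_le L (leq_trans (leq_subr _ _) bal) W.
  have : l <> j by move=> lj; move: Fi; rewrite i0 lj F0 eqxx.
  lia.
by have := W_lt L (ltac:(lia) : (b - i < al)%N) W; lia.
Qed.

Lemma ev_z1 F j c : (forall i l, (l < j)%N -> F (mi2 i l) = 0) ->
  F (mi2 0 j) = 0 -> ev phi F (mi3 1 c j) = F (mi2 1 j) * (c == 0)%N%:R.
Proof.
move=> Fj F0; have al0 := lead_al_gt0 L; have ld := lead_deg L.
rewrite (ev_single (i0 := 1) (l0 := j)) ?subnn ?(W_z0 L) ?eqxx ?andbT // => i l Fi i1 W.
have jl : (j <= l)%N by rewrite leqNgt; apply: contra_neqN Fi; apply: Fj.
have [i0|i0] := posnP i; last first.
  have iE : i = 1%N by lia.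
  by rewrite iE subnn in W; have [_ ->] := W_z0_neq0 L W.
have lj : l <> j by move=> lj; move: Fi; rewrite i0 lj F0 eqxx.
rewrite i0 subn0 in W; have [al1|al1] := ltnP 1 al.
  by have := W_lt L al1 W; lia.
have alE : al = 1%N by lia.
have : (wpar phi 'i ^+ l) (mi3 al c j) != 0 by rewrite alE.
by rewrite (W_al L) ?ifF ?eqxx //; [apply/eqP; lia|lia].
Qed.

(** If F is divisible by w^(j+1), its lowest terms restrict to F_(0,j+1)
    w^(j+1), and the term of first order in phi of w^(j+1) gives this
    coefficient. *)
Lemma ev_al F j m : (0 < m)%N -> (forall i l, (l <= j)%N -> F (mi2 i l) = 0) ->
  ev phi F (mi3 al m (mu + j)) =
    F (mi2 0 j.+1) * (j.+1%:R * 'i * phi (mi3 al m mu)).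
Proof.
move=> m0 Fj; rewrite (ev_single (i0 := 0) (l0 := j.+1)) //.
  by rewrite subn0 (W_al L) ?ifT //; lia.
move=> i l Fi ia W.
have jl : (j < l)%N by rewrite ltnNge; apply: contra_neqN Fi; apply: Fj.
have [ia'|ia'] := eqVneq i al.
  by rewrite ia' subnn in W; have [mE] := W_z0_neq0 L W; lia.
have [i0|i0] := posnP i; last by have := W_mid L (ltac:(lia) : (0 < al - i < al)%N) W; lia.
split=> //; move: W; rewrite i0 subn0 (W_al L); last by lia.
by case: ifP => [/eqP|]; [lia|rewrite eqxx].
Qed.

Lemma evb_al F j m : (0 < m)%N -> (forall i l, (l <= j)%N -> F (mi2 i l) = 0) ->
  (forall i, (0 < i)%N -> F (mi2 i j.+1) != 0 -> (m < i + n)%N) ->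
  evb phi F (mi3 al m (mu + j)) =
    (F (mi2 0 j.+1))^*%R * (j.+1%:R * - 'i * phi (mi3 al m mu)).
Proof.
move=> m0 Fj Fi1; rewrite (evb_single (i0 := 0) (l0 := j.+1)) //.
  by rewrite subn0 (W_al L) ?ifT //; lia.
move=> i l Fi ia W.
have jl : (j < l)%N by rewrite ltnNge; apply: contra_neqN Fi; apply: Fj.
move: W; rewrite (W_al L); last by lia.
case: ifP => [/eqP lE|]; last by rewrite eqxx.
have {lE} lE : l = j.+1 by lia.
rewrite mulf_eq0 negb_or => /andP[_ /(lead_min L) nm]; split=> //.
by have [//|i0] := posnP i; rewrite lE in Fi; have := Fi1 _ i0 Fi; lia.
Qed.

Lemma ev_below F j b m v : (forall i l, (l <= j)%N -> F (mi2 i l) = 0) ->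
  (0 < m)%N -> (b < al)%N -> ev phi F (mi3 b m v) != 0 -> (j.+1 + mu <= v)%N.
Proof.
move=> Fj m0 bal /ev_neq0[i [l [Fi ib W]]].
have jl : (j < l)%N by rewrite ltnNge; apply: contra_neqN Fi; apply: Fj.
have [bi|bi] := posnP (b - i).
  by rewrite bi in W; have [mE] := W_z0_neq0 L W; lia.
have := W_mid L (ltac:(lia) : (0 < b - i < al)%N) W; lia.
Qed.

Lemma evb_below F j b m v : (forall i l, (l <= j)%N -> F (mi2 i l) = 0) ->
  (0 < b < al)%N -> evb phi F (mi3 b m v) != 0 -> (j.+1 + mu <= v)%N.
Proof.
move=> Fj bal /evb_neq0[i [l [Fi ib W]]].
have jl : (j < l)%N by rewrite ltnNge; apply: contra_neqN Fi; apply: Fj.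
have := W_mid L bal W; lia.
Qed.

End WithLeadingTerm.
End SeriesAlongHypersurface.

(** * Tangent vector fields *)

Section Derivatives.
Variables (K : comNzRingType) (n : nat).

Definition pderiv (i : 'I_n) (f : fps K n) : fps K n :=
  fun m => f (madd (midx1 i) m) *+ (m i).+1.

End Derivatives.

Section TangentFields.
Variables (R : realType) (phi : fps R[i] 3).
Local Notation C := R[i].
Hypothesis phiN : normal_series phi.

Let dz := pderiv (0 : 'I_3) phi.
Let dchi := pderiv (1 : 'I_3) phi.
Let ds := pderiv (ord_max : 'I_3) phi.

(** The vector field (xi, eta) and its conjugate annihilate Im w - phi along
    the hypersurface. Here pderiv is the partial derivative with respect to z,
    chi and s. *)
Definition tangent (xi eta : fps C 2) : Prop :=
  im_part (ev phi eta) (evb phi eta) =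
    dz * ev phi xi + dchi * evb phi xi + ds * re_part (ev phi eta) (evb phi eta).

Lemma dzE b c v : dz (mi3 b c v) = phi (mi3 b.+1 c v) *+ b.+1.
Proof.
rewrite /dz /pderiv ffunE; congr (phi _ *+ _).
by apply/ffunP; apply: ord3P; rewrite !ffunE.
Qed.

Lemma dchiE b c v : dchi (mi3 b c v) = phi (mi3 b c.+1 v) *+ c.+1.
Proof.
rewrite /dchi /pderiv ffunE; congr (phi _ *+ _).
by apply/ffunP; apply: ord3P; rewrite !ffunE.
Qed.

Lemma dsE b c v : ds (mi3 b c v) = phi (mi3 b c v.+1) *+ v.+1.
Proof.
rewrite /ds /pderiv ffunE; congr (phi _ *+ _).
by apply/ffunP; apply: ord3P; rewrite !ffunE.
Qed.

Lemma mulrSn_neq0 (x : C) k : x *+ k != 0 -> x != 0.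
Proof. by apply: contra_neq => ->; rewrite mul0rn. Qed.

Lemma phi_conj a b v : phi (mi3 a b v) = (phi (mi3 b a v))^*%R.
Proof. by case: phiN => /(_ a b v). Qed.

Section Level.
Variables (xi eta : fps C 2) (j : nat).
Hypothesis X : tangent xi eta.
Variables (al n mu : nat).
Hypothesis L : leading phi al n mu.

Ltac lead h := let h1 := fresh in let h2 := fresh in
  have [h1 [h2 ?]] := lead_supp L h.

Lemma tangentE e : (2%:R * 'i)^-1 * (ev phi eta e - evb phi eta e) =
  (dz * ev phi xi) e + (dchi * evb phi xi) e
    + (ds * re_part (ev phi eta) (evb phi eta)) e.
Proof. by have := congr1 (fun f => f e) X; rewrite /im_part fcstM. Qed.

(** On chi = 0 only the terms phi_(b,1,v) of the derivative in chi contribute;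
    those with v = 0 are the conjugates of phi_(1,b,0), which vanish since (1,
    0) lies below the leading pair. So the restrictions of eta and of its
    conjugate agree on chi = 0 at the power s^j. *)
Lemma eta_pure : (forall l, (l < j)%N -> xi (mi2 0 l) = 0) ->
  (forall i, (0 < i)%N -> eta (mi2 i j) = 0) /\
  eta (mi2 0 j) = (eta (mi2 0 j))^*%R.
Proof.
move=> xi0; have ld := lead_deg L.
have key i : ev phi eta (mi3 i 0 j) = evb phi eta (mi3 i 0 j).
  apply: im_part_eq0; rewrite im_partE tangentE.
  have -> : (dz * ev phi xi) (mi3 i 0 j) = 0.
    apply: fpsM3_eq0 => b1 c1 v1 b2 c2 v2 _ e _; rewrite dzE => /mulrSn_neq0 p.
    by lead p; lia.
  have -> : (ds * re_part (ev phi eta) (evb phi eta)) (mi3 i 0 j) = 0.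
    apply: fpsM3_eq0 => b1 c1 v1 b2 c2 v2 _ e _; rewrite dsE => /mulrSn_neq0 p.
    by lead p; lia.
  rewrite add0r addr0; apply: fpsM3_eq0 => b1 c1 v1 b2 c2 v2 _ e ev; rewrite dchiE => /mulrSn_neq0.
  have [-> ->] : c1 = 0%N /\ c2 = 0%N by lia.
  rewrite (evb_chi0 phiN L) => p q.
  have jv2 : (j <= v2)%N.
    rewrite leqNgt; apply: contra_neqN q => /xi0 ->.
    by rewrite rmorph0 mul0r.
  have v10 : v1 = 0%N by lia.
  move: p; rewrite v10 phi_conj fmorph_eq0 => p.
  by lead p; lia.
split=> [i i0|].
  by rewrite -(ev_chi0 phiN L) key (evb_chi0 phiN L) (gtn_eqF i0) mulr0.
by rewrite -{1}(ev_chi0 phiN L) key (evb_chi0 phiN L) eqxx mulr1.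
Qed.

Hypothesis xi_j : forall i l, (l < j)%N -> xi (mi2 i l) = 0.
Hypothesis eta_j : forall i l, (l <= j)%N -> eta (mi2 i l) = 0.

Lemma eta_j' i l : (l < j.+1)%N -> eta (mi2 i l) = 0.
Proof. exact: eta_j. Qed.

(** The coefficient of z^(al-1) chi^n s^(mu+j) of the tangency equation is al
    phi_(al,n,mu) xi_(0,j): every other product exceeds this exponent. *)
Lemma xi0_level : (2 <= al)%N -> xi (mi2 0 j) = 0.
Proof.
move=> al2; have n0 := lead_n_gt0 L.
have := tangentE (mi3 al.-1 n (mu + j)).
have -> : ev phi eta (mi3 al.-1 n (mu + j)) = 0.
  apply/eqP; apply: contraT => h.
  by have := ev_below phiN L eta_j n0 (ltac:(lia) : (al.-1 < al)%N) h; lia.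
have -> : evb phi eta (mi3 al.-1 n (mu + j)) = 0.
  apply/eqP; apply: contraT => h.
  by have := evb_below phiN L eta_j (ltac:(lia) : (0 < al.-1 < al)%N) h; lia.
rewrite subrr mulr0.
have -> : (ds * re_part (ev phi eta) (evb phi eta)) (mi3 al.-1 n (mu + j)) = 0.
  apply: fpsM3_eq0 => b1 c1 v1 b2 c2 v2 eb ec ev; rewrite dsE => /mulrSn_neq0 p.
  have b2al : (b2 < al)%N by lia.
  move=> /re_part_neq0[/(ev_lt phiN L eta_j' b2al)|/(evb_lt phiN L eta_j' b2al)] ?;
    lead p; lia.
have -> : (dchi * evb phi xi) (mi3 al.-1 n (mu + j)) = 0.
  apply: fpsM3_eq0 => b1 c1 v1 b2 c2 v2 eb ec ev; rewrite dchiE => /mulrSn_neq0 p.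
  have b2al : (b2 < al)%N by lia.
  by move=> /(evb_lt phiN L xi_j b2al) ?; lead p; lia.
rewrite !addr0 -[al.-1]addn0 -[X in mi3 _ X _]addn0 fpsM3_single; last first.
  move=> b1 c1 v1 b2 c2 v2 eb ec ev; rewrite dzE => /mulrSn_neq0 p q.
  have b2al : (b2 < al)%N by lia.
  have jv2 := ev_lt phiN L xi_j b2al q; lead p.
  have b20 : b2 = 0%N by lia.
  have v2j : v2 = j by lia.
  move: q; rewrite b20 v2j (ev_z0 phiN L); have [c20 _|_] := eqVneq c2 0%N.
    by split; lia.
  by rewrite mulr0 eqxx.
rewrite dzE (ev_z0 phiN L) eqxx mulr1 prednK; last by lia.
move/esym/eqP; rewrite mulf_eq0 mulrn_eq0 (negbTE (lead_neq0 L)) orbF.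
by rewrite (gtn_eqF (lead_al_gt0 L)) /= => /eqP.
Qed.

Hypothesis xi_0j : xi (mi2 0 j) = 0.
Hypothesis eta_ij : forall i, (0 < i)%N -> eta (mi2 i j.+1) = 0.
Hypothesis eta_real : eta (mi2 0 j.+1) = (eta (mi2 0 j.+1))^*%R.

(** This is the coefficient of z^al chi^(n-1+b) s^(mu+j) of the tangency
    equation, in which only the terms of phi over the leading pair take part. *)
Lemma level_equation b : (0 < b)%N ->
  (forall b', (b' < b)%N -> xi (mi2 b' j) = 0) ->
  let m := (n.-1 + b)%N in let p := phi (mi3 al m mu) in
  j.+1%:R * p * eta (mi2 0 j.+1) =
    p *+ al * xi (mi2 1 j) + phi (mi3 al n mu) *+ n * (xi (mi2 b j))^*%R
    + p *+ mu * eta (mi2 0 j.+1).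
Proof.
move=> b0 xib m p; have n0 := lead_n_gt0 L; have al0 := lead_al_gt0 L.
have := tangentE (mi3 al m (mu + j)).
rewrite (ev_al phiN L) ?(evb_al phiN L) //; last 3 first.
- by rewrite /m; lia.
- by move=> i i0; rewrite eta_ij ?eqxx.
- by rewrite /m; lia.
rewrite -eta_real -/p.
have -> : (2%:R * 'i)^-1 * (eta (mi2 0 j.+1) * (j.+1%:R * 'i * p) -
    eta (mi2 0 j.+1) * (j.+1%:R * - 'i * p)) = j.+1%:R * p * eta (mi2 0 j.+1).
  have -> : eta (mi2 0 j.+1) * (j.+1%:R * 'i * p) -
    eta (mi2 0 j.+1) * (j.+1%:R * - 'i * p) =
    2%:R * 'i * (j.+1%:R * p * eta (mi2 0 j.+1)) by ring.
  by rewrite mulKf ?two_i_neq0.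
move=> ->; congr (_ + _ + _).
- have -> : mi3 al m (mu + j) = mi3 (al.-1 + 1) (m + 0) (mu + j).
    by rewrite addn0 addn1 prednK.
  rewrite fpsM3_single.
    by rewrite dzE prednK // (ev_z1 phiN L) // eqxx mulr1.
  move=> b1 c1 v1 b2 c2 v2 eb ec ev; rewrite dzE => /mulrSn_neq0 q.
  lead q; have [b20|b20] := posnP b2.
    rewrite b20 (ev_z0 phiN L); have [v2j|v2j] := ltnP v2 j.
      by rewrite xi_j // mul0r eqxx.
    have -> : v2 = j by lia.
    by rewrite xi_0j mul0r eqxx.
  move=> r; have jv2 := ev_le phiN L xi_j xi_0j (ltac:(lia) : (0 < b2 <= al)%N) r.
  have v2j : v2 = j by lia.
  have b21 : b2 = 1%N by lia.
  move: r; rewrite b21 v2j (ev_z1 phiN L) //; have [c20 _|_] := eqVneq c2 0%N.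
    by split; lia.
  by rewrite mulr0 eqxx.
- have -> : mi3 al m (mu + j) = mi3 (al + 0) (n.-1 + b) (mu + j) by rewrite addn0.
  rewrite fpsM3_single; first by rewrite dchiE prednK // (evb_z0 phiN L).
  move=> b1 c1 v1 b2 c2 v2 eb ec ev; rewrite dchiE => /mulrSn_neq0 q.
  lead q; have b2al : (b2 < al)%N by lia.
  move=> r; have jv2 := evb_lt phiN L xi_j b2al r.
  have [b1al v1mu] : b1 = al /\ v1 = mu by lia.
  rewrite b1al v1mu in q; have nc1 := lead_min L q.
  have [b20 v2j] : b2 = 0%N /\ v2 = j by lia.
  move: r; rewrite b20 v2j (evb_z0 phiN L) => r.
  have : (b <= c2)%N.
    rewrite leqNgt; apply: contra_neqN r => /xib ->; by rewrite rmorph0.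
  by move=> bc2; split; lia.
have [mu0|mu0] := posnP mu.
  rewrite mu0 mulr0n mul0r; apply: fpsM3_eq0 => b1 c1 v1 b2 c2 v2 eb ec ev.
  rewrite dsE => /mulrSn_neq0 q; lead q; have b2al : (b2 < al)%N by lia.
  by move=> /re_part_neq0[/(ev_lt phiN L eta_j' b2al)|/(evb_lt phiN L eta_j' b2al)]; lia.
have -> : mi3 al m (mu + j) = mi3 (al + 0) (m + 0) (mu.-1 + j.+1).
  by congr mi3; lia.
have re0 c2 : re_part (ev phi eta) (evb phi eta) (mi3 0 c2 j.+1) =
    eta (mi2 0 j.+1) * (c2 == 0)%N%:R.
  rewrite re_partE (ev_z0 phiN L) (evb_z0 phiN L); case: eqP => [->|/eqP c20].
    rewrite -eta_real; set x := eta _.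
    have -> : x * true%:R + x = 2%:R * x by rewrite mulr1; ring.
    by rewrite mulKf ?pnatr_eq0 // mulr1.
  have -> : (eta (mi2 c2 j.+1))^*%R = 0 :> C by rewrite eta_ij ?lt0n ?rmorph0.
  by rewrite mulr0n mulr0 addr0 mulr0.
rewrite fpsM3_single; first by rewrite dsE prednK // re0 eqxx mulr1.
move=> b1 c1 v1 b2 c2 v2 eb ec ev; rewrite dsE => /mulrSn_neq0 q.
lead q; have b2al : (b2 < al)%N by lia.
move=> r; have jv2 : (j.+1 <= v2)%N.
  by case/re_part_neq0: r => [/(ev_lt phiN L eta_j' b2al)|/(evb_lt phiN L eta_j' b2al)].
have [b20 v2j] : b2 = 0%N /\ v2 = j.+1 by lia.
move: r; rewrite b20 v2j re0; have [c20 _|_] := eqVneq c2 0%N; last by rewrite mulr0 eqxx.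
by split; lia.
Qed.

(** The case b = 1 of level_equation, divided by phi_(al,n,mu). *)
Lemma leading_equation :
  (xi (mi2 1 j)) *+ al + (xi (mi2 1 j))^*%R *+ n =
    (j.+1%:R - mu%:R) * eta (mi2 0 j.+1).
Proof.
have n0 := lead_n_gt0 L.
have := @level_equation 1 isT (fun b' => _); rewrite addn1 prednK //=.
move=> /(_ (fun b' h => ltac:(by rewrite ltnS leqn0 in h; rewrite (eqP h)))) e.
apply: (mulfI (lead_neq0 L)); move: e.
set p := phi _; set x := xi _; set r := eta _; set xb := x^*%R => e.
rewrite mulrBl mulrBr mulrDr -[X in _ = X - _]mulrCA mulrA e.
by rewrite mulr_natl !mulrnAr -!mulrnAl addrK.
Qed.

(** Once eta_(0,j+1) and xi_(1,j) vanish, the level equations are a triangular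
    homogeneous system for the remaining coefficients of w^j in xi. *)
Lemma xi_level_eq0 : eta (mi2 0 j.+1) = 0 -> xi (mi2 1 j) = 0 ->
  forall b, xi (mi2 b j) = 0.
Proof.
move=> r0 x1 b; have [m] := ubnP b; elim: m b => // m IH b bm.
have [->|b0] := posnP b; first by [].
have := @level_equation b b0 (fun b' h => IH b' (leq_trans h bm)).
rewrite /= r0 x1 !mulr0 add0r addr0 => /esym/eqP.
rewrite mulf_eq0 mulrn_eq0 (negbTE (lead_neq0 L)) orbF.
by rewrite (gtn_eqF (lead_n_gt0 L)) /= fmorph_eq0 => /eqP.
Qed.

End Level.
End TangentFields.

(** * The invariant set and rigidity of tangent fields *)

(** Subtracting the conjugate equation leaves (a - b)(x - \bar x) = 0. This is
    the place where alpha differs from n. *)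
Lemma conj_fixed_solution (F : numClosedFieldType) (a b : nat) (x y : F) :
  a <> b -> x *+ a + x^*%R *+ b = y -> y = y^*%R -> x = x^*%R.
Proof.
move=> ab e yr; have e' : x^*%R *+ a + x *+ b = y.
  by rewrite yr -e rmorphD !rmorphMn /= conjCK.
apply/eqP; rewrite -subr_eq0; apply: contra_notT ab => d0.
apply: (mulrIn d0); rewrite !mulrnBl; apply/eqP; rewrite subr_eq addrAC.
by rewrite eq_sym subr_eq e addrC e'.
Qed.

Lemma conj_nat_sub (F : numClosedFieldType) (a b : nat) (y : F) :
  y = y^*%R -> (a%:R - b%:R) * y = ((a%:R - b%:R) * y)^*%R.
Proof. by move=> yr; rewrite rmorphM rmorphB !rmorph_nat /= -yr. Qed.

Lemma mulrnD_eq0 (F : numFieldType) (a b : nat) (x : F) : (0 < a)%N ->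
  x *+ a + x *+ b = 0 -> x = 0.
Proof.
move=> a0; rewrite -mulrnDr => /eqP.
by rewrite mulrn_eq0 addn_eq0 (gtn_eqF a0) /= => /eqP.
Qed.

Section InvariantSet.
Variables (R : realType) (phi : fps R[i] 3).
Local Notation C := R[i].
Hypothesis phiN : normal_series phi.

Lemma phi_b0 c v : phi (mi3 0 c v) = 0.
Proof. by case: phiN => _ _ /(_ c v). Qed.

Lemma phi_c0 b v : phi (mi3 b 0 v) = 0.
Proof. by case: phiN => _ /(_ b v). Qed.

Lemma iter_deriv_series (f : nat -> C) n m :
  iter n (@deriv_series R) f m = f (m + n)%N *+ (m + n) ^_ n.
Proof.
elim: n m => [|n IH] m; first by rewrite addn0 ffactn0.
rewrite iterS /deriv_series IH addSnnS -mulrnA; congr (_ *+ _).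
by rewrite ffactnSr; congr (_ * _)%N; lia.
Qed.

Lemma first_derivativeP (f : nat -> C) n : is_first_derivative f n ->
  f n != 0 /\ forall c, f c != 0 -> (n <= c)%N.
Proof.
move=> [fn fm]; have nz c : (iter c (@deriv_series R) f 0%N == 0) = (f c == 0).
  rewrite iter_deriv_series add0n mulrn_eq0 ffactnn.
  by rewrite -[_`! == 0%N]negbK -lt0n fact_gt0.
split; first by rewrite -nz.
by move=> c; rewrite leqNgt; apply: contra_neqN => /fm/eqP; rewrite nz => /eqP.
Qed.

Lemma Lambda_neq0 al n mu : Lambda phi (al, n, mu) -> phi (mi3 al n mu) != 0.
Proof. by case=> _ /first_derivativeP[]. Qed.

Lemma Lambda_gt0 al n mu : Lambda phi (al, n, mu) -> (0 < al)%N /\ (0 < n)%N.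
Proof.
move=> /Lambda_neq0 h; split; rewrite lt0n; apply: contra_neq h => ->.
  exact: phi_b0.
exact: phi_c0.
Qed.

Lemma Lambda_supp al n mu b c v : Lambda phi (al, n, mu) ->
  phi (mi3 b c v) != 0 ->
  (mu < v)%N \/ (al + mu < b + v)%N \/ (b = al /\ v = mu).
Proof.
move=> [[_ h] _] p; have [vmu|] := leqP v mu; last by left.
have [bv|] := leqP (b + v) (al + mu); last by right; left.
right; right; have [[-> ->] //|nE] := pselect ((b, v) = (al, mu)).
have := h (b, v) (conj (conj bv vmu) nE) c.
by move: p; rewrite /phi_coef => /eqP.
Qed.

(** Neither of the pairs precedes the other, as phi vanishes over all pairs
    that precede an invariant one, and over the same pair n is determined. *)
Lemma Lambda_antichain al n mu al' n' mu' :
  Lambda phi (al, n, mu) -> Lambda phi (al', n', mu') ->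
  (al', n', mu') <> (al, n, mu) ->
  (mu' < mu /\ al + mu < al' + mu')%N \/ (mu < mu' /\ al' + mu' < al + mu)%N.
Proof.
move=> h h' ne; have := Lambda_supp h (Lambda_neq0 h').
have := Lambda_supp h' (Lambda_neq0 h).
suff : ~ (al' = al /\ mu' = mu) by lia.
move=> [e1 e2]; subst al' mu'; apply: ne; congr (_, _, _).
case: h h' => _ /first_derivativeP[nz nm] [_ /first_derivativeP[nz' nm']].
by apply/eqP; rewrite eqn_leq nm // nm'.
Qed.

Lemma Lambda_deg al n mu t' : Lambda phi (al, n, mu) ->
  Lambda phi t' -> t' <> (al, n, mu) -> (2 <= al + mu)%N.
Proof.
case: t' => [[al' n'] mu'] h h' ne.
have [al0 _] := Lambda_gt0 h; have [al0' _] := Lambda_gt0 h'.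
by have := Lambda_antichain h h' ne; lia.
Qed.

Lemma Lambda_leading al n mu : Lambda phi (al, n, mu) -> (2 <= al + mu)%N ->
  leading phi al n mu.
Proof.
move=> h deg; split=> //.
- move=> b c v p; split; [|split; [|exact: Lambda_supp h p]].
    by rewrite lt0n; apply: contra_neq p => ->; apply: phi_b0.
  by rewrite lt0n; apply: contra_neq p => ->; apply: phi_c0.
- exact: Lambda_neq0 h.
by move=> c; case: h => _ /first_derivativeP[_]; apply.
Qed.

Lemma Lambda_le al n mu : Lambda phi (al, n, mu) -> (al <= n)%N.
Proof.
move=> h; have := Lambda_neq0 h; rewrite phi_conj // fmorph_eq0.
by move/(Lambda_supp h); lia.
Qed.

End InvariantSet.

Section Rigidity.
Variables (R : realType) (phi : fps R[i] 3).
Local Notation C := R[i].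
Hypothesis phiN : normal_series phi.
Variables (al n mu : nat) (t' : nat * nat * nat).
Hypotheses (Lt : Lambda phi (al, n, mu)) (Lt' : Lambda phi t').
Hypothesis tt' : t' <> (al, n, mu).
Hypothesis aln : al <> n.

Lemma lambda_leading al' n' mu' : Lambda phi (al', n', mu') ->
  leading phi al' n' mu'.
Proof.
move=> h; apply: Lambda_leading => //.
have [e|ne] := pselect ((al', n', mu') = (al, n, mu)).
  by apply: (Lambda_deg phiN h Lt') => //; rewrite e.
by apply: (Lambda_deg phiN h Lt) => // e; apply: ne.
Qed.

(** Two pairs with alpha = 1 would be comparable. *)
Lemma some_al_ge2 : exists al' n' mu',
  Lambda phi (al', n', mu') /\ (2 <= al')%N.
Proof.
have [al2|al1] := ltnP 1 al; first by exists al, n, mu.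
case: t' Lt' tt' => [[al' n'] mu'] h ne; exists al', n', mu'; split=> //.
have [al0 _] := Lambda_gt0 phiN Lt.
have [al0' _] := Lambda_gt0 phiN h.
have := Lambda_antichain Lt h ne; lia.
Qed.

(** The slopes of the pairs of points of the invariant set are all equal to k:
    it is what is left of the existence of weights x of z and y of w such that
    all the leading terms have the weight of w^k. *)
Definition common_slope (k : nat) := forall al' n' mu',
  Lambda phi (al', n', mu') -> (al', n', mu') <> (al, n, mu) ->
  (al + n)%N <> (al' + n')%N /\ slope (al, n, mu) (al', n', mu') = k%:R.

(** Eliminating x and y from the equations of two points of the invariant set
    leaves an identity between integers, which is the formula for the slope. *)
Lemma common_slopeP (F : numFieldType) (k : nat) (x y : F) :
  (forall al' n' mu', Lambda phi (al', n', mu') ->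
    (al' + n')%:R * x = (k%:R - mu'%:R) * y) ->
  y != 0 -> common_slope k.
Proof.
move=> w y0 al' n' mu' h ne.
have e : ((al' + n') * k + (al + n) * mu' = (al + n) * k + (al' + n') * mu)%N.
  apply/eqP; rewrite -(eqr_nat F); apply/eqP.
  have e1 := w _ _ _ Lt; have e2 := w _ _ _ h.
  have e3 : (al' + n')%:R * ((k%:R - mu%:R) * y) = (al + n)%:R * ((k%:R - mu'%:R) * y).
    by rewrite -e1 -e2; ring.
  apply: (mulIf y0); move: e3; rewrite !natrD !natrM !natrD => e3.
  by apply/eqP; rewrite -subr_eq0; apply/eqP; move/eqP: e3; rewrite -subr_eq0 => /eqP <-; ring.
have [al0 n0] := Lambda_gt0 phiN Lt.
have neA : (al + n)%N <> (al' + n')%N.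
  move=> eA; rewrite -eA in e.
  have : ((al + n) * mu')%N = ((al + n) * mu)%N by lia.
  move/eqP; rewrite eqn_pmul2l ?addn_gt0 ?al0 // => /eqP mumu.
  by have := Lambda_antichain Lt h ne; lia.
split=> //; rewrite /slope.
have d0 : (al' + n')%:R - (al + n)%:R != 0 :> rat.
  by rewrite subr_eq0 eqr_nat; apply/eqP => e'; apply: neA.
apply: (canLR (mulfK d0)); apply/eqP; rewrite mulrBr -!natrM subr_eq addrAC eq_sym subr_eq.
by rewrite -!natrD eqr_nat; apply/eqP; lia.
Qed.

Variables (xi eta : fps C 2).
Hypothesis X : tangent phi xi eta.
Hypotheses (eta0 : eta (mi2 0 0) = 0) (eta1 : eta (mi2 0 1) = 0).

(* xi is divisible by w^j, and eta by w^(j+1). *)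
Let vanish j := (forall i l, (l < j)%N -> xi (mi2 i l) = 0) /\
                (forall i l, (l <= j)%N -> eta (mi2 i l) = 0).

Let resonant := exists k, [/\ (2 <= k)%N, common_slope k, eta (mi2 0 k) != 0,
  eta (mi2 0 k) = (eta (mi2 0 k))^*%R
  & forall e, (mdeg e < k)%N -> xi e = 0 /\ eta e = 0].

(** One level of the induction: xi_(0,j) vanishes by a point with alpha >= 2,
    then xi_(1,j) is real by the point with alpha <> n, so that the leading
    equations of all points become (alpha + n) xi_(1,j) = (j + 1 - mu)
    eta_(0,j+1). Either eta_(0,j+1) = 0 and the whole level vanishes, or all
    slopes are j + 1. *)
Lemma tangent_step j : vanish j -> vanish j.+1 \/ resonant.
Proof.
move=> [xij etaj].
have [al2 [n2 [mu2 [h2 al22]]]] := some_al_ge2.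
have xi0 : xi (mi2 0 j) = 0.
  exact: (xi0_level phiN X (lambda_leading h2) xij etaj al22).
have xi0' l : (l < j.+1)%N -> xi (mi2 0 l) = 0.
  by rewrite ltnS leq_eqVlt => /orP[/eqP->|/xij].
have [etaij etar] := eta_pure phiN X (lambda_leading Lt) xi0'.
have eq al' n' mu' (h : Lambda phi (al', n', mu')) :=
  leading_equation phiN X (lambda_leading h) xij etaj xi0 etaij etar.
have e := eq _ _ _ Lt.
have xr : xi (mi2 1 j) = (xi (mi2 1 j))^*%R.
  exact: conj_fixed_solution aln e (conj_nat_sub _ _ etar).
have [r0|r0] := eqVneq (eta (mi2 0 j.+1)) 0.
  left; have x1 : xi (mi2 1 j) = 0.
    have [al0 n0] := Lambda_gt0 phiN Lt.
    by move: e; rewrite -xr r0 mulr0; apply: mulrnD_eq0.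
  have xib := xi_level_eq0 phiN X (lambda_leading Lt) xij etaj xi0 etaij etar r0 x1.
  split=> i l lj; first by have [/xij//|jl] := ltnP l j; rewrite (_ : l = j) //; lia.
  have [/etaj//|jl] := leqP l j; rewrite (_ : l = j.+1); last by lia.
  by have [->|] := posnP i; [|apply: etaij].
right; exists j.+1; split=> //.
- by case: (j) r0 => //; rewrite eta1 eqxx.
- apply: (@common_slopeP C j.+1 (xi (mi2 1 j)) (eta (mi2 0 j.+1))) => // al' n' mu' h.
  by rewrite -(eq _ _ _ h) -xr mulr_natl mulrnDr.
move=> a; rewrite (mi2E a) mdeg_mi2; move: (a 0) (a 1) => i l il; split.
  have [lj|jl] := ltnP l j; first exact: xij.
  have [-> ->] : i = 0%N /\ l = j by lia.
  exact: xi0.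
by apply: etaj; lia.
Qed.

(** A field of which no level produces a common slope is divisible by all
    powers of w. *)
Theorem tangent_rigid : (xi = 0 /\ eta = 0) \/ resonant.
Proof.
have [res|nres] := pselect resonant; first by right.
left; have van j : vanish j.
  elim: j => [|j IH]; last by case: (tangent_step IH).
  have [etai _] := @eta_pure _ _ phiN xi eta 0 X _ _ _ (lambda_leading Lt) (fun l => ltac:(by [])).
  split=> [//|i l]; rewrite leqn0 => /eqP ->.
  by have [->|] := posnP i; [|apply: etai].
split; apply/funext => e; rewrite (mi2E e).
  by have [h _] := van (e 1).+1; apply: h.
by have [_ h] := van (e 1); apply: h.
Qed.

End Rigidity.

(** * Linear parts of automorphisms *)

Section LinearPart.
Variables (R : realType) (phi : fps R[i] 3).
Local Notation C := R[i].
Hypothesis phiN : normal_series phi.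
Variable H : formal_map R.
Hypotheses (H0 : null H) (dH : defect phi H = 0).

Let f := H 0.
Let g := H 1.
Let F := ev phi f.
Let Fb := evb phi f.
Let G := re_part (ev phi g) (evb phi g).

Lemma f00 : f (mi2 0 0) = 0. Proof. by rewrite -midx0_2; apply: H0. Qed.
Lemma g00 : g (mi2 0 0) = 0. Proof. by rewrite -midx0_2; apply: H0. Qed.

Lemma defectE e : im_part (ev phi g) (evb phi g) e = fps_comp phi (t3 F Fb G) e.
Proof.
by apply/eqP; rewrite -subr_eq0 -fpsB -[X in X e]/(defect phi H) dH.
Qed.

Lemma nullF : null (t3 F Fb G).
Proof.
apply: null_t3; first by apply: null_ev => //; apply: H0.
  by apply: null_evb => //; apply: H0.
by rewrite /G /re_part fcstM fpsD null_ev ?null_evb ?addr0 ?mulr0 //; apply: H0.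
Qed.

Section WithLeadingTerm.
Variables (al n mu : nat).
Hypothesis L : leading phi al n mu.

Ltac lead h := let h1 := fresh in let h2 := fresh in
  have [h1 [h2 ?]] := lead_supp L h.

(** On chi = s = 0 the conjugate of f vanishes, and with it phi(f, \bar f, Re
    g). *)
Lemma g_z : forall i, g (mi2 i 0) = 0.
Proof.
move=> i; have [->|i0] := posnP i; first exact: g00.
have Fbb b : Fb (mi3 b 0 0) = 0.
  by rewrite /Fb (evb_chi0 phiN L) f00 rmorph0 mul0r.
have e : im_part (ev phi g) (evb phi g) (mi3 i 0 0) = 0.
  rewrite defectE (@fps_compE _ _ _ (mdeg (mi3 i 0 0)).+1) ?big1 // => [a _|]; last exact: nullF.
  have [->|pa] := eqVneq (phi a) 0; first by rewrite mul0r.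
  move: pa; rewrite (mi3E a) => pa; lead pa.
  rewrite mpow_t3 -(prednK H2) exprS; set m := (a 1).-1.
  rewrite -mulrA mulrCA -mulrA fpsM3_eq0 ?mulr0 // => b1 c1 v1 b2 c2 v2 _ ec ev.
  have [-> ->] : c1 = 0%N /\ v1 = 0%N by lia.
  by rewrite Fbb eqxx.
move/im_part_eq0: e.
by rewrite (ev_chi0 phiN L) (evb_chi0 phiN L) (gtn_eqF i0) mulr0.
Qed.

Let gam := f (mi2 1 0).
Let del := g (mi2 0 1).

Lemma del_real : del = del^*%R.
Proof.
have e : im_part (ev phi g) (evb phi g) (mi3 0 0 1) = 0.
  rewrite defectE (@fps_compE _ _ _ 2) ?mdeg_mi3 // ?big1 // => [a _|]; last exact: nullF.
  have [->|pa] := eqVneq (phi a) 0; first by rewrite mul0r.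
  move: pa; rewrite (mi3E a) => pa; lead pa.
  rewrite order_ge_mpow ?mulr0 //; first exact: nullF.
  by rewrite !mdeg_mi3; lia.
move/im_part_eq0: e.
by rewrite (ev_chi0 phiN L) (evb_z0 phiN L).
Qed.

Lemma g_l0 i l : g (mi2 i l) != 0 -> (0 < l)%N.
Proof. by rewrite lt0n; apply: contra_neq => ->; apply: g_z. Qed.

Lemma F_deg b c v : F (mi3 b c v) != 0 -> (1 <= b + v)%N.
Proof.
move=> /(ev_neq0 phiN)[i [l [fi ib /(W_deg L)]]].
suff : ~ (i = 0%N /\ l = 0%N) by lia.
by move=> [i0 l0]; move: fi; rewrite i0 l0 f00 eqxx.
Qed.

Lemma F_z1 c : F (mi3 1 c 0) = gam * (c == 0)%N%:R.
Proof.
rewrite /F (ev_single phiN (i0 := 1) (l0 := 0)) ?subnn ?(W_z0 L) ?eqxx ?andbT // => i l fi i1 W.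
have [i0|i0] := posnP i; last first.
  have iE : i = 1%N by lia.
  by rewrite iE subnn in W; have [_ <-] := W_z0_neq0 L W.
have lE : l = 1%N.
  have := W_deg L W; rewrite i0.
  have : l <> 0%N by move=> l0; move: fi; rewrite i0 l0 f00 eqxx.
  lia.
move: W; rewrite i0 lE expr1 subn0 => /wpar_neq0[[]|p] //.
have ld := lead_deg L; lead p; lia.
Qed.

Lemma G_supp b c v : G (mi3 b c v) != 0 ->
  (1 <= b + v)%N /\ ((0 < v)%N \/ (al + mu <= b + v)%N).
Proof.
have Wsupp k l b' c' : (0 < l)%N -> (wpar phi k ^+ l) (mi3 b' c' v) != 0 ->
    (1 <= b' + v)%N /\ ((0 < v)%N \/ (al + mu <= b' + v)%N).
  case: l => // l _; move=> W; split; first by have := W_deg L W; lia.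
  have [b1 [c1 [v1 [b2 [c2 [v2 [[eb ec evv] [p _]]]]]]]] := W_split W.
  by case: p => [[? ? ?]|p]; [lia|lead p; lia].
move=> /re_part_neq0[/(ev_neq0 phiN)|/(evb_neq0 phiN)] [i [l [/g_l0 l0 ib W]]].
  by have := Wsupp _ _ _ _ l0 W; lia.
exact: Wsupp l0 W.
Qed.

Lemma G_001 : G (mi3 0 0 1) = del.
Proof.
rewrite /G re_partE (ev_z0 phiN L) (evb_z0 phiN L) eqxx mulr1 -/del -del_real.
have -> : del + del = 2%:R * del by ring.
by rewrite mulKf ?pnatr_eq0.
Qed.

Lemma Fpow_deg k b c v : (F ^+ k) (mi3 b c v) != 0 -> (k <= b + v)%N.
Proof.
elim: k b c v => [//|k IH] b c v; rewrite exprS => /fpsM3_neq0.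
move=> [b1 [c1 [v1 [b2 [c2 [v2 [[eb ec evv] [/F_deg p /IH q]]]]]]]]; lia.
Qed.

Lemma Gpow_supp k b c v : (G ^+ k) (mi3 b c v) != 0 ->
  (k <= b + v)%N /\ ((k <= v)%N \/ (al + mu <= b + v)%N).
Proof.
elim: k b c v => [|k IH] b c v; first by split=> //; left.
rewrite exprS => /fpsM3_neq0.
move=> [b1 [c1 [v1 [b2 [c2 [v2 [[eb ec evv] [/G_supp p /IH q]]]]]]]]; lia.
Qed.

Lemma Fbpow_z0 k c : (Fb ^+ k) (mi3 0 c 0) != 0 -> (k <= c)%N.
Proof.
elim: k c => [//|k IH] c; rewrite exprS => /fpsM3_neq0.
move=> [b1 [c1 [v1 [b2 [c2 [v2 [[eb ec evv] [p q]]]]]]]].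
have [b10 b20] : b1 = 0%N /\ b2 = 0%N by lia.
have [v10 v20] : v1 = 0%N /\ v2 = 0%N by lia.
rewrite b20 v20 in q; have := IH _ q.
suff : c1 <> 0%N by lia.
move=> c10; move: p; rewrite b10 v10 c10 /Fb (evb_z0 phiN L) f00 rmorph0.
by rewrite eqxx.
Qed.

Lemma Fpow_lead k : (F ^+ k) (mi3 k 0 0) = gam ^+ k.
Proof.
elim: k => [|k IH]; first by rewrite !expr0 one3E.
rewrite exprS -[k.+1]add1n -[mi3 _ _ _]/(mi3 (1 + k) (0 + 0) (0 + 0)) fpsM3_single.
  by rewrite F_z1 IH mulr1 exprS.
move=> b1 c1 v1 b2 c2 v2 eb ec evv /F_deg p /Fpow_deg q; split; lia.
Qed.

Lemma Gpow_lead k : (G ^+ k) (mi3 0 0 k) = del ^+ k.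
Proof.
elim: k => [|k IH]; first by rewrite !expr0 one3E.
rewrite exprS -[k.+1]add1n -[mi3 _ _ _]/(mi3 (0 + 0) (0 + 0) (1 + k)) fpsM3_single.
  by rewrite G_001 IH exprS.
move=> b1 c1 v1 b2 c2 v2 eb ec evv /G_supp p /Gpow_supp q; split; lia.
Qed.

Lemma Fbpow_lead k : (Fb ^+ k) (mi3 0 k 0) = gam^*%R ^+ k.
Proof.
elim: k => [|k IH]; first by rewrite !expr0 one3E.
rewrite exprS -[k.+1]add1n -[mi3 _ _ _]/(mi3 (0 + 0) (1 + k) (0 + 0)) fpsM3_single.
  by rewrite IH /Fb (evb_z0 phiN L) -/gam exprS.
move=> b1 c1 v1 b2 c2 v2 eb ec evv p q.
have [b10 b20] : b1 = 0%N /\ b2 = 0%N by lia.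
have [v10 v20] : v1 = 0%N /\ v2 = 0%N by lia.
rewrite b20 v20 in q; have := Fbpow_z0 q.
have : c1 <> 0%N.
  move=> c10; move: p; rewrite b10 v10 c10 /Fb (evb_z0 phiN L) f00 rmorph0.
  by rewrite eqxx.
by move=> *; split; lia.
Qed.

(** Among the products f^b \bar f^c (Re g)^v that occur in phi(f, \bar f, Re g),
    only the one of the leading term of phi reaches its exponent. *)
Lemma monomial_lead b c v : phi (mi3 b c v) != 0 ->
  (F ^+ b * Fb ^+ c * G ^+ v) (mi3 al n mu) != 0 ->
  mi3 b c v = mi3 al n mu.
Proof.
move=> p /fpsM3_neq0[b12 [c12 [v12 [b3 [c3 [v3 [[eb ec evv] [q r]]]]]]]].
have [b1 [c1 [v1 [b2 [c2 [v2 [[eb' ec' ev'] [q1 q2]]]]]]]] := fpsM3_neq0 q.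
have := Fpow_deg q1; have := Gpow_supp r; lead p => r' q1'.
have [bE vE] : b = al /\ v = mu by lia.
subst b v; have nc := lead_min L p.
have [b20 v20] : b2 = 0%N /\ v2 = 0%N by lia.
rewrite b20 v20 in q2; have c2c := Fbpow_z0 q2.
by congr mi3; lia.
Qed.

Lemma monomial_lead_coef :
  (F ^+ al * Fb ^+ n * G ^+ mu) (mi3 al n mu) =
  gam ^+ al * gam^*%R ^+ n * del ^+ mu.
Proof.
have -> : mi3 al n mu = mi3 ((al + 0) + 0) ((0 + n) + 0) ((0 + 0) + mu).
  by congr mi3; lia.
rewrite fpsM3_single; last first.
  move=> b12 c12 v12 b3 c3 v3 eb ec evv q r.
  have [b1 [c1 [v1 [b2 [c2 [v2 [[eb' ec' ev'] [q1 q2]]]]]]]] := fpsM3_neq0 q.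
  have q1' := Fpow_deg q1; have r' := Gpow_supp r; have al0 := lead_al_gt0 L.
  have [b20 v20] : b2 = 0%N /\ v2 = 0%N by lia.
  rewrite b20 v20 in q2; have := Fbpow_z0 q2; split; lia.
rewrite fpsM3_single; first by rewrite Fpow_lead Fbpow_lead Gpow_lead.
move=> b1 c1 v1 b2 c2 v2 eb ec evv q1 q2; have q1' := Fpow_deg q1.
have [b20 v20] : b2 = 0%N /\ v2 = 0%N by lia.
rewrite b20 v20 in q2; have := Fbpow_z0 q2; split; lia.
Qed.

(** Both sides are the coefficient of z^al chi^n s^mu of the equation Im g =
    phi(f, \bar f, Re g), divided by phi_(al,n,mu): on the left through the
    term of first order in phi of delta w, on the right through the leading
    monomial. *)
Theorem linear_part_relation : del = gam ^+ al * gam^*%R ^+ n * del ^+ mu.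
Proof.
apply: (mulfI (lead_neq0 L)).
have n0 := lead_n_gt0 L.
have gj i l : (l <= 0)%N -> g (mi2 i l) = 0.
  by rewrite leqn0 => /eqP ->; apply: g_z.
have := defectE (mi3 al n (mu + 0)).
rewrite im_partE (ev_al phiN L n0 gj) (evb_al phiN L n0 gj) => [|i i0 _]; last lia.
rewrite -/del -del_real.
have -> : (2%:R * 'i)^-1 * (del * (1 * 'i * phi (mi3 al n mu)) -
    del * (1 * - 'i * phi (mi3 al n mu))) = phi (mi3 al n mu) * del.
  have -> : del * (1 * 'i * phi (mi3 al n mu)) -
    del * (1 * - 'i * phi (mi3 al n mu)) = 2%:R * 'i * (phi (mi3 al n mu) * del) by ring.
  by rewrite mulKf ?two_i_neq0.
move=> ->; rewrite addn0 (@fps_compE _ _ _ (mdeg (mi3 al n mu)).+1) //; last exact: nullF.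
rewrite (bigD1_seq (mi3 al n mu)) ?box_uniq //= ?mem_box_mdeg //.
rewrite mpow_t3 monomial_lead_coef big1 ?addr0 // => a aN.
apply/eqP; rewrite mulf_eq0; apply: contraR aN.
rewrite negb_or (mi3E a) mpow_t3 => /andP[pa qa].
by apply/eqP; apply: monomial_lead.
Qed.

End WithLeadingTerm.
End LinearPart.

(** * Exponential polynomials *)

Section ShiftOperators.
Variable F : numFieldType.
Implicit Types p q : {poly F}.

Lemma poly_nat_eq0 p : (forall m : nat, p.[m%:R] = 0) -> p = 0.
Proof.
move=> h; apply: (@roots_geq_poly_eq0 _ p [seq m%:R | m <- iota 0 (size p)]).
- by apply/allP => x /mapP[m _ ->]; rewrite /root h.
- by rewrite map_inj_uniq ?iota_uniq // => a b /eqP; rewrite eqr_nat => /eqP.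
by rewrite size_map size_iota.
Qed.

Definition shift p : {poly F} := p \Po ('X + 1).

Lemma horner_shift p x : (shift p).[x] = p.[x + 1].
Proof. by rewrite /shift horner_comp !hornerE. Qed.

Lemma size_X1 : size ('X + 1 : {poly F}) = 2.
Proof. by rewrite -[1]/(1%:P) size_XaddC. Qed.

Lemma size_shift p : size (shift p) = size p.
Proof. by rewrite /shift size_comp_poly2 // size_X1. Qed.

Lemma lead_coef_shift p : lead_coef (shift p) = lead_coef p.
Proof.
rewrite /shift lead_coef_comp ?size_X1 //.
have /monicP -> : ('X + 1 : {poly F}) \is monic by rewrite -[1]/(1%:P) monicXaddC.
by rewrite expr1n mulr1.
Qed.

Lemma coef_X1n m k : (('X + 1 : {poly F}) ^+ m)`_k = 'C(m, k)%:R.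
Proof.
elim: m k => [|m IH] k; first by rewrite expr0 coef1; case: k.
rewrite exprS mulrDl mul1r coefD coefXM; case: k => [|k] /=.
  by rewrite IH !bin0 add0r.
by rewrite !IH binS addnC natrD.
Qed.

Lemma coef_scaled_shift (A B : F) p :
  (A *: shift p - B *: p)`_(size p).-1 = (A - B) * lead_coef p.
Proof.
rewrite coefB !coefZ mulrBl; congr (_ - _); congr (_ * _).
by rewrite -lead_coef_shift /lead_coef size_shift.
Qed.

Lemma size_scaled_shift (A B : F) p :
  (size (A *: shift p - B *: p)%R <= size p)%N.
Proof.
rewrite (leq_trans (size_polyD _ _)) // geq_max size_polyN.
by rewrite !(leq_trans (size_scale_leq _ _)) ?size_shift.
Qed.

(** The operator q |-> A q(t+1) - B q(t) preserves the degree if A and B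
    differ, and lowers it by exactly one if A = B: in both cases the leading
    term of p can be matched, and the rest follows by induction on the degree. *)
Lemma shift_surj (A B : F) p : A != 0 -> exists q, A *: shift q - B *: q = p.
Proof.
move=> A0; have [d] := ubnP (size p); elim: d p => // d IH p pd.
have [->|p0] := eqVneq p 0.
  by exists 0; rewrite /shift comp_poly0 !scaler0 subr0.
suff [q hq] : exists q, (size (p - (A *: shift q - B *: q))%R < size p)%N.
  have [q' e] := IH _ (leq_trans hq pd); exists (q + q').
  rewrite -[RHS](subrK (A *: shift q - B *: q)) -e /shift comp_polyD !scalerDr.
  by rewrite opprD addrACA addrC.
have sp : (0 < size p)%N by rewrite lt0n size_poly_eq0.
have lt (q : {poly F}) : (size q <= size p)%N -> q`_(size p).-1 = lead_coef p ->
    (size (p - q)%R < size p)%N.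
  move=> qp lq; rewrite -[X in (_ < X)%N](prednK sp) ltnS; apply/leq_sizeP => j.
  rewrite leq_eqVlt => /orP[/eqP <-|]; first by rewrite coefB lq /lead_coef subrr.
  rewrite prednK // => pj; rewrite coefB !nth_default ?subr0 //.
  exact: leq_trans qp pj.
have [AB|AB] := eqVneq A B; last first.
  exists ((lead_coef p / (A - B)) *: 'X^((size p).-1)).
  set q : {poly F} := (lead_coef p / (A - B)) *: 'X^_; have sq : size q = size p.
    by rewrite size_scale ?size_polyXn ?prednK // mulf_neq0 ?lead_coef_eq0 ?invr_eq0 ?subr_eq0.
  apply: lt; first by rewrite -sq; apply: size_scaled_shift.
  rewrite -{1}sq coef_scaled_shift lead_coefZ lead_coefXn mulr1 mulrC divfK //.
  by rewrite subr_eq0.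
have e0 : A * (size p)%:R != 0 by rewrite mulf_neq0 // pnatr_eq0 -lt0n.
exists ((lead_coef p / (A * (size p)%:R)) *: 'X^(size p)).
rewrite -AB; set c := _ / _; apply: lt.
  apply/leq_sizeP => j pj; rewrite /shift comp_polyZ comp_Xn_poly.
  rewrite coefB !coefZ coef_X1n coefXn.
  have [->|jp] := eqVneq j (size p); first by rewrite binn subrr.
  by rewrite bin_small ?mulr0 ?subr0 // ltn_neqAle eq_sym jp.
rewrite /shift comp_polyZ comp_Xn_poly coefB !coefZ coef_X1n coefXn.
rewrite (ltn_eqF (n := size p)) ?prednK // !mulr0 subr0.
have -> : 'C(size p, (size p).-1) = size p.
  by rewrite -{1}(prednK sp) binSn prednK.
by rewrite mulrCA /c divfK.
Qed.

End ShiftOperators.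

Section ExponentialPolynomials.
Variable R : realType.
Local Notation C := R[i].

Definition expfun (q : R * {poly C}) (t : R) : C :=
  q.2.[t%:C] * (expR (q.1 * t))%:C.

(** The list s contains the frequencies and their polynomial coefficients. *)
Definition expoly (e : R -> C) : Prop :=
  exists s : seq (R * {poly C}), forall t, e t = \sum_(q <- s) expfun q t.

Lemma expoly_eq e e' : expoly e -> e =1 e' -> expoly e'.
Proof. by move=> [s h] ee; exists s => t; rewrite -ee. Qed.

Lemma expoly_term q : expoly (expfun q).
Proof. by exists [:: q] => t; rewrite big_seq1. Qed.

Lemma expoly_poly (p : {poly C}) : expoly (fun t => p.[t%:C]).
Proof.
apply: (expoly_eq (expoly_term (0, p))) => t.
by rewrite /expfun mul0r expR0 mulr1.
Qed.

Lemma expoly_cst c : expoly (fun=> c).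
Proof. by apply: (expoly_eq (expoly_poly c%:P)) => t; rewrite hornerC. Qed.

Lemma expoly_exp c : expoly (fun t => (expR (c * t))%:C).
Proof.
by apply: (expoly_eq (expoly_term (c, 1))) => t; rewrite /expfun hornerC mul1r.
Qed.

Lemma expolyD e e' : expoly e -> expoly e' -> expoly (fun t => e t + e' t).
Proof. by move=> [s h] [s' h']; exists (s ++ s') => t; rewrite big_cat h h'. Qed.

Lemma expolyM e e' : expoly e -> expoly e' -> expoly (fun t => e t * e' t).
Proof.
move=> [s h] [s' h'].
exists [seq (q.1 + q'.1, q.2 * q'.2) | q <- s, q' <- s'] => t.
rewrite big_allpairs_dep h h' mulr_suml; apply: eq_bigr => q _.
rewrite mulr_sumr; apply: eq_bigr => q' _; rewrite /expfun /= hornerM mulrDl expRD.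
by rewrite rmorphM /=; ring.
Qed.

Lemma expoly_sum (I : Type) (r : seq I) (P : pred I) (e : I -> R -> C) :
  (forall i, P i -> expoly (e i)) -> expoly (fun t => \sum_(i <- r | P i) e i t).
Proof.
move=> h; elim: r => [|i r IH].
  by apply: (expoly_eq (expoly_cst 0)) => t; rewrite big_nil.
have [Pi|nPi] := boolP (P i).
  by apply: (expoly_eq (expolyD (h i Pi) IH)) => t; rewrite big_cons Pi.
by apply: (expoly_eq IH) => t; rewrite big_cons (negbTE nPi).
Qed.

Lemma conj_real (x : R) : (x%:C)^*%R = x%:C :> C.
Proof. exact: conjc_real. Qed.

Lemma expoly_conj e : expoly e -> expoly (fun t => (e t)^*%R).
Proof.
move=> [s h]; exists [seq (q.1, map_poly Num.conj q.2) | q <- s] => t.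
rewrite big_map h rmorph_sum; apply: eq_bigr => q _.
rewrite /expfun /= rmorphM /= conj_real; congr (_ * _).
by rewrite -[in RHS]conj_real horner_map.
Qed.

(** The operator e |-> e(t+1) - A e(t), where A is the base of the term q0,
    lowers the degree of the polynomial of q0, does not raise the other degrees
    and respects the vanishing at all natural numbers. After induction all
    terms but q0 vanish, and q0 is a polynomial with infinitely many zeros. *)
Lemma expoly_terms_eq0 (s : seq (R * {poly C})) : uniq (map fst s) ->
  (forall m : nat, \sum_(q <- s) expfun q m%:R = 0) ->
  forall q, q \in s -> q.2 = 0.
Proof.
have [d] := ubnP (\sum_(q <- s) size q.2)%N; elim: d s => // d IH s sd us h q0 q0s.
apply/eqP; apply: contraT => q00.
pose A (c : R) : C := (expR c)%:C.
have A0 c : A c != 0 by rewrite /A fmorph_eq0 gt_eqF ?expR_gt0.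
pose tr (q : R * {poly C}) := (q.1, A q.1 *: shift q.2 - A q0.1 *: q.2).
have tr0 q : q \in s -> (tr q).2 = 0.
  move=> qs; apply: (IH (map tr s)); last exact: map_f.
  - rewrite ltnS in sd; apply: leq_trans sd; rewrite big_map (bigD1_seq q0) ?(map_uniq us) //=.
    rewrite [X in (_ < X)%N](bigD1_seq q0) ?(map_uniq us) //= -addSn leq_add //; last first.
      by apply: leq_sum => q1 _; apply: size_scaled_shift.
    have s0 : (0 < size q0.2)%N by rewrite lt0n size_poly_eq0.
    rewrite -[X in (_ < X)%N](prednK s0) ltnS; apply/leq_sizeP => j.
    rewrite leq_eqVlt => /orP[/eqP <-|].
      by rewrite coef_scaled_shift subrr mul0r.
    by rewrite prednK // => j0; rewrite nth_default // (leq_trans (size_scaled_shift _ _ _)).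
  - by rewrite -map_comp.
  move=> m; rewrite big_map.
  transitivity (\sum_(q <- s) expfun q m.+1%:R
    - A q0.1 * \sum_(q <- s) expfun q m%:R); last by rewrite !h mulr0 subr0.
  rewrite mulr_sumr -sumrB; apply: eq_bigr => q1 _.
  rewrite /expfun /= hornerD hornerN !hornerZ horner_shift -natr1 rmorphD rmorph1.
  rewrite mulrDr mulr1 expRD rmorphM -/(A q1.1) /=; ring.
have q0' q : q \in s -> q != q0 -> q.2 = 0.
  move=> qs qq0; have := congr1 (fun p : {poly C} => p`_(size q.2).-1) (tr0 q qs).
  rewrite coef_scaled_shift coef0 => /eqP; rewrite mulf_eq0 lead_coef_eq0 => /orP[|/eqP //].
  rewrite subr_eq0 => /eqP/complexI/expR_inj e; case/negP: qq0.
  rewrite -(nth_index q0 qs) -[X in _ == X](nth_index q0 q0s).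
  apply/eqP; congr (nth _ _ _); apply/eqP; rewrite -(nth_uniq 0 _ _ us) ?size_map ?index_mem //.
  by rewrite !(nth_map q0) ?index_mem // !nth_index // e.
case/eqP: q00; apply: poly_nat_eq0 => m.
have := h m; rewrite (bigD1_seq q0) ?(map_uniq us) //= big_seq_cond big1 ?addr0.
  move/eqP; rewrite /expfun mulf_eq0 => /orP[/eqP|].
    by rewrite rmorph_nat.
  by rewrite fmorph_eq0 gt_eqF ?expR_gt0.
by move=> q /andP[qs qq0]; rewrite /expfun (q0' q) // horner0 mul0r.
Qed.

Lemma expoly_nat_eq0 e : expoly e -> (forall m : nat, e m%:R = 0) ->
  forall t, e t = 0.
Proof.
move=> [s h] e0 t.
pose s' := [seq (c, \sum_(q <- s | q.1 == c) q.2) | c <- undup (map fst s)].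
have hs' u : e u = \sum_(q <- s') expfun q u.
  rewrite h big_map /expfun /=.
  transitivity (\sum_(c <- undup (map fst s)) \sum_(q <- s | q.1 == c) expfun q u);
    last first.
    apply: eq_bigr => c _; rewrite horner_sum mulr_suml.
    by apply: eq_bigr => q /eqP <-.
  rewrite (exchange_big_dep predT) //= !big_seq; apply: eq_bigr => q qs.
  under [RHS]eq_bigl => c do rewrite eq_sym.
  by rewrite -big_filter filter_pred1_uniq ?undup_uniq ?mem_undup ?map_f // big_seq1.
rewrite hs' big_seq big1 // => q qs'.
rewrite /expfun (@expoly_terms_eq0 s' _ _ q qs') ?horner0 ?mul0r //.
  by rewrite -map_comp map_id undup_uniq.
by move=> m; rewrite -hs'.
Qed.

Lemma expoly_nat_eq e e' : expoly e -> expoly e' ->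
  (forall m : nat, e m%:R = e' m%:R) -> e =1 e'.
Proof.
move=> he he' ee t; apply/eqP; rewrite -subr_eq0; apply/eqP.
have := @expoly_nat_eq0 (fun t => e t + -1 * e' t) _ _ t; rewrite mulN1r; apply.
  by apply: expolyD => //; apply: expolyM => //; apply: expoly_cst.
by move=> m; rewrite ee mulN1r subrr.
Qed.

(** A particular solution is found term by term by shift_surj; a multiple of
    exp(c t) adjusts the initial value. *)
Lemma expoly_recurrence c (a : C) b : expoly b ->
  exists e, [/\ expoly e, e 0 = a
    & forall m : nat, e m.+1%:R = (expR c)%:C * e m%:R + b m%:R].
Proof.
move=> [s hb].
have /boolp.choice[Q hQ] (q : R * {poly C}) : exists r : {poly C},
    (expR q.1)%:C *: shift r - (expR c)%:C *: r = q.2.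
  by apply: shift_surj; rewrite fmorph_eq0 gt_eqF ?expR_gt0.
pose p t := \sum_(q <- s) expfun (q.1, Q q) t.
have hp t : p (t + 1) = (expR c)%:C * p t + b t.
  rewrite hb /p mulr_sumr -big_split; apply: eq_bigr => q _.
  rewrite {3}/expfun -hQ hornerD hornerN !hornerZ horner_shift /expfun /=.
  by rewrite rmorphD rmorph1 mulrDr mulr1 expRD rmorphM /=; ring.
pose e t := p t + (a - p 0) * (expR (c * t))%:C.
exists e; split.
- apply: expolyD; first by apply: expoly_sum => q _; apply: expoly_term.
  by apply: expolyM; [apply: expoly_cst|apply: expoly_exp].
- by rewrite /e mulr0 expR0 mulr1 addrC subrK.
move=> m; rewrite /e -natr1 hp mulrDr mulr1 expRD rmorphM /=; ring.
Qed.

End ExponentialPolynomials.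

(** * Real powers of a formal map *)

Definition zdeg (a : midx 2) : nat := a 0.
Definition wdeg (a : midx 2) : nat := a 1.

Lemma zwE a : a = mi2 (zdeg a) (wdeg a). Proof. exact: mi2E. Qed.
Lemma wdeg_mi2 i l : wdeg (mi2 i l) = l. Proof. by rewrite /wdeg ffunE. Qed.

Lemma zw_eq a e : zdeg a = zdeg e -> wdeg a = wdeg e -> a = e.
Proof. by move=> z w; rewrite (zwE a) (zwE e) z w. Qed.

Lemma mdeg2 a : mdeg a = (zdeg a + wdeg a)%N.
Proof. by rewrite {1}(zwE a) mdeg_mi2. Qed.

Lemma wdegD a e : wdeg (madd a e) = (wdeg a + wdeg e)%N.
Proof. exact: maddE. Qed.

Section LexicographicOrder.
Variable K : comNzRingType.
Implicit Types (F G : fps K 2) (a e : midx 2).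

(** The position of z^a0 w^a1 in the list of monomials that is ordered by
    degree, and then by the exponent of w. *)
Definition pos a : nat := ('C((mdeg a).+1, 2) + wdeg a)%N.

Definition lexle a e : Prop :=
  (mdeg a < mdeg e)%N \/ (mdeg a = mdeg e /\ wdeg a <= wdeg e)%N.

Lemma lexle_pos a e : lexle a e -> (pos e <= pos a)%N -> a = e.
Proof.
rewrite /pos => -[lt|[eqd le]].
  have : ('C((mdeg a).+2, 2) <= 'C((mdeg e).+1, 2))%N by apply: leq_bin2l.
  by rewrite binS bin1; have := mdeg2 a; lia.
rewrite eqd leq_add2l => ge; move: eqd; rewrite !mdeg2 => eqd.
by apply: zw_eq; lia.
Qed.

Lemma lexle_total a e : lexle a e \/ lexle e a.
Proof. by rewrite /lexle; lia. Qed.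

Lemma pos_inj : injective pos.
Proof.
move=> a e ae; have [h|h] := lexle_total a e; first by apply: lexle_pos; rewrite ?ae.
by apply/esym/lexle_pos; rewrite ?ae.
Qed.

Lemma mdeg_le_pos a : (mdeg a <= pos a)%N.
Proof. by rewrite /pos binS bin1 -addnA addnC -addnA leq_addr. Qed.

Definition unpos i : midx 2 := nth (midx0 2) [seq a <- box 2 i.+1 | pos a == i] 0.

Lemma unposK a : unpos (pos a) = a.
Proof.
rewrite /unpos; set s := [seq _ <- _ | _].
have as_ : a \in s by rewrite mem_filter eqxx mem_box_mdeg // ltnS mdeg_le_pos.
have : nth (midx0 2) s 0 \in s by rewrite mem_nth //; case: (s) as_.
by rewrite {2}/s mem_filter => /andP[/eqP/pos_inj].
Qed.

Definition lexlead a (c : K) F : Prop :=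
  (forall e, F e != 0 -> lexle a e) /\ F a = c.

Lemma lexle_anti a e : lexle a e -> lexle e a -> a = e.
Proof.
by rewrite /lexle !mdeg2 => h h'; apply: zw_eq; lia.
Qed.

Lemma lexlead_mul a b c d F G : lexlead a c F -> lexlead b d G ->
  lexlead (madd a b) (c * d) (F * G).
Proof.
move=> [Fa Fc] [Gb Gd]; split=> [e|].
  move=> /fpsM_neq0[x [y [<- /Fa ax /Gb bY]]].
  by move: ax bY; rewrite /lexle !mdegD !wdegD; lia.
rewrite fpsM_single ?Fc ?Gd // => x y xy /Fa ax /Gb bY; apply: lexle_anti => //.
have := congr1 (@mdeg 2) xy; have := congr1 (fun m : midx 2 => wdeg m) xy.
rewrite !wdegD !mdegD; move: ax bY; rewrite /lexle; lia.
Qed.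

Lemma lexlead_one : lexlead (midx0 2) 1 1.
Proof.
split=> [e|]; last by rewrite fps1 eqxx.
by rewrite fps1; have [-> _|_] := eqVneq e (midx0 2); [right|rewrite eqxx].
Qed.

Lemma lexlead_pow (H : 'I_2 -> fps K 2) c d a :
  lexlead (mi2 1 0) c (H 0) -> lexlead (mi2 0 1) d (H 1) ->
  lexlead a (c ^+ zdeg a * d ^+ wdeg a) (mpow H a).
Proof.
have pw i x F k : lexlead i x F ->
    lexlead [ffun j => (i j * k)%N] (x ^+ k) (F ^+ k).
  move=> h; elim: k => [|k IH].
    rewrite !expr0 (_ : [ffun j => _] = midx0 2); first exact: lexlead_one.
    by apply/ffunP => j; rewrite !ffunE muln0.
  rewrite !exprS; have := lexlead_mul h IH; congr lexlead.
  by apply/ffunP => j; rewrite !ffunE mulnS.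
move=> h0 h1; rewrite (_ : mpow H a = H 0 ^+ zdeg a * H 1 ^+ wdeg a); last first.
  rewrite /mpow !big_ord_recl big_ord0 mulr1; congr (_ * H _ ^+ a _); exact: val_inj.
have := lexlead_mul (pw _ _ _ (zdeg a) h0) (pw _ _ _ (wdeg a) h1); congr lexlead.
by apply/ffunP; apply: ord2P; rewrite !ffunE ?mul0n ?mul1n ?addn0.
Qed.

End LexicographicOrder.

Section NewtonInterpolation.
Variables (R : realType) (H : formal_map R) (x y : R).
Local Notation C := R[i].
Hypothesis H0 : null H.
Hypothesis Hf : H 0 (mi2 1 0) = (expR x)%:C.
Hypothesis Hg : H 1 (mi2 0 1) = (expR y)%:C.
Hypothesis Hgz : H 1 (mi2 1 0) = 0.

Let U (F : fps C 2) := fps_comp F H.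

Lemma lexlead_f : lexlead (mi2 1 0) (expR x)%:C (H 0).
Proof.
split=> // e He; rewrite /lexle mdeg_mi2 wdeg_mi2 mdeg2.
suff : ~ (zdeg e = 0 /\ wdeg e = 0)%N by lia.
by move=> [z w]; move: He; rewrite (zwE e) z w -midx0_2 H0 eqxx.
Qed.

Lemma lexlead_g : lexlead (mi2 0 1) (expR y)%:C (H 1).
Proof.
split=> // e He; rewrite /lexle mdeg_mi2 wdeg_mi2 mdeg2.
suff : ~ (zdeg e = 0 /\ wdeg e = 0)%N /\ ~ (zdeg e = 1 /\ wdeg e = 0)%N by lia.
by split; move=> [z w]; move: He; rewrite (zwE e) z w -?midx0_2 ?H0 ?Hgz eqxx.
Qed.

Definition expo i : R := x * (zdeg (unpos i))%:R + y * (wdeg (unpos i))%:R.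
Definition eigen i : C := (expR (expo i))%:C.

(** Substitution by H is triangular in the order of the positions, with a power
    of exp x and exp y on the diagonal. *)
Lemma mpow_lex a : lexlead a (eigen (pos a)) (mpow H a).
Proof.
have := lexlead_pow a lexlead_f lexlead_g; congr lexlead.
by rewrite /eigen /expo unposK expRD !expRM_natr rmorphM !rmorphXn.
Qed.

Definition pos_ge i (F : fps C 2) := forall e, (pos e < i)%N -> F e = 0.

Lemma pos_ge_step i F : pos_ge i F -> pos_ge i.+1 (U F - fcst 2 (eigen i) * F).
Proof.
move=> Fi e; rewrite ltnS => ei; rewrite fpsB fcstM /U.
rewrite (@fps_compE _ _ _ (mdeg e).+1) // (bigD1_seq e) ?box_uniq //= ?mem_box_mdeg //.
have [_ ->] := mpow_lex e; rewrite big1_seq ?addr0 => [|a /andP[ae _]].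
  have [->|ne] := eqVneq (pos e) i; first by rewrite mulrC subrr.
  by rewrite Fi ?mul0r ?mulr0 ?subrr // ltn_neqAle ne.
apply/eqP; rewrite mulf_eq0; apply: contraR ae; rewrite negb_or => /andP[Fa pa].
have [la _] := mpow_lex a; apply/eqP; apply: lexle_pos (la e pa) _.
by apply: leq_trans ei _; rewrite leqNgt; apply: contra_neqN Fa => /Fi.
Qed.

Fixpoint newton i F := if i is j.+1
  then U (newton j F) - fcst 2 (eigen j) * newton j F else F.

(** The i-th Newton difference kills the first i diagonal entries of a
    triangular operator. *)
Lemma pos_ge_newton i F : pos_ge i (newton i F).
Proof. by elim: i => [//|i IH] /=; apply: pos_ge_step. Qed.

Fixpoint divdiff (m i : nat) : C := if m is m'.+1
  then eigen i * divdiff m' i + (if i is i'.+1 then divdiff m' i' else 0)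
  else (i == 0)%:R.

Lemma divdiff_gt m i : (m < i)%N -> divdiff m i = 0.
Proof.
elim: m i => [|m IH] i mi /=; first by rewrite (gtn_eqF mi).
case: i mi => // i mi; rewrite !IH ?mulr0 ?addr0 //.
by rewrite ltnW.
Qed.

(** Newton interpolation of the function T |-> T^m at the eigenvalues of the
    triangular operator U. The numbers divdiff m i are the divided differences;
    they are defined by their recurrence in m. *)
Lemma iter_newton m N F : (m < N)%N ->
  iter m U F = \sum_(i < N) fcst 2 (divdiff m i) * newton i F.
Proof.
elim: m N => [|m IH] [//|N] mN.
  rewrite big_ord_recl /= rmorph1 mul1r big1 ?addr0 // => i _.
  by rewrite /= rmorph0 mul0r.
rewrite iterS (IH N) // {1}/U fps_comp_sum.
transitivity (\sum_(i < N) (fcst 2 (divdiff m i) * newton i.+1 F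
    + fcst 2 (eigen i * divdiff m i) * newton i F)).
  apply: eq_bigr => i _; rewrite fps_compM // fps_comp_cst //= -/(U _) rmorphM.
  by rewrite mulrBr [X in _ = _ + X]mulrAC; ring.
rewrite big_split /=; pose T i := fcst 2 (eigen i * divdiff m i) * newton i F.
have -> : \sum_(i < N) T i = \sum_(i < N.+1) T i.
  by rewrite [RHS]big_ord_recr /= /T divdiff_gt // mulr0 rmorph0 mul0r addr0.
rewrite [X in _ + X]big_ord_recl [RHS]big_ord_recl /= addr0 addrCA; congr (_ + _).
rewrite -big_split; apply: eq_bigr => i _ /=.
by rewrite /T rmorphD mulrDl addrC.
Qed.

(* E i extends the i-th divided difference of T |-> T^m from natural to real
   exponents m, and with it the coefficients of the iterates of H. By
   pos_ge_newton the differences beyond pos e vanish at e, so that finite sums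
   suffice. *)
Variable E : nat -> R -> C.
Hypothesis hE : forall i (m : nat), E i m%:R = divdiff m i.

Definition flow (t : R) : formal_map R := fun l e =>
  \sum_(i < (pos e).+1) E i t * newton i (fps_var C l) e.

Lemma flow_nat (m : nat) l : flow m%:R l = iter m U (fps_var C l).
Proof.
apply/funext => e; rewrite (@iter_newton m (m + pos e).+1) ?ltnS ?leq_addr //.
rewrite fps_sum /flow (big_ord_widen (m + pos e).+1 (fun i => E i m%:R * newton i (fps_var C l) e)) ?ltnS ?leq_addl //.
rewrite big_mkcond; apply: eq_bigr => i _; rewrite fcstM hE.
case: ifP => // /negbT; rewrite -ltnNge => ei.
by rewrite pos_ge_newton ?mulr0.
Qed.

Lemma flowS (m : nat) : flow m.+1%:R = mcomp (flow m%:R) H.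
Proof. by apply/funext => l; rewrite /Defs.map_comp !flow_nat. Qed.

Lemma flow0 : flow 0 = @formal_id R.
Proof. by apply/funext => l; rewrite (flow_nat 0). Qed.

End NewtonInterpolation.

(** * One-parameter families of automorphisms *)

Lemma det2 (K : comNzRingType) (A : 'M[K]_2) :
  \det A = A 0 0 * A 1 1 - A 0 1 * A 1 0.
Proof.
rewrite (expand_det_row _ ord0) !big_ord_recl big_ord0 addr0 /cofactor !det_mx11 !mxE /=.
rewrite expr0 expr1 mul1r mulN1r mulrN.
by congr (A _ _ * A _ _ - A _ _ * A _ _); apply: val_inj.
Qed.

Section FamiliesOfSeries.
Variable R : realType.
Local Notation C := R[i].

Definition exp_family n (F : R -> fps C n) := forall e, expoly (fun t => F t e).

Lemma exp_family_cst n (F : fps C n) : exp_family (fun=> F).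
Proof. by move=> e; apply: expoly_cst. Qed.

Lemma exp_familyM n (F G : R -> fps C n) :
  exp_family F -> exp_family G -> exp_family (fun t => F t * G t).
Proof.
move=> hF hG e.
apply: (@expoly_eq _ (fun t => \sum_(p <- splits e) F t p.1 * G t p.2)) => [|t]; last by rewrite fpsM.
by apply: expoly_sum => p _; apply: expolyM.
Qed.

Lemma exp_familyX n (F : R -> fps C n) k :
  exp_family F -> exp_family (fun t => F t ^+ k).
Proof.
move=> hF; elim: k => [|k IH]; first exact: exp_family_cst.
by under eq_fun do rewrite exprS; apply: exp_familyM.
Qed.

Lemma exp_familyD n (F G : R -> fps C n) :
  exp_family F -> exp_family G -> exp_family (fun t => F t + G t).
Proof. by move=> hF hG e; apply: expolyD. Qed.

Lemma exp_family_mpow n m (G : R -> 'I_n -> fps C m) a :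
  (forall i, exp_family (fun t => G t i)) -> exp_family (fun t => mpow (G t) a).
Proof.
move=> hG; rewrite /mpow; elim: (index_enum _) => [|i r IH].
  by under eq_fun do rewrite big_nil; apply: exp_family_cst.
under eq_fun do rewrite big_cons; apply: exp_familyM => //.
exact: exp_familyX.
Qed.

(** The coefficients of a composition are polynomials in finitely many
    coefficients of its arguments. *)
Lemma exp_family_comp n m (F : R -> fps C n) (G : R -> 'I_n -> fps C m) :
  exp_family F -> (forall i, exp_family (fun t => G t i)) ->
  exp_family (fun t => fps_comp (F t) (G t)).
Proof.
move=> hF hG e; rewrite /fps_comp; apply: expoly_sum => b _; apply: expolyM; first exact: hF.
under eq_fun do rewrite fps_monomialE.
exact: (exp_family_mpow _ hG).
Qed.

Lemma exp_family_conj n (F : R -> fps C n) :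
  exp_family F -> exp_family (fun t => fps_conj (F t)).
Proof. by move=> hF e; apply: expoly_conj. Qed.

End FamiliesOfSeries.

Section AutomorphismsOfNormalForms.
Variables (R : realType) (phi : fps R[i] 3).
Local Notation C := R[i].
Hypothesis phiN : normal_series phi.
Let r := normal_defining_series phi.
Implicit Types H G : formal_map R.

Lemma exp_family_defect (H : R -> formal_map R) :
  (forall l, exp_family (fun t => H t l)) -> exp_family (fun t => defect phi (H t)).
Proof.
move=> hH.
have hev l : exp_family (fun t => ev phi (H t l)).
  by apply: exp_family_comp => // i; apply: exp_family_cst.
have hevb l : exp_family (fun t => evb phi (H t l)).
  apply: exp_family_comp => [|i]; first exact: exp_family_conj.
  exact: exp_family_cst.
have hneg n (F : R -> fps C n) : exp_family F -> exp_family (fun t => - F t).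
  move=> hF e; apply: (expoly_eq (expolyM (expoly_cst (-1)) (hF e))) => t.
  by rewrite mulN1r fpsN.
apply: exp_familyD.
  apply: exp_familyM; first exact: exp_family_cst.
  by apply: exp_familyD => //; apply: hneg.
apply: hneg; apply: exp_family_comp; first exact: exp_family_cst.
apply: ord3P; [exact: hev|exact: hevb|].
apply: exp_familyM; first exact: exp_family_cst.
exact: exp_familyD.
Qed.

Lemma Autf_comp rho H G : Autf rho H -> Autf rho G -> Autf rho (mcomp H G).
Proof.
move=> [HI [a ha]] [GI [b hb]]; split; first exact: formal_invertible_comp.
have [H0 G0] := (formal_invertible_null HI, formal_invertible_null GI).
exists (pullback a G * b); rewrite pullback_comp // ha.
change (pullback (a * rho) G = pullback a G * b * rho).
by rewrite pullbackM // -mulrA; congr (_ * _).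
Qed.

Lemma Autf_id (rho : fps C (2 + 2)) : Autf rho (@formal_id R).
Proof.
split; first exact: formal_invertible_id.
by exists 1; rewrite pullback_id; change (rho = 1 * rho); rewrite mul1r.
Qed.

Section OneParameterFamily.
Variables (H : formal_map R) (x y : R).
Hypothesis HA : Autf r H.
Hypothesis Hf : H 0 (mi2 1 0) = (expR x)%:C.
Hypothesis Hg : H 1 (mi2 0 1) = (expR y)%:C.
Hypothesis Hgz : H 1 (mi2 1 0) = 0.
Variable E : nat -> R -> C.
Hypothesis hE : forall i (m : nat), E i m%:R = divdiff x y m i.
Hypothesis Eexp : forall i, expoly (E i).

Let H0 : null H := formal_invertible_null (proj1 HA).
Let fl := flow H x y E.

Lemma exp_family_flow l : exp_family (fun t => fl t l).
Proof.
move=> e; apply: expoly_sum => i _; apply: expolyM; first exact: Eexp.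
exact: expoly_cst.
Qed.

Lemma flow_nat_aut (m : nat) : Autf r (fl m%:R).
Proof.
elim: m => [|m IH]; first by rewrite /fl (flow0 H0 Hf Hg Hgz hE); apply: Autf_id.
by rewrite /fl (flowS H0 Hf Hg Hgz hE); apply: Autf_comp.
Qed.

Lemma flow_null t : null (fl t).
Proof.
move=> l; apply: (expoly_nat_eq0 (exp_family_flow l (midx0 2))) => m.
exact: (formal_invertible_null (proj1 (flow_nat_aut m))).
Qed.

Lemma mcomp_lin F G l j : null G -> mcomp F G l (midx1 j) =
  F l (mi2 1 0) * G 0 (midx1 j) + F l (mi2 0 1) * G 1 (midx1 j) :> C.
Proof.
move=> G0; rewrite [LHS]fps_comp_lin // !big_ord_recl big_ord0 addr0.
by rewrite -midx1_20 -midx1_21; congr (_ * G _ _ + F _ (midx1 _) * G _ _); apply: val_inj.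
Qed.

Lemma shear_step (K : comNzRingType) (X Y A B b h : K) :
  (X - Y) * b = h * (A - B) -> (X - Y) * (A * h + b * Y) = h * (A * X - B * Y).
Proof. by move=> e; rewrite mulrDr [X in _ + X]mulrA e; ring. Qed.

Lemma flow_nat_lin (m : nat) :
  [/\ fl m%:R 0 (mi2 1 0) = (expR (x * m%:R))%:C,
      fl m%:R 1 (mi2 0 1) = (expR (y * m%:R))%:C,
      fl m%:R 1 (mi2 1 0) = 0
    & ((expR x)%:C - (expR y)%:C) * fl m%:R 0 (mi2 0 1) =
      H 0 (mi2 0 1) * ((expR (x * m%:R))%:C - (expR (y * m%:R))%:C)].
Proof.
elim: m => [|m [IHf IHg IHz IHb]].
  rewrite /fl (flow0 H0 Hf Hg Hgz hE) !mulr0 expR0 subrr mulr0 /formal_id /fps_var.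
  have ne : (mi2 1 0 == mi2 0 1) = false by apply/eqP => /mi2_inj[].
  rewrite midx1_20 midx1_21 !eqxx [mi2 0 1 == _]eq_sym ne mulr0n mulr0.
  by split=> //; rewrite rmorph1.
have := fun l j => mcomp_lin (fl m%:R) l j H0.
rewrite /fl -(flowS H0 Hf Hg Hgz hE) -/fl => lin.
have e l : fl m.+1%:R l (mi2 1 0) = fl m%:R l (mi2 1 0) * H 0 (mi2 1 0) + fl m%:R l (mi2 0 1) * H 1 (mi2 1 0).
  by rewrite -[in LHS]midx1_20 lin midx1_20.
have e' l : fl m.+1%:R l (mi2 0 1) = fl m%:R l (mi2 1 0) * H 0 (mi2 0 1) + fl m%:R l (mi2 0 1) * H 1 (mi2 0 1).
  by rewrite -[in LHS]midx1_21 lin midx1_21.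
have ex (u : R) : (expR (u * m.+1%:R))%:C = (expR (u * m%:R))%:C * (expR u)%:C :> C.
  by rewrite -natr1 mulrDr mulr1 expRD rmorphM.
split.
- by rewrite e IHf Hgz mulr0 addr0 Hf ex.
- by rewrite e' IHz mul0r add0r IHg Hg ex.
- by rewrite e IHz Hgz mul0r mulr0 addr0.
rewrite e' IHf Hg (ex x) (ex y); exact: shear_step IHb.
Qed.

Lemma flow_lin t :
  [/\ fl t 0 (mi2 1 0) = (expR (x * t))%:C,
      fl t 1 (mi2 0 1) = (expR (y * t))%:C,
      fl t 1 (mi2 1 0) = 0
    & ((expR x)%:C - (expR y)%:C) * fl t 0 (mi2 0 1) =
      H 0 (mi2 0 1) * ((expR (x * t))%:C - (expR (y * t))%:C)].
Proof.
have ex (u : R) : expoly (fun t => (expR (u * t))%:C) := expoly_exp u.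
have fe l e := exp_family_flow l e.
split.
- by apply: (expoly_nat_eq (fe 0 _) (ex x) _ t) => m; have [] := flow_nat_lin m.
- by apply: (expoly_nat_eq (fe 1 _) (ex y) _ t) => m; have [] := flow_nat_lin m.
- by apply: (expoly_nat_eq (fe 1 _) (expoly_cst 0) _ t) => m; have [] := flow_nat_lin m.
have ed : expoly (fun t => (expR (x * t))%:C - (expR (y * t))%:C).
  apply: (expoly_eq (expolyD (ex x) (expolyM (expoly_cst (-1)) (ex y)))) => u.
  by rewrite mulN1r.
apply: (expoly_nat_eq (expolyM (expoly_cst _) (fe 0 _)) (expolyM (expoly_cst _) ed) _ t).
by move=> m; have [] := flow_nat_lin m.
Qed.

(** The defect of the family is an exponential polynomial of t, and vanishes
    when t is a natural number. *)
Theorem flow_aut t : Autf r (fl t).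
Proof.
apply/(Autf_normal phiN); split; last first.
  apply/funext => e; apply: (expoly_nat_eq0 (exp_family_defect exp_family_flow e)) => m.
  by have [_ ->] := (Autf_normal phiN _).1 (flow_nat_aut m).
split; first exact: flow_null.
have [a d c _] := flow_lin t.
rewrite unitmxE det2 !mxE midx1_20 midx1_21 a d c mulr0 subr0 unitfE.
by rewrite mulf_neq0 // fmorph_eq0 gt_eqF // expR_gt0.
Qed.

End OneParameterFamily.

(** The recurrence of the divided differences has solutions among the
    exponential polynomials. *)
Lemma divdiff_extension (x y : R) : exists E : nat -> R -> C,
  (forall i (m : nat), E i m%:R = divdiff x y m i) /\ (forall i, expoly (E i)).
Proof.
suff /boolp.choice[E hE] (i : nat) : exists e : R -> C,
    (forall m : nat, e m%:R = divdiff x y m i) /\ expoly e.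
  by exists E; split=> i; have [] := hE i.
elim: i => [|i [b [hb be]]].
  have [e [ee e0 es]] := expoly_recurrence (expo x y 0) 1 (expoly_cst (0 : C)).
  by exists e; split=> //; elim=> [|m IH]; rewrite ?e0 // es IH.
have [e [ee e0 es]] := expoly_recurrence (expo x y i.+1) 0 be.
by exists e; split=> //; elim=> [|m IH]; rewrite ?e0 // es IH hb.
Qed.

End AutomorphismsOfNormalForms.

(** * Derivatives of polynomial families *)

Section DerivativesAtZero.
Variable R : realType.
Local Notation C := R[i].

(** Differentiation at 0 of polynomial functions, as a formal operation. *)
Definition has_der (e : R -> C) (d : C) : Prop :=
  exists p : {poly C}, (forall t, e t = p.[t%:C]) /\ d = p`_1.

Lemma has_der_eq e e' d : has_der e d -> e =1 e' -> has_der e' d.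
Proof. by move=> [p [h hd]] ee; exists p; split=> // t; rewrite -ee. Qed.

Lemma has_der_uniq e d d' : has_der e d -> has_der e d' -> d = d'.
Proof.
move=> [p [h ->]] [p' [h' ->]]; suff -> : p = p' by [].
apply/eqP; rewrite -subr_eq0; apply/eqP/poly_nat_eq0 => m; rewrite hornerD hornerN.
by rewrite -(rmorph_nat (real_complex R)) -h -h' subrr.
Qed.

Lemma has_der_cst c : has_der (fun=> c) 0.
Proof. by exists c%:P; split=> [t|]; rewrite ?hornerC ?coefC. Qed.

Lemma has_derD e e' d d' : has_der e d -> has_der e' d' ->
  has_der (fun t => e t + e' t) (d + d').
Proof.
move=> [p [h ->]] [p' [h' ->]]; exists (p + p'); split=> [t|].
  by rewrite hornerD h h'.
by rewrite coefD.
Qed.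

Lemma has_derM e e' d d' : has_der e d -> has_der e' d' ->
  has_der (fun t => e t * e' t) (d * e' 0 + e 0 * d').
Proof.
move=> [p [h ->]] [p' [h' ->]]; exists (p * p'); split=> [t|].
  by rewrite hornerM h h'.
have p0 (q : {poly C}) : q.[0%:C] = q`_0 by rewrite rmorph0 horner_coef0.
rewrite h h' !p0 coefM !big_ord_recl big_ord0 addr0 /= addrC.
by congr (_ + _).
Qed.

Lemma has_der_sum (I : Type) (r : seq I) (P : pred I) (e : I -> R -> C) d :
  (forall i, P i -> has_der (e i) (d i)) ->
  has_der (fun t => \sum_(i <- r | P i) e i t) (\sum_(i <- r | P i) d i).
Proof.
move=> h; elim: r => [|i r IH].
  rewrite big_nil; apply: (has_der_eq (has_der_cst 0)) => t.
  by rewrite big_nil.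
rewrite big_cons; have [Pi|nPi] := boolP (P i).
  by apply: (has_der_eq (has_derD (h i Pi) IH)) => t; rewrite big_cons Pi.
by apply: (has_der_eq IH) => t; rewrite big_cons (negbTE nPi).
Qed.

Lemma has_der_conj e d : has_der e d -> has_der (fun t => (e t)^*%R) (d^*%R).
Proof.
move=> [p [h ->]]; exists (map_poly Num.conj p); split=> [t|]; last by rewrite coef_map.
by rewrite h -[in RHS]conj_real horner_map.
Qed.

Definition has_ders n (F : R -> fps C n) (X : fps C n) :=
  forall e, has_der (fun t => F t e) (X e).

Section Families.
Variable n : nat.
Implicit Types (F G : R -> fps C n) (X Y : fps C n).

Lemma has_ders_cst (f : fps C n) : has_ders (fun=> f) 0.
Proof. by move=> e; apply: has_der_cst. Qed.

Lemma has_dersD F G X Y : has_ders F X -> has_ders G Y ->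
  has_ders (fun t => F t + G t) (X + Y).
Proof. by move=> hF hG e; apply: has_derD. Qed.

Lemma has_dersM F G X Y : has_ders F X -> has_ders G Y ->
  has_ders (fun t => F t * G t) (X * G 0 + F 0 * Y).
Proof.
move=> hF hG e; rewrite fpsD !fpsM -big_split.
apply: (@has_der_eq (fun t => \sum_(p <- splits e) F t p.1 * G t p.2)) => [|t]; last first.
  by rewrite fpsM.
by apply: has_der_sum => p _; apply: has_derM.
Qed.

Lemma has_dersZ F X c : has_ders F X ->
  has_ders (fun t => fcst n c * F t) (fcst n c * X).
Proof. by move=> hF; have := has_dersM (has_ders_cst (fcst n c)) hF; rewrite mul0r add0r. Qed.

Lemma has_dersN F X : has_ders F X -> has_ders (fun t => - F t) (- X).
Proof.
move=> hF e; have := has_derM (has_der_cst (-1)) (hF e).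
rewrite mul0r add0r mulN1r => h; apply: has_der_eq h _ => t.
by rewrite mulN1r.
Qed.

Lemma has_dersX F X k : has_ders F X ->
  has_ders (fun t => F t ^+ k) ((F 0 ^+ k.-1 *+ k) * X).
Proof.
move=> hF; elim: k => [|k IH]; first by rewrite mulr0n mul0r; apply: has_ders_cst.
under [X in has_ders X]eq_fun do rewrite exprS.
have := has_dersM hF IH; congr has_ders.
case: k {IH} => [|k] /=; first by rewrite mulr0n mul0r mulr0 addr0 !expr0 mulr1 mul1r.
by rewrite !mulrnAl mulrnAr mulrA -exprS [X * _]mulrC -mulrS.
Qed.

End Families.

Lemma has_ders_comp_l n m (F : R -> fps C n) X (G : 'I_n -> fps C m) :
  has_ders F X -> has_ders (fun t => fps_comp (F t) G) (fps_comp X G).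
Proof.
move=> hF e; rewrite /fps_comp; apply: has_der_sum => b _.
have := has_derM (hF (bounded_midx b)) (has_der_cst (fps_monomial G (bounded_midx b) e)).
by rewrite mulr0 addr0.
Qed.

Lemma has_ders_conj n (F : R -> fps C n) X :
  has_ders F X -> has_ders (fun t => fps_conj (F t)) (fps_conj X).
Proof. by move=> hF e; apply: has_der_conj. Qed.

Lemma pderiv_mpow_var n (i : 'I_n) (a : midx n) :
  pderiv i (mpow (@fps_var C n) a) =
  mpow (@fps_var C n) [ffun j => (a j - (j == i))%N] *+ a i.
Proof.
apply/funext => e; rewrite /pderiv fpsMn !mpow_var.
have [aE|ne] := eqVneq (madd (midx1 i) e) a.
  rewrite (_ : e == _ = true) -?aE ?maddE ?ffunE ?eqxx ?add1n //.
  by apply/eqP/ffunP => j; rewrite !ffunE addKn.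
have [a0|a0] := posnP (a i); first by rewrite a0 mulr0n mul0rn.
rewrite (_ : e == _ = false) ?mul0rn //; apply: contraNF ne => /eqP ->.
apply/eqP/ffunP => j; rewrite !ffunE subnKC //.
by case: eqP => // ->.
Qed.

(** X has no constant term, so only finitely many monomials of phi contribute
    to the coefficient at e. *)
Lemma pderiv_mulE n (phi X : fps C n) (i : 'I_n) e d : X (midx0 n) = 0 ->
  (mdeg e < d)%N ->
  (pderiv i phi * X) e = \sum_(a <- box n d) phi a * (pderiv i (mpow (@fps_var C n) a) * X) e.
Proof.
move=> X0 ed; pose P := \sum_(a <- box n d) fcst n (phi a) * pderiv i (mpow (@fps_var C n) a).
have oP : order_ge d.-1 (pderiv i phi - P).
  move=> m md; rewrite fpsB /P fps_sum {1}/pderiv.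
  rewrite (bigD1_seq (madd (midx1 i) m)) ?box_uniq //=; last first.
    by rewrite mem_box_mdeg // mdegD mdeg1; lia.
  rewrite big1 ?addr0 => [|a /negbTE am]; rewrite fcstM /pderiv mpow_var.
    by rewrite eqxx mulrnAr mulr1 subrr.
  by rewrite eq_sym am mul0rn mulr0.
have -> : (pderiv i phi * X) e = (P * X) e.
  apply/eqP; rewrite -subr_eq0 -fpsB -mulrBl; apply/eqP.
  apply: (@order_geM _ _ d.-1 1) => //; first by apply/order_ge1.
  by rewrite addn1 prednK //; apply: leq_ltn_trans ed.
rewrite /P mulr_suml fps_sum; apply: eq_bigr => a _.
by rewrite -mulrA fcstM.
Qed.

Lemma leibniz3 (K : comNzRingType) (A B D a b c X Y Z : K) i j k :
  (a *+ i * X * B + A * (b *+ j * Y)) * D + A * B * (c *+ k * Z) =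
  (a * B * D) *+ i * X + (A * b * D) *+ j * Y + (A * B * c) *+ k * Z.
Proof.
rewrite !mulrnAl !mulrnAr !mulrDl !mulrnAl; congr (_ *+ _ + _ *+ _ + _ *+ _); ring.
Qed.

(** The chain rule at the identity holds for each monomial of phi by the
    product rule, and only finitely many monomials matter for a coefficient. *)
Lemma has_ders_comp3 (phi : fps C 3) (F G K : R -> fps C 3) X Y Z :
  has_ders F X -> has_ders G Y -> has_ders K Z ->
  (forall t, null (t3 (F t) (G t) (K t))) ->
  F 0 = zv R -> G 0 = chiv R -> K 0 = sv R ->
  X (midx0 3) = 0 -> Y (midx0 3) = 0 -> Z (midx0 3) = 0 ->
  has_ders (fun t => fps_comp phi (t3 (F t) (G t) (K t)))
    (pderiv 0 phi * X + pderiv 1 phi * Y + pderiv ord_max phi * Z).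
Proof.
move=> hF hG hK n0 F0 G0 K0 X0 Y0 Z0 e; set d := (mdeg e).+1.
rewrite !fpsD !(@pderiv_mulE _ _ _ _ e d) // -!big_split /=.
apply: (@has_der_eq (fun t => \sum_(a <- box 3 d) phi a * mpow (t3 (F t) (G t) (K t)) a e)) => [|t]; last first.
  by rewrite (@fps_compE _ _ _ d).
apply: has_der_sum => a _; rewrite -!mulrDr.
rewrite -[phi a * _]add0r -[X in X + _](mul0r (mpow (t3 (F 0) (G 0) (K 0)) a e)).
apply: has_derM; first exact: has_der_cst.
rewrite -!fpsD; move: e {d}.
rewrite -/(has_ders _ _) (mi3E a); move: (a 0) (a 1) (a ord_max) => b c v.
under [X in has_ders X]eq_fun do rewrite mpow_t3.
have := has_dersM (has_dersM (has_dersX b hF) (has_dersX c hG)) (has_dersX v hK).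
congr has_ders; rewrite F0 G0 K0 !pderiv_mpow_var -var3_id.
have e1 : [ffun j => (mi3 b c v j - (j == (0%R : 'I_3)))%N] = mi3 b.-1 c v.
  by apply/ffunP; apply: ord3P; rewrite !ffunE ?subn0 ?subn1.
have e2 : [ffun j => (mi3 b c v j - (j == (1%R : 'I_3)))%N] = mi3 b c.-1 v.
  by apply/ffunP; apply: ord3P; rewrite !ffunE ?subn0 ?subn1.
have e3 : [ffun j => (mi3 b c v j - (j == ord_max))%N] = mi3 b c v.-1.
  by apply/ffunP; apply: ord3P; rewrite !ffunE ?subn0 ?subn1.
rewrite e1 e2 e3 !mpow_t3 !ffunE t3E0 t3E1 t3E2; exact: leibniz3.
Qed.

End DerivativesAtZero.

(** * Automorphisms tangent to the identity *)

Section BinomialPolynomials.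
Variable F : numFieldType.

Definition bin_poly (i : nat) : {poly F} :=
  (i`!%:R)^-1 *: \prod_(j < i) ('X - j%:R%:P).

Lemma bin_poly0 : bin_poly 0 = 1.
Proof. by rewrite /bin_poly big_ord0 invr1 scale1r. Qed.

Lemma bin_poly1 : bin_poly 1 = 'X.
Proof. by rewrite /bin_poly big_ord1 subr0 invr1 scale1r. Qed.

Lemma bin_poly_nat i (m : nat) : (bin_poly i).[m%:R] = 'C(m, i)%:R.
Proof.
rewrite /bin_poly hornerZ horner_prod.
have -> : \prod_(j < i) ('X - j%:R%:P).[m%:R] = (m ^_ i)%:R :> F.
  elim: i => [|i IH]; first by rewrite big_ord0.
  rewrite big_ord_recr IH /= ffactnSr natrM !hornerE.
  have [le|lt] := leqP i m; first by rewrite natrB.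
  by rewrite ffact_small // !mul0r.
by rewrite -bin_ffact natrM mulrC mulfK // pnatr_eq0 -lt0n fact_gt0.
Qed.

End BinomialPolynomials.

Section TangentToIdentity.
Variables (R : realType) (phi : fps R[i] 3).
Local Notation C := R[i].
Hypothesis phiN : normal_series phi.
Let r := normal_defining_series phi.
Variable H : formal_map R.
Hypothesis HA : Autf r H.
Hypothesis Hf : H 0 (mi2 1 0) = 1.
Hypothesis Hg : H 1 (mi2 0 1) = 1.
Hypothesis Hgz : H 1 (mi2 1 0) = 0.

Let H0 : null H := formal_invertible_null (proj1 HA).

Let Hf' : H 0 (mi2 1 0) = (expR 0)%:C. Proof. by rewrite expR0. Qed.
Let Hg' : H 1 (mi2 0 1) = (expR 0)%:C. Proof. by rewrite expR0. Qed.

Let E i (t : R) : C := (bin_poly C i).[t%:C].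

Lemma eigen00 i : eigen 0 0 i = 1 :> C.
Proof. by rewrite /eigen /expo !mul0r addr0 expR0. Qed.

(** All eigenvalues are 1, and the divided differences of T |-> T^m at 1 are
    the binomial coefficients. *)
Lemma bin_divdiff i (m : nat) : E i m%:R = divdiff 0 0 m i.
Proof.
rewrite /E rmorph_nat bin_poly_nat; elim: m i => [|m IH] [|i] //=.
- by rewrite -(IH 0) !bin0 eigen00 mulr1 addr0.
- by rewrite -!IH eigen00 mul1r binS natrD.
Qed.

Lemma expoly_bin i : expoly (E i). Proof. exact: expoly_poly. Qed.

Let fl := flow H 0 0 E.

Lemma uflow_aut t : Autf r (fl t).
Proof. have h := flow_aut phiN HA Hf' Hg' Hgz (E:=E). have h2 := h bin_divdiff expoly_bin. exact: h2. Qed.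

Let fl0 : fl 0 = @formal_id R.
Proof. have h := flow0 H0 Hf' Hg' Hgz (E:=E). have h2 := h bin_divdiff. exact: h2. Qed.

(** The derivative at the identity of the one-parameter group through H. *)
Definition log_field : formal_map R := fun l e =>
  \sum_(i < (pos e).+1) (bin_poly C i)`_1 * newton H 0 0 i (fps_var C l) e.

Let V : formal_map R := fun l => H l - fps_var C l.

Lemma newton1 l : newton H 0 0 1 (fps_var C l) = V l.
Proof. by rewrite /= fps_comp_var // eigen00 rmorph1 mul1r. Qed.

Lemma has_ders_flow l : has_ders (fun t => fl t l) (log_field l).
Proof.
move=> e; apply: has_der_sum => i _.
have hE : has_der (E i) (bin_poly C i)`_1 by exists (bin_poly C i).
by have := has_derM hE (has_der_cst (newton H 0 0 i (fps_var C l) e)); rewrite mulr0 addr0.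
Qed.

Lemma log_field_null l : log_field l (midx0 2) = 0.
Proof.
apply: has_der_uniq (has_der_cst 0).
apply: has_der_eq (has_ders_flow l (midx0 2)) _ => t.
exact: (formal_invertible_null (proj1 (uflow_aut t))).
Qed.

Lemma log_field_lin : log_field 1 (mi2 0 1) = 0.
Proof.
apply: has_der_uniq (has_ders_flow 1 (mi2 0 1)) _; apply: has_der_eq (has_der_cst 1) _ => t.
by rewrite /fl; have [_ -> _ _] := flow_lin HA Hf' Hg' Hgz bin_divdiff expoly_bin t; rewrite mul0r expR0.
Qed.

(** The derivative at t = 0 of the identity that the defect of the family
    vanishes. *)
Theorem log_field_tangent : tangent phi (log_field 0) (log_field 1).
Proof.
have hev l : has_ders (fun t => ev phi (fl t l)) (ev phi (log_field l)).
  exact/has_ders_comp_l/has_ders_flow.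
have hevb l : has_ders (fun t => evb phi (fl t l)) (evb phi (log_field l)).
  exact/has_ders_comp_l/has_ders_conj/has_ders_flow.
have him := has_dersZ (2%:R * 'i)^-1 (has_dersD (hev 1) (has_dersN (hevb 1))).
have hre := has_dersZ 2%:R^-1 (has_dersD (hev 1) (hevb 1)).
have n0 t l : fl t l (midx0 2) = 0 := flow_null HA Hf' Hg' Hgz bin_divdiff expoly_bin t l.
have evid l : ev phi (@formal_id R l) = t2 (zv R) (wpar phi 'i) l.
  by rewrite /ev /formal_id fps_comp_var //; apply: null_par.
have evbid l : evb phi (@formal_id R l) = t2 (chiv R) (wpar phi (- 'i)) l.
  rewrite /evb /formal_id (_ : fps_conj _ = fps_var C l) ?fps_comp_var //; first exact: null_parb.
  exact: (fps_map_var Num.conj l).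
have z0 : re_part (ev phi (log_field 1)) (evb phi (log_field 1)) (midx0 3) = 0.
  by rewrite /re_part fcstM fpsD null_ev ?null_evb ?log_field_null // addr0 mulr0.
have hc := has_ders_comp3 phi (hev 0) (hevb 0) hre.
have hd := has_dersD him (has_dersN (hc _ _ _ _ _ _ z0)).
apply/eqP; rewrite -subr_eq0; apply/eqP/funext => e.
apply: has_der_uniq (has_der_cst 0); apply: has_der_eq (hd _ _ _ _ _ _ e) _.
- move=> t; apply: null_t3; [by rewrite null_ev ?n0|by rewrite null_evb ?n0|].
  by rewrite fcstM fpsD null_ev ?null_evb ?n0 // addr0 mulr0.
- by rewrite fl0 evid.
- by rewrite fl0 evbid.
- by rewrite fl0 evid evbid; apply: re_par.
- by rewrite null_ev // log_field_null.
- by rewrite null_evb // log_field_null.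
move=> t; have [_ /(congr1 (fun F : fps C 3 => F e))] := (Autf_normal phiN _).1 (uflow_aut t).
by [].
Qed.

Lemma pos_geD i j F : pos_ge i F -> pos_ge (i + j) (iter j (fun G => fps_comp G H - fcst 2 1 * G) F).
Proof.
elim: j F => [|j IH] F hF; first by rewrite addn0.
rewrite addnS iterS; have := pos_ge_step H0 Hf' Hg' Hgz (IH F hF).
by rewrite eigen00.
Qed.

Lemma newtonS l i : newton H 0 0 i.+1 (fps_var C l) =
  iter i (fun G => fps_comp G H - fcst 2 1 * G) (V l).
Proof.
elim: i => [|i IH]; first exact: newton1.
by rewrite iterS -IH -[X in fcst 2 X](eigen00 i.+1).
Qed.

Lemma log_fieldE l e : log_field l e = V l e +
  \sum_(2 <= i < (pos e).+1) (bin_poly C i)`_1 * newton H 0 0 i (fps_var C l) e.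
Proof.
rewrite /log_field -(big_mkord xpredT (fun i => (bin_poly C i)`_1 * newton H 0 0 i (fps_var C l) e)).
rewrite big_ltn // bin_poly0 coef1 mul0r add0r.
have [p0|p0] := posnP (pos e).
  rewrite p0 !big_geq // addr0.
  have -> : e = midx0 2 by apply: pos_inj; rewrite p0 /pos mdeg0 /wdeg ffunE.
  by rewrite /V fpsB H0 null_var subr0.
by rewrite big_ltn ?ltnS // bin_poly1 coefX mul1r newton1.
Qed.

(** The higher differences of H - id start at later positions than H - id
    itself. *)
Lemma log_field_lead l e : (forall a, (pos a < pos e)%N -> V l a = 0) ->
  log_field l e = V l e.
Proof.
move=> h; rewrite log_fieldE big_nat_cond big1 ?addr0 // => -[|[|i]] //= _.
by rewrite -/(newton H 0 0 i.+2 _) newtonS (pos_geD (i := pos e)) ?mulr0 // addnS ltnS leq_addr.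
Qed.

Lemma lt_pos_mdeg a e : (pos a < pos e)%N -> (mdeg a <= mdeg e)%N.
Proof.
have [h|h] := lexle_total e a; last by case: h => [|[]]; lia.
by move=> ae; rewrite (lexle_pos h (ltnW ae)).
Qed.

Lemma log_field_order k l : order_ge k (log_field l) -> order_ge k (V l).
Proof.
move=> hX e; have [p] := ubnP (pos e); elim: p e => // p IH e ep ek.
rewrite -log_field_lead ?hX // => a ae; apply: IH; first exact: leq_trans ae ep.
exact: leq_ltn_trans (lt_pos_mdeg ae) ek.
Qed.

Lemma log_field_eq0 : (forall l, log_field l = 0) -> H = @formal_id R.
Proof.
move=> X0; apply/funext => l; apply/eqP; rewrite -subr_eq0; apply/eqP.
apply: order_ge_all => d; apply: log_field_order => e _.
by rewrite X0.
Qed.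

Section LeadingTerm.
Variable k : nat.
Hypotheses (k2 : (2 <= k)%N) (Xk : forall l, order_ge k (log_field l)).

(** The second difference is V o H - V, whose order exceeds that of V because H
    is tangent to the identity. *)
Lemma newton_order l i e : (mdeg e <= k)%N -> newton H 0 0 i.+2 (fps_var C l) e = 0.
Proof.
suff h : order_ge k.+1 (newton H 0 0 i.+2 (fps_var C l)) by move=> ek; apply: h.
have h2 j : order_ge 2 (H j - fps_var C j).
  exact: order_geW k2 (log_field_order (@Xk j)).
have st F d : order_ge d F -> order_ge d.+1 (fps_comp F H - fcst 2 1 * F).
  by move=> Fd; rewrite rmorph1 mul1r; apply: comp_tangent_id.
rewrite newtonS; elim: i => [|i IH]; first exact/st/log_field_order.
by rewrite iterS; apply: order_geW (st _ _ IH).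
Qed.

Lemma flow_jet t l e : (mdeg e <= k)%N -> fl t l e = @formal_id R l e + t%:C * V l e.
Proof.
move=> ek; rewrite /fl /flow -(big_mkord xpredT (fun i => E i t * newton H 0 0 i (fps_var C l) e)).
rewrite big_ltn // {1}/E bin_poly0 hornerC mul1r; congr (_ + _).
have [p0|p0] := posnP (pos e).
  rewrite p0 big_geq //.
  have -> : e = midx0 2 by apply: pos_inj; rewrite p0 /pos mdeg0 /wdeg ffunE.
  by rewrite /V fpsB H0 null_var subr0 mulr0.
rewrite big_ltn ?ltnS // {1}/E bin_poly1 hornerX newton1.
rewrite big_nat_cond big1 ?addr0 // => -[|[|i]] //= _.
by rewrite -/(newton H 0 0 i.+2 _) newton_order ?mulr0.
Qed.

Lemma log_field_jet l e : (mdeg e <= k)%N -> log_field l e = V l e.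
Proof.
move=> ek; rewrite log_fieldE big_nat_cond big1 ?addr0 // => -[|[|i]] //= _.
by rewrite -/(newton H 0 0 i.+2 _) newton_order ?mulr0.
Qed.

End LeadingTerm.

Variables (al n mu : nat) (t' : nat * nat * nat).
Hypotheses (Lt : Lambda phi (al, n, mu)) (Lt' : Lambda phi t').
Hypotheses (tt' : t' <> (al, n, mu)) (aln : al <> n).

(** Unless H is the identity, its logarithm is a nonzero tangent field without
    linear part, so tangent_rigid applies. Up to degree k, V is the logarithm
    of H and the one-parameter group is affine in t. *)
Theorem tangent_to_identity : H = @formal_id R \/
  exists k, [/\ (2 <= k)%N, common_slope phi al n mu k,
    V 1 (mi2 0 k) != 0 /\ V 1 (mi2 0 k) = (V 1 (mi2 0 k))^*%R,
    (forall l, order_ge k (V l))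
  & forall t, exists G, Autf r G /\ (forall l e, (mdeg e <= k)%N ->
      G l e = @formal_id R l e + t%:C * V l e)].
Proof.
have [[x0 e0]|[k [k2 sl e0 er low]]] := tangent_rigid phiN Lt Lt' tt' aln log_field_tangent
  (etrans (f_equal _ (esym midx0_2)) (log_field_null 1)) log_field_lin.
  by left; apply: log_field_eq0; apply: ord2P.
right; exists k; have Xk l : order_ge k (log_field l).
  by move: l; apply: ord2P => e /low[].
have ek : (mdeg (mi2 0 k) <= k)%N by rewrite mdeg_mi2.
rewrite -(log_field_jet k2 Xk 1 ek); split=> // [l|t]; first exact: log_field_order.
by exists (fl t); split=> [|l e]; [exact: uflow_aut|exact: flow_jet].
Qed.

End TangentToIdentity.

(** * The group of automorphisms and its linear parts *)

Section Inverses.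
Variable R : realType.
Local Notation C := R[i].
Implicit Types (rho r u a v : fps C (2 + 2)) (H G T L : formal_map R).

Lemma fps_unit_null n (a b : fps C n) : a * b = 1 -> a (midx0 n) != 0.
Proof.
move=> ab; apply/eqP => a0; have : (b * a) (midx0 n) = 0 by apply: fpsM_null.
by rewrite mulrC ab fps1 eqxx => /eqP; rewrite oner_eq0.
Qed.

Lemma inverse_pullback rho r u T L : null T -> null L ->
  mcomp T L = @formal_id R -> pullback rho T = u * r -> u (midx0 _) != 0 ->
  exists2 v : fps C (2 + 2), v (midx0 _) != 0 & pullback r L = v * rho.
Proof.
move=> T0 L0 TL Tu u0; have [|v uv] := @fps_unit _ _ (pullback u L).
  by rewrite /pullback fps_comp_const //; apply: null_with_bar.
exists v; first by apply: (@fps_unit_null _ _ (pullback u L)); rewrite mulrC.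
rewrite -[LHS]mul1r -uv mulrAC -pullbackM // -Tu -pullback_comp // TL pullback_id.
exact: mulrC.
Qed.

End Inverses.

Section NormalForm.
Variables (R : realType) (rho : fps R[i] (2 + 2)) (T : formal_map R).
Variable phi : fps R[i] 3.
Local Notation C := R[i].
Implicit Types (H G K L : formal_map R).
Hypothesis rhoH : formal_hypersurface rho.
Hypothesis Tphi : normal_coordinates rho T phi.
Let r := normal_defining_series phi.

Let phiN : normal_series phi. Proof. by case: Tphi. Qed.
Let TI : formal_invertible T. Proof. by case: Tphi. Qed.
Let T0 : null T := formal_invertible_null TI.

Lemma normal_inverse : exists L, [/\ formal_invertible L,
  mcomp L T = @formal_id R, mcomp T L = @formal_id R,
  forall H, Autf rho H -> Autf r (mcomp L (mcomp H T))
  & forall H, Autf r H -> Autf rho (mcomp T (mcomp H L))].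
Proof.
have [L [LI LT TL]] := formal_inverse TI; exists L.
have L0 := formal_invertible_null LI; case: Tphi => _ _ [u Tu].
have u0 := normal_factor_unit rhoH TI phiN Tu.
have [v v0 Lv] := inverse_pullback T0 L0 TL Tu u0.
split=> // H; first exact: (Autf_conj TI LI TL u0 Tu).
exact: (Autf_conj LI TI LT v0 Lv).
Qed.

Lemma Autf_inv H : Autf r H ->
  exists G, [/\ Autf r G, mcomp H G = @formal_id R & mcomp G H = @formal_id R].
Proof.
move=> [HI [a Ha]]; have [G [GI GH HG]] := formal_inverse HI.
have [H0 G0] := (formal_invertible_null HI, formal_invertible_null GI).
exists G; split=> //; split=> //; case: Tphi => _ _ [u Tu].
have Ha' : pullback r H = a * r := Ha.
have a0 : a (midx0 _) != 0.
  have : pullback rho (mcomp T H) = pullback u H * a * r.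
    by rewrite pullback_comp // Tu -/r -mulrA -Ha' -pullbackM.
  move=> /(normal_factor_unit rhoH (formal_invertible_comp TI HI) phiN).
  by apply: contraNneq => a0; rewrite fpsM_null.
by have [v _ Gv] := inverse_pullback H0 G0 HG Ha' a0; exists v; exact: Gv.
Qed.

Variables (al n mu : nat) (t' : nat * nat * nat).
Hypotheses (Lt : Lambda phi (al, n, mu)) (Lt' : Lambda phi t').
Hypotheses (tt' : t' <> (al, n, mu)) (aln : al <> n).

Definition gam H : C := H 0 (mi2 1 0).
Definition del H : C := H 1 (mi2 0 1).

Lemma Autf_gz H : Autf r H -> H 1 (mi2 1 0) = 0.
Proof.
move=> /(Autf_normal phiN)[/formal_invertible_null H0 dH].
exact: (g_z phiN H0 dH (lambda_leading phiN Lt Lt' tt' Lt)).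
Qed.

Lemma Autf_del_real H : Autf r H -> del H = (del H)^*%R.
Proof.
move=> /(Autf_normal phiN)[/formal_invertible_null H0 dH].
exact: (del_real phiN H0 dH (lambda_leading phiN Lt Lt' tt' Lt)).
Qed.

Lemma Autf_lin_neq0 H : Autf r H -> gam H != 0 /\ del H != 0.
Proof.
move=> HA; have gz := Autf_gz HA; case: HA => [[_]].
rewrite unitmxE det2 !mxE midx1_20 midx1_21 gz mulr0 subr0 unitfE mulf_eq0 negb_or.
by move=> /andP[].
Qed.

Lemma Autf_relation H al' n' mu' : Autf r H -> Lambda phi (al', n', mu') ->
  del H = gam H ^+ al' * (gam H)^*%R ^+ n' * del H ^+ mu'.
Proof.
move=> /(Autf_normal phiN)[/formal_invertible_null H0 dH] h.
exact: (linear_part_relation phiN H0 dH (lambda_leading phiN Lt Lt' tt' h)).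
Qed.

Lemma gamM H G : Autf r H -> Autf r G -> gam (mcomp H G) = gam H * gam G.
Proof.
move=> HA GA; rewrite /gam -[in LHS]midx1_20 mcomp_lin; last exact: formal_invertible_null (proj1 GA).
by rewrite midx1_20 (Autf_gz GA) mulr0 addr0.
Qed.

Lemma delM H G : Autf r H -> Autf r G -> del (mcomp H G) = del H * del G.
Proof.
move=> HA GA; rewrite /del -[in LHS]midx1_21 mcomp_lin; last exact: formal_invertible_null (proj1 GA).
by rewrite midx1_21 (Autf_gz HA) mul0r add0r.
Qed.

Lemma gam_id : gam (@formal_id R) = 1.
Proof. by rewrite /gam /formal_id /fps_var midx1_20 eqxx. Qed.

Lemma del_id : del (@formal_id R) = 1.
Proof. by rewrite /del /formal_id /fps_var midx1_21 eqxx. Qed.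

Lemma norm_expR (z : C) : z != 0 -> exists x : R, `|z| = (expR x)%:C.
Proof.
move=> z0; have hz : `|z| = (complex.Re `|z|)%:C by rewrite RRe_real // normr_real.
exists (ln (complex.Re `|z|)); rewrite lnK // posrE.
by rewrite -ltcR -hz normr_gt0.
Qed.

(** The logarithms x and y of the absolute values of gamma and delta are
    weights of z and w for which all leading terms have the weight of w, which
    is the situation of common_slopeP for k = 1. *)
Lemma Autf_weights H : Autf r H -> exists x y : R,
  [/\ `|gam H| = (expR x)%:C, `|del H| = (expR y)%:C,
      forall al' n' mu', Lambda phi (al', n', mu') ->
        (al' + n')%:R * x = (1 - mu'%:R) * y
    & y != 0 -> common_slope phi al n mu 1].
Proof.
move=> HA; have [/norm_expR[x hx] /norm_expR[y hy]] := Autf_lin_neq0 HA.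
have w al' n' mu' : Lambda phi (al', n', mu') ->
    (al' + n')%:R * x = (1 - mu'%:R) * y.
  move=> h; have := congr1 Num.norm (Autf_relation HA h).
  rewrite !normrM !normrX norm_conjC hx hy -!rmorphXn -!rmorphM => /complexI.
  rewrite -!expRM_natl -!expRD => /expR_inj e.
  by rewrite natrD mulrDl mulrBl mul1r {1}e; ring.
exists x, y; split=> // y0; exact: (common_slopeP phiN Lt aln (k := 1) w y0).
Qed.

(** These automorphisms form the kernel of the phase map below. *)
Definition positive H := exists x y : R, gam H = (expR x)%:C /\ del H = (expR y)%:C.

Definition unipotent H := gam H = 1 /\ del H = 1.

Lemma unipotent_rigid H : Autf r H -> unipotent H ->
  (forall k, (2 <= k)%N -> common_slope phi al n mu k -> H 1 (mi2 0 k) = 0) ->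
  H = @formal_id R.
Proof.
move=> HA [Hf Hg] hk.
have [//|[k [k2 sl [+ _] _ _]]] := tangent_to_identity phiN HA Hf Hg (Autf_gz HA) Lt Lt' tt' aln.
rewrite fpsB hk // /fps_var midx1_21 (_ : (mi2 0 k == mi2 0 1) = false) ?subr0 ?eqxx //.
by apply/eqP => /mi2_inj[_] k1; rewrite k1 in k2.
Qed.

Lemma unipotent_order2 H : Autf r H -> unipotent H ->
  (exists2 k, (2 <= k)%N & common_slope phi al n mu k) \/ H = @formal_id R.
Proof.
move=> HA [Hf Hg].
have [->|[k [k2 sl _ _ _]]] := tangent_to_identity phiN HA Hf Hg (Autf_gz HA) Lt Lt' tt' aln.
  by right.
by left; exists k.
Qed.

(** If H = K o G with K = id + V, and V vanishes to order k, then V and H - G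
    have the same terms of degree k. *)
Lemma unipotent_inj H G : Autf r H -> Autf r G -> unipotent H -> unipotent G ->
  (forall k, (2 <= k)%N -> common_slope phi al n mu k ->
     H 1 (mi2 0 k) = G 1 (mi2 0 k)) ->
  H = G.
Proof.
move=> HA GA [Hf Hg] [Gf Gg] hk.
have [G' [G'A GG' G'G]] := Autf_inv GA.
have G0 := formal_invertible_null (proj1 GA).
have G'0 := formal_invertible_null (proj1 G'A).
pose K := mcomp H G'; have KA : Autf r K by apply: Autf_comp.
have KG : mcomp K G = H by rewrite /K mcompA // G'G mcomp1.
have Kf : gam K = 1 by move: (gamM KA GA); rewrite KG Hf Gf mulr1.
have Kg : del K = 1 by move: (delM KA GA); rewrite KG Hg Gg mulr1.
have [K1|[k [k2 sl [/negP n0 _] hV _]]] := tangent_to_identity phiN KA Kf Kg (Autf_gz KA) Lt Lt' tt' aln.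
  by rewrite -KG K1 m1comp.
case: n0; have G2 i : order_ge 2 (G i - fps_var C i).
  have [->|[k' [k'2 _ _ h _]]] := tangent_to_identity phiN GA Gf Gg (Autf_gz GA) Lt Lt' tt' aln.
    by rewrite subrr => e.
  exact: order_geW (h i).
have := @comp_tangent_id _ _ G _ k G0 G2 (hV 1) (mi2 0 k).
rewrite mdeg_mi2 ltnSn => /(_ isT); rewrite fps_compB fps_comp_var //.
have -> : fps_comp (K 1) G = H 1 by rewrite -KG.
by rewrite !fpsB hk // subrr sub0r => /eqP; rewrite oppr_eq0.
Qed.

Lemma common_slope_inj k k' : common_slope phi al n mu k ->
  common_slope phi al n mu k' -> k = k'.
Proof.
case: t' Lt' tt' => [[al' n'] mu'] h ne /(_ _ _ _ h ne)[_ e] /(_ _ _ _ h ne)[_].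
by rewrite e => /eqP; rewrite eqr_nat => /eqP.
Qed.

(** The logarithms of gamma and delta vanish by Autf_weights. *)
Lemma positive_unipotent H : Autf r H -> positive H ->
  ~ common_slope phi al n mu 1 -> unipotent H.
Proof.
move=> HA [x [y [hx hy]]] n1; have [x' [y' [hx' hy' w y0]]] := Autf_weights HA.
have ge0 (z : R) : (0 : C) <= (expR z)%:C by rewrite ler0c expR_ge0.
move: hx' hy'; rewrite hx hy !ger0_norm // => /complexI/expR_inj xx /complexI/expR_inj yy.
have y'0 : y' = 0 by apply/eqP/negPn/negP => /y0.
have x'0 : x' = 0.
  have := w _ _ _ Lt; rewrite y'0 mulr0 => /eqP; rewrite mulf_eq0 pnatr_eq0.
  by have [al0 n0] := Lambda_gt0 phiN Lt; rewrite addn_eq0 -leqn0 leqNgt al0 => /eqP.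
by rewrite /unipotent hx hy xx yy x'0 y'0 expR0 rmorph1.
Qed.

(** The linear part up to positive factors. *)
Definition phase H : C * C := (gam H / `|gam H|, del H / `|del H|).

Lemma phaseM H G : Autf r H -> Autf r G ->
  phase (mcomp H G) = ((phase H).1 * (phase G).1, (phase H).2 * (phase G).2).
Proof.
move=> HA GA; rewrite /phase gamM // delM // !normrM !invfM /=.
by congr (_, _); rewrite mulrACA.
Qed.

(** Dividing the relation between gamma and delta by its absolute value leaves
    the relation for the phases. As delta is real, its phase is a sign, so that
    the conjugate form of the relation has the exponents n - alpha and mu - 1. *)
Lemma phase_N H : Autf r H -> N_group phi (phase H).
Proof.
move=> HA al' n' mu' h; have [g0 d0] := Autf_lin_neq0 HA.
have un (z : C) : z != 0 -> `|z / `|z| | = 1.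
  by move=> z0; rewrite normrM normfV normr_id divff // normr_eq0.
have dr := Autf_del_real HA.
have d1 : (phase H).2 = 1 \/ (phase H).2 = -1.
  rewrite /phase /=; have : del H \is Num.real by apply/CrealP.
  rewrite realE => /orP[d|d]; [left|right].
    by rewrite ger0_norm // divff.
  by rewrite ler0_norm // invrN mulrN divff.
have rel : (phase H).2 = (phase H).1 ^+ al' * (phase H).1^-1 ^+ n' * (phase H).2 ^+ mu'.
  have -> : (phase H).1^-1 = (phase H).1^*%R.
    rewrite /phase /=; apply: (mulfI (mulf_neq0 g0 _ : gam H / `|gam H| != 0)).
      by rewrite invr_eq0 normr_eq0.
    rewrite divff ?mulf_neq0 ?invr_eq0 ?normr_eq0 //.
    by rewrite -normCK un ?expr1n.
  have nr := congr1 Num.norm (Autf_relation HA h).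
  rewrite !normrM !normrX norm_conjC in nr.
  rewrite /phase /= rmorphM fmorphV /= conj_normC.
  rewrite {1}(Autf_relation HA h) {1}nr !exprMn !exprVn !invfM; ring.
split=> //; first exact: un.
have p10 : (phase H).1 != 0 by rewrite mulf_neq0 ?invr_eq0 ?normr_eq0.
have p20 : (phase H).2 != 0 by rewrite mulf_neq0 ?invr_eq0 ?normr_eq0.
move: (phase H).1 (phase H).2 p10 p20 rel d1 => p q p0 q0 e d1.
have qq : q^-1 = q by case: d1 => ->; rewrite ?invrN invr1.
have e' : q = (p ^+ al')^-1 * p ^+ n' * q ^+ mu'.
  by rewrite -{1}qq {1}e !invfM -!exprVn invrK qq.
rewrite !expfzDr // -!invr_expz -!exprnP expr1 [X in X * _]mulrC mulrA -e'.
exact: mulfV.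
Qed.

Lemma phase_positive H G : Autf r H -> Autf r G -> phase H = phase G ->
  exists K, [/\ Autf r K, positive K & H = mcomp G K].
Proof.
move=> HA GA hp; have [G' [G'A GG' G'G]] := Autf_inv GA.
have G0 := formal_invertible_null (proj1 GA).
have G'0 := formal_invertible_null (proj1 G'A).
have H0 := formal_invertible_null (proj1 HA).
pose K := mcomp G' H; have KA : Autf r K by apply: Autf_comp.
have GK : mcomp G K = H by rewrite /K -mcompA // GG' m1comp.
exists K; split=> //; have [kg kd] := Autf_lin_neq0 KA; have [gg gd] := Autf_lin_neq0 GA.
have := phaseM GA KA; rewrite GK hp => -[e1 e2].
have red (a b : C) : a != 0 -> b != 0 -> a / `|a| = a / `|a| * (b / `|b|) -> b = `|b|.
  move=> a0 b0 e; have : a / `|a| != 0 by rewrite mulf_neq0 ?invr_eq0 ?normr_eq0.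
  move=> /mulfI/(_ 1 (b / `|b|)); rewrite mulr1 => /(_ e) e'.
  by rewrite -[LHS](@divfK _ `|b|) ?normr_eq0 // -e' mul1r.
have [[x hx] [y hy]] := (norm_expR kg, norm_expR kd).
by exists x, y; rewrite -hx -hy; split; [apply: red gg kg e1|apply: red gd kd e2].
Qed.

End NormalForm.

(** * Jets *)

Section Congruences.
Variable K : comNzRingType.

Lemma mpow_congr n m d (G G' : 'I_n -> fps K m) a :
  (forall i, order_ge d (G i - G' i)) -> order_ge d (mpow G a - mpow G' a).
Proof.
move=> h; have hM (A A' B B' : fps K m) : order_ge d (A - A') -> order_ge d (B - B') ->
    order_ge d (A * B - A' * B').
  move=> hA hB; have -> : A * B - A' * B' = B * (A - A') + A' * (B - B') by ring.
  by apply: order_geD; apply: order_geMl.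
rewrite /mpow; elim/big_rec2: _ => [|i y x _ IH]; first by rewrite subrr.
apply: (hM) => //; elim: (a i) => [|k IHk]; first by rewrite !expr0 subrr.
by rewrite !exprS; apply: (hM).
Qed.

Lemma fps_comp_congr n m d (F F' : fps K n) (G G' : 'I_n -> fps K m) :
  null G -> null G' -> order_ge d (F - F') -> (forall i, order_ge d (G i - G' i)) ->
  order_ge d (fps_comp F G - fps_comp F' G').
Proof.
move=> G0 G'0 hF hG.
have -> : fps_comp F G - fps_comp F' G' =
    fps_comp (F - F') G + (fps_comp F' G - fps_comp F' G').
  by rewrite fps_compB addrA subrK.
apply: order_geD; first exact: order_ge_comp.
move=> e ed; rewrite fpsB !(@fps_compE _ _ _ d) // -sumrB big1_seq // => a _.
by rewrite -mulrBr -fpsB (mpow_congr a hG) ?mulr0.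
Qed.

End Congruences.

Section JetsOfMaps.
Variables (R : realType) (k : nat).
Local Notation C := R[i].
Implicit Types (H G P V W : formal_map R).

Definition agree H G := forall l, order_ge k.+1 (H l - G l).

Lemma agree_refl H : agree H H. Proof. by move=> l e _; rewrite subrr. Qed.

Lemma agree_trans G H K : agree H G -> agree G K -> agree H K.
Proof. by move=> h h' l; rewrite -(subrK (G l) (H l)) -addrA; apply: order_geD. Qed.

Lemma agree_comp H H' G G' : null G -> null G' -> agree H H' -> agree G G' ->
  agree (mcomp H G) (mcomp H' G').
Proof. by move=> G0 G'0 hH hG l; apply: fps_comp_congr. Qed.

Lemma agree_coef H G l e : agree H G -> (mdeg e <= k)%N -> H l e = G l e.
Proof. by move=> h ek; apply/eqP; rewrite -subr_eq0 -fpsB h. Qed.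

Lemma agree_jet H G : agree H G -> jet k H = jet k G.
Proof.
move=> h; apply/rowP => j; rewrite !mxE; have := enum_valP j.
by case: (enum_val j) => [[l b] c]; rewrite inE => /andP[_ bk]; rewrite (agree_coef _ h).
Qed.

Lemma jet_coef H G l e : jet k H = jet k G -> (0 < mdeg e <= k)%N -> H l e = G l e.
Proof.
move=> h ek; have ei i : (e i < k.+1)%N.
  by rewrite ltnS; case/andP: ek => _; apply: leq_trans (leq_mdeg e i).
pose b : {ffun 'I_2 -> 'I_k.+1} := [ffun i => Ordinal (ei i)].
have be : bounded_midx b = e by apply/ffunP => i; rewrite !ffunE.
have part c : (if c then complex.Im (H l e) else complex.Re (H l e)) =
              (if c then complex.Im (G l e) else complex.Re (G l e)).
  have x_in : (l, b, c) \in @jet_index k by rewrite inE /= be.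
  have := congr1 (fun v : 'rV_ _ => v 0 (enum_rank_in x_in (l, b, c))) h.
  by rewrite !mxE enum_rankK_in // be.
by apply/eqP; rewrite eq_complex (part false) (part true) !eqxx.
Qed.

Lemma jet_agree H G : null H -> null G -> jet k H = jet k G -> agree H G.
Proof.
move=> H0 G0 h l e; rewrite ltnS => ek; apply/eqP; rewrite fpsB subr_eq0; apply/eqP.
have [|e0] := posnP (mdeg e); first by move/eqP; rewrite mdeg_eq0 => /eqP ->; rewrite H0 G0.
by apply: jet_coef h _; rewrite e0.
Qed.

Definition lin3 P V W (s u : R) : formal_map R := fun l =>
  P l + fcst 2 s%:C * V l + fcst 2 u%:C * W l.

Lemma jet_lin3 P V W s u :
  jet k (lin3 P V W s u) = jet k P + s *: jet k V + u *: jet k W.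
Proof.
apply/rowP => j; rewrite !mxE; case: (enum_val j) => [[l b] c].
rewrite /lin3 !fpsD !fcstM; move: (P l _) (V l _) (W l _) => [p q] [p' q'] [p'' q''].
by case: c; simpc.
Qed.

Lemma jet0 : jet k (fun=> 0 : fps C 2) = 0.
Proof.
by apply/rowP => j; rewrite !mxE; case: (enum_val j) => [[l b] c]; case: c.
Qed.

Lemma null_jet_rep (v : 'rV[R]_#|jet_index k|) : null (jet_rep v).
Proof.
move=> l; rewrite /jet_rep big1 // => j _; have := enum_valP j.
case: (enum_val j) => [[i b] c]; rewrite inE /= => /andP[b0 _].
by case: ifP => // /andP[_ /eqP be]; rewrite be mdeg0 in b0.
Qed.

(** The definition of jet_rep sums over the real and imaginary parts of all
    coefficients; the two terms with the index (l, e) give the coefficient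
    back. *)
Lemma jet_rep_agree H : null H -> agree H (jet_rep (jet k H)).
Proof.
move=> H0 l e; rewrite ltnS => ek; rewrite fpsB.
have [|e0] := posnP (mdeg e).
  by move/eqP; rewrite mdeg_eq0 => /eqP ->; rewrite H0 null_jet_rep subrr.
have ei i : (e i < k.+1)%N by rewrite ltnS; apply: leq_trans (leq_mdeg e i) ek.
pose b : {ffun 'I_2 -> 'I_k.+1} := [ffun i => Ordinal (ei i)].
have be : bounded_midx b = e by apply/ffunP => i; rewrite !ffunE.
pose F (x : 'I_2 * {ffun 'I_2 -> 'I_k.+1} * bool) : C :=
  if (x.1.1 == l) && (bounded_midx x.1.2 == e) then
    (if x.2 then 'i else 1) *
      (if x.2 then complex.Im (H x.1.1 (bounded_midx x.1.2))
       else complex.Re (H x.1.1 (bounded_midx x.1.2)))%:C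
  else 0.
have -> : jet_rep (jet k H) l e = \sum_(x in @jet_index k) F x.
  rewrite big_enum_val; apply: eq_bigr => j _; rewrite mxE.
  by rewrite /F; case: (enum_val j) => [[i' b'] c'].
have x_in c : (l, b, c) \in @jet_index k by rewrite inE /= be e0.
have x_in' : ((l, b, true) \in @jet_index k) && ((l, b, true) != (l, b, false)).
  by rewrite x_in; apply/eqP.
rewrite (bigD1 (l, b, false) (x_in false)) (bigD1 (l, b, true) x_in') /= big1 ?addr0.
  by rewrite /F /= be !eqxx /= mul1r; case: (H l e) => p q; simpc.
move=> [[i' b'] c'] /= /andP[/andP[_ nf] nt]; rewrite /F /=.
case: ifP => // /andP[/eqP il /eqP bb].
have bb' : b' = b by apply: bounded_midx_inj; rewrite bb.
by move: nf nt; rewrite il bb'; case: (c'); rewrite eqxx.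
Qed.

Lemma jetM H G : null H -> null G ->
  jet k (mcomp H G) = jet_mul (jet k H) (jet k G).
Proof.
move=> H0 G0; apply/agree_jet/agree_comp => //; first exact: null_jet_rep.
  exact: jet_rep_agree.
exact: jet_rep_agree.
Qed.

End JetsOfMaps.

(** * Curves in spaces of row vectors *)

Section SmoothFamily.
Variable R : realType.

Lemma mulmxr_differentiable n m (M : 'M[R]_(n, m)) (x : 'rV[R]_n) :
  differentiable (mulmxr M : 'rV[R]_n -> 'rV[R]_m) x.
Proof.
have -> : (mulmxr M : 'rV[R]_n -> 'rV[R]_m) = \sum_i (fun y : 'rV[R]_n => y 0 i *: row i M).
  by apply/funext => y; rewrite /= mulmx_sum_row fct_sumE.
apply: differentiable_sum => i.
apply: (@differentiable_comp _ _ _ _ (fun y : 'rV[R]_n => y 0 i) ( *:%R^~ (row i M))).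
  exact: differentiable_coord.
by case: (is_diff_scalel (x 0 i) (row i M)).
Qed.

Lemma mulmxr_continuous n m (M : 'M[R]_(n, m)) :
  continuous (mulmxr M : 'rV[R]_n -> 'rV[R]_m).
Proof. by move=> x; apply/differentiable_continuous/mulmxr_differentiable. Qed.

Definition dotp n (L : 'cV[R]_n) (x : 'rV[R]_n) : R := (x *m L) 0 0.

Lemma dotp_continuous n (L : 'cV[R]_n) : continuous (dotp L).
Proof.
move=> x; apply: (@continuous_comp _ _ _ (mulmxr L) (fun M : 'M[R]_(1, 1) => M 0 0)).
  exact: mulmxr_continuous.
exact: coord_continuous.
Qed.

Lemma dotpD n (L : 'cV[R]_n) x y : dotp L (x + y) = dotp L x + dotp L y.
Proof. by rewrite /dotp mulmxDl mxE. Qed.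

Lemma dotpZ n (L : 'cV[R]_n) c x : dotp L (c *: x) = c * dotp L x.
Proof. by rewrite /dotp -scalemxAl mxE. Qed.

Lemma dotpN n (L : 'cV[R]_n) x : dotp L (- x) = - dotp L x.
Proof. by rewrite -scaleN1r dotpZ mulN1r. Qed.

Lemma dotp_scale n m (L : 'cV[R]_n) (V : 'rV[R]_m) x : x *m (L *m V) = dotp L x *: V.
Proof. by rewrite mulmxA [x *m L]mx11_scalar mul_scalar_mx. Qed.

Lemma dotp_mul n (L : 'cV[R]_n) (M : 'M[R]_n) x : dotp L (x *m M) = dotp (M *m L) x.
Proof. by rewrite /dotp mulmxA. Qed.

Fact dotp_is_linear n (L : 'cV[R]_n) : linear (dotp L : 'rV[R]_n -> R^o).
Proof. by move=> c x y; rewrite dotpD dotpZ. Qed.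

HB.instance Definition _ n (L : 'cV[R]_n) :=
  GRing.isLinear.Build R 'rV[R]_n R^o *:%R (dotp L) (@dotp_is_linear n L).

Lemma dotp_diff n (L : 'cV[R]_n) x : is_diff x (dotp L : 'rV[R]_n -> R) (dotp L).
Proof.
apply: DiffDef; first exact: (linear_differentiable (f := dotp L)) (@dotp_continuous n L).
exact: (diff_lin (f := dotp L) x) (@dotp_continuous n L).
Qed.

Section Powers.
Variables (n : nat) (L : 'cV[R]_n) (a b : R).

Definition halfspace : set 'rV[R]_n := [set x | 0 < a * dotp L x + b].

Lemma open_halfspace : open halfspace.
Proof.
apply: (@open_comp _ _ (fun x : 'rV[R]_n => a * dotp L x + b) [set y | 0 < y]) => [x _|]; last exact: open_gt.
apply: (@continuousD _ _ _ (fun y : 'rV[R]_n => a * dotp L y)); last exact: cst_continuous.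
by apply: continuousM; [exact: cst_continuous|exact: dotp_continuous].
Qed.

Definition power_map m (P : 'rV[R]_m) (M : 'M[R]_(n, m)) (c th : R) (W : 'rV[R]_m) :
    'rV[R]_n -> 'rV[R]_m :=
  fun x => P + x *m M + (c * (a * dotp L x + b) `^ th) *: W.

Lemma power_map_diff m (P : 'rV[R]_m) M c th W x : halfspace x ->
  is_diff x (power_map P M c th W)
    (fun v => v *m M + (c * (th * (a * dotp L x + b) `^ (th - 1)) * a * dotp L v) *: W).
Proof.
move=> hx.
pose aff : 'rV[R]_n -> R := fun y => a * dotp L y + b.
have daff : is_diff x aff (fun v => a * dotp L v).
  apply: (is_diff_eq (is_diffD (is_diffZ a (dotp_diff L x)) (is_diff_cst b x))).
  by apply/funext => v; rewrite /= addr0.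
pose pw : R -> R := fun s => c * s `^ th.
have dpw : is_diff (aff x) pw ( *:%R^~ (c * (th * aff x `^ (th - 1)))).
  have dp := is_deriveZ c (is_derive1_powR th hx).
  apply: DiffDef; first exact/derivable1_diffP/(@ex_derive _ _ _ _ _ _ _ dp).
  rewrite diff1E; last exact/derivable1_diffP/(@ex_derive _ _ _ _ _ _ _ dp).
  by rewrite derive1E (@derive_val _ _ _ _ _ _ _ dp).
have dW := is_diff_comp (is_diff_comp daff dpw) (is_diff_scalel (pw (aff x)) W).
have dM : is_diff x (mulmxr M) (mulmxr M).
  by apply: DiffDef; [exact: mulmxr_differentiable|apply: diff_lin; exact: mulmxr_continuous].
apply: (is_diff_eq (is_diffD (is_diffD (is_diff_cst P x) dM) dW)).
apply/funext => v; rewrite /= add0r; congr (_ + _ *: _).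
by rewrite /GRing.scale /= mulrC -!mulrA.
Qed.

(** Directional derivatives of these maps have the same form, whence smoothness
    by induction. *)
Lemma power_map_derive m (P : 'rV[R]_m) M c th W v x : halfspace x ->
  derivable (power_map P M c th W) x v /\
  'D_v (power_map P M c th W) x =
    power_map (v *m M) 0 (c * th * a * dotp L v) (th - 1) W x.
Proof.
move=> hx; have [d e] := power_map_diff P M c th W hx.
split; first exact: diff_derivable.
rewrite deriveE // e /power_map mulmx0 addr0; congr (_ + _ *: _); ring.
Qed.

Lemma power_map_continuous m (P : 'rV[R]_m) M c th W x : halfspace x ->
  {for x, continuous (power_map P M c th W)}.
Proof. by move=> hx; have [d _] := power_map_diff P M c th W hx; apply: differentiable_continuous. Qed.

Lemma Ck_on_eq k m (U : set 'rV[R]_n) (f g : 'rV[R]_n -> 'rV[R]_m) : open U ->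
  (forall x, U x -> f x = g x) -> Ck_on k U f -> Ck_on k U g.
Proof.
move=> Uo; have near_U (h h' : 'rV[R]_n -> 'rV[R]_m) : (forall x, U x -> h x = h' x) ->
    forall x, U x -> \near x, h x = h' x.
  by move=> hh x Ux; apply: filterS (open_nbhs_nbhs (conj Uo Ux)) => y Uy; rewrite hh.
have cont_eq (h h' : 'rV[R]_n -> 'rV[R]_m) : (forall x, U x -> h x = h' x) ->
    (forall x, U x -> {for x, continuous h}) -> forall x, U x -> {for x, continuous h'}.
  move=> hh hc x Ux; move: (hc x Ux); rewrite /prop_for /continuous_at hh // => hx.
  move=> A /hx hA; change (nbhs x (h' @^-1` A)).
  have hA' : nbhs x (h @^-1` A) := hA.
  have hU : nbhs x [set y | h y = h' y] := near_U _ _ hh _ Ux.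
  by apply: filterS (filterI hA' hU) => y [/=] Ay <-.
elim: k f g => [|k IH] f g fg /= [fc fd]; first by split=> //; apply: cont_eq fg fc.
split=> [|v]; first exact: cont_eq fg fc.
have [fdv fk] := fd v; split=> [x Ux|].
  by apply: near_eq_derivable (fdv x Ux); apply: near_U fg _ Ux.
by apply: (IH (fun x => 'D_v f x)) => // x Ux; apply: near_eq_derive; apply: near_U fg _ Ux.
Qed.

Lemma power_map_smooth (U : set 'rV[R]_n) m (P : 'rV[R]_m) M c th W : open U ->
  U `<=` halfspace -> smooth_on U (power_map P M c th W).
Proof.
move=> Uo UH k; elim: k P M c th W => [|k IH] P M c th W /=.
  by split=> // x /UH hx; apply: power_map_continuous.
split=> [x /UH hx|v]; first exact: power_map_continuous.
split=> [x /UH hx|]; first by have [] := power_map_derive P M c th W v hx.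
apply: (Ck_on_eq Uo _ (IH (v *m M) 0 (c * th * a * dotp L v) (th - 1) W)) => x /UH hx.
by have [_ ->] := power_map_derive P M c th W v hx.
Qed.

End Powers.
End SmoothFamily.

(** Arcs s |-> P + s V + (a s + b)^th W, parametrized by the value s of a
    linear form on them. *)
Section Arcs.
Variables (R : realType) (n : nat) (a b th : R).

Definition arc (q : 'rV[R]_n * 'rV[R]_n * 'rV[R]_n * 'cV[R]_n) (s : R) : 'rV[R]_n :=
  let: (P, V, W, L) := q in P + s *: V + (a * s + b) `^ th *: W.

Definition arc_form (q : 'rV[R]_n * 'rV[R]_n * 'rV[R]_n * 'cV[R]_n) : 'cV[R]_n := q.2.

Definition proper_arc (q : 'rV[R]_n * 'rV[R]_n * 'rV[R]_n * 'cV[R]_n) :=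
  let: (P, V, W, L) := q in [/\ dotp L P = 0, dotp L V = 1 & dotp L W = 0].

Lemma arc_formK q s : proper_arc q -> dotp (arc_form q) (arc q s) = s.
Proof.
case: q => [[[P V] W] L] [p v w].
by rewrite /arc /arc_form !dotpD !dotpZ p v w mulr1 mulr0 add0r addr0.
Qed.

Definition arc_set q : set 'rV[R]_n :=
  [set x | halfspace (arc_form q) a b x /\ x = arc q (dotp (arc_form q) x)].

Lemma arc_setP q x : proper_arc q ->
  arc_set q x <-> exists2 s, 0 < a * s + b & x = arc q s.
Proof.
move=> pq; split=> [[hx xE]|[s s0 ->]]; last by rewrite /arc_set /halfspace /= arc_formK.
by exists (dotp (arc_form q) x).
Qed.

Let split_map (q : 'rV[R]_n * 'rV[R]_n * 'rV[R]_n * 'cV[R]_n) : 'rV[R]_n -> 'rV[R]_n :=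
  fun y => y - arc q (dotp (arc_form q) y).

Lemma split_mapE P V W L y : split_map (P, V, W, L) y =
  power_map L a b (- P) (1%:M - L *m V) (-1) th W y.
Proof.
rewrite /power_map mulmxBr mulmx1 dotp_scale mulN1r scaleNr /split_map /arc /arc_form /=.
by rewrite !opprD !addrA; congr (_ - _ - _); rewrite addrC.
Qed.

Lemma closure_arc_set q x : closure (arc_set q) x -> halfspace (arc_form q) a b x ->
  arc_set q x.
Proof.
case: q => [[[P V] W] L] cx hx; split=> //; apply: contrapT => nx.
have hc : {for x, continuous (split_map (P, V, W, L))}.
  by rewrite (funext (split_mapE P V W L)); apply: power_map_continuous.
have ne : split_map (P, V, W, L) x != 0 by rewrite subr_eq0; apply/eqP.
have : nbhs x (split_map (P, V, W, L) @^-1` [set y | y != 0]).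
  apply: hc; apply: open_nbhs_nbhs; split=> //.
  rewrite (_ : [set y | y != 0] = ~` [set 0]); last first.
    by apply/seteqP; split=> y /=; [move/eqP|move/eqP].
  exact/closed_openC/accessible_closed_set1/hausdorff_accessible/norm_hausdorff.
by move=> /cx[y [[_ yE]]] /= /negP; apply; rewrite subr_eq0; apply/eqP.
Qed.

(** The map y |-> y - c(l(y)) + l(y) v, for the arc c, the linear form l and
    any v with l(v) = 1, carries the arc to the line spanned by v. Choosing for
    v a multiple of a basis vector, a transposition of coordinates moves this
    line to the first axis. *)
Lemma arc_chart q S x : proper_arc q -> arc_set q x ->
  (\forall y \near x, S y <-> arc_set q y) ->
  exists (U V : set 'rV[R]_n) (f g : 'rV[R]_n -> 'rV[R]_n),
    [/\ [/\ open U, open V & U x],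
        smooth_on U f /\ smooth_on V g,
        (forall y, U y -> V (f y)) /\ (forall y, V y -> U (g y)),
        (forall y, U y -> g (f y) = y) /\ (forall y, V y -> f (g y) = y)
      & forall y, U y ->
          (S y <-> forall i : 'I_n, (1 <= i)%N -> f y 0 i = 0)].
Proof.
case: q => [[[P V] W] L]; set q := (P, V, W, L) => pq [hx xE] nS.
have [_ lV _] := pq.
have [j0 Lj0] : exists j, L j 0 != 0.
  apply/existsP; apply: contraT; rewrite negb_exists => /forallP L0.
  have := lV; rewrite /dotp mxE big1 => [/esym/eqP|j _]; first by rewrite oner_eq0.
  by move/negPn/eqP: (L0 j) => ->; rewrite mulr0.
have n0 : (0 < n)%N := leq_ltn_trans (leq0n j0) (ltn_ord j0).
pose i0 : 'I_n := Ordinal n0; pose M : 'M[R]_n := tperm_mx j0 i0.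
have MM : M *m M = 1%:M by rewrite -perm_mxM tperm2 perm_mx1.
pose v0 : 'rV[R]_n := (L j0 0)^-1 *: delta_mx 0 j0.
have lv0 : dotp L v0 = 1.
  rewrite /v0 dotpZ /dotp -rowE mxE mulVf //.
pose f0 y := split_map q y + dotp L y *: v0.
pose g0 y := y + arc q (dotp L y) - dotp L y *: v0.
have lf0 y : halfspace L a b y -> dotp L (f0 y) = dotp L y.
  by move=> hy; rewrite /f0 /split_map dotpD dotpD dotpN (arc_formK _ pq) (dotpZ L _ v0) lv0 mulr1 subrr add0r.
have lg0 y : halfspace L a b y -> dotp L (g0 y) = dotp L y.
  by move=> hy; rewrite /g0 dotpD dotpD (arc_formK _ pq) dotpN (dotpZ L _ v0) lv0 mulr1 addrK.
have gf0 y : halfspace L a b y -> g0 (f0 y) = y.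
  by move=> hy; rewrite /g0 lf0 // /f0 /split_map addrAC addrK subrK.
have fg0 y : halfspace L a b y -> f0 (g0 y) = y.
  move=> hy; rewrite /f0 /split_map -[dotp (arc_form q) (g0 y)]/(dotp L (g0 y)) lg0 // /g0.
  by rewrite addrAC subrK addrK.
pose f y := f0 y *m M; pose g y := g0 (y *m M).
have lM y : dotp (M *m L) y = dotp L (y *m M) by rewrite dotp_mul.
have fE : f = power_map L a b (- P *m M) ((1%:M - L *m V + L *m v0) *m M) (-1) th (W *m M).
  apply/funext => y; rewrite /f /f0 split_mapE /power_map -dotp_scale addrAC -[- P + _ + _]addrA.
  rewrite -(mulmxDr y) (mulmxDl _ _ M) (mulmxDl _ _ M) -(mulmxA y).
  by congr (_ + _); rewrite scalemxAl.
have gE : g = power_map (M *m L) a b P (M *m (1%:M + L *m V - L *m v0)) 1 th W.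
  apply/funext => y; rewrite /g /g0 /power_map lM mulmxA mul1r mulmxBr mulmxDr mulmx1 !dotp_scale.
  rewrite /arc /q !addrA [y *m M + P]addrC; exact: addrAC.
have hM y : halfspace (M *m L) a b y = halfspace L a b (y *m M).
  by rewrite /halfspace /= lM.
pose U := halfspace L a b `&` [set y | S y <-> arc_set q y]^°.
have Uo : open U by apply: openI; [exact: open_halfspace|exact: open_interior].
pose V' := halfspace (M *m L) a b `&` (g @^-1` U).
have V'o : open V'.
  rewrite openE => y [hy Uy]; apply: filterI; first exact: open_nbhs_nbhs (conj (@open_halfspace _ _ _ _ _) hy).
  have gc : {for y, continuous g} by rewrite gE; apply: power_map_continuous.
  by apply: gc; apply: open_nbhs_nbhs.
have gf y : U y -> g (f y) = y.
  by move=> [hy _]; rewrite /g /f -mulmxA MM mulmx1 gf0.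
exists U, V', f, g; split.
- by split=> //; split=> //; exact: nS.
- split; first by rewrite fE; apply: power_map_smooth => // y [].
  by rewrite gE; apply: power_map_smooth => // y [].
- split=> [y Uy|y []//]; split; last by rewrite /= gf.
  by case: Uy => hy _; rewrite hM /f -mulmxA MM mulmx1 /halfspace /= lf0.
- split=> // y [hy _]; rewrite /f /g fg0 -?mulmxA ?MM ?mulmx1 //.
  by rewrite -hM.
move=> y [hy /interior_subset /= Sy]; rewrite Sy.
have fy i : f y 0 i = f0 y 0 (tperm j0 i0 i) by rewrite /f -xcolE mxE.
split=> [[_ yE] i i1|fz].
  rewrite fy /f0 /split_map {1}yE subrr add0r !mxE.
  case: tpermP => [ij|ii|ij _]; last 1 first.
  - by rewrite (_ : i == j0 = false) ?andbF ?mulr0 //; apply/eqP.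
  - by rewrite (_ : i0 == j0 = false) ?andbF ?mulr0 //; apply/eqP => e; rewrite ij -e in i1.
  by rewrite ii in i1.
split=> //; apply/eqP; rewrite -subr_eq0; apply/eqP; apply: (addIr (dotp L y *: v0)).
rewrite add0r -/(split_map q y) -/(f0 y) -[in RHS](lf0 y) //.
have f0z j : j != j0 -> f0 y 0 j = 0.
  move=> jj; have := fz (tperm j0 i0 j); rewrite fy tpermK; apply.
  by rewrite lt0n; apply: contra jj => /eqP e; rewrite -(inj_eq (@perm_inj _ (tperm j0 i0))) tpermL; apply/eqP/val_inj.
move: (f0 y) f0z => z z0.
have -> : z = z 0 j0 *: delta_mx 0 j0.
  apply/rowP => j; rewrite !mxE eqxx /=; have [->|jj] := eqVneq j j0; first by rewrite mulr1.
  by rewrite mulr0 z0.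
by rewrite dotpZ /dotp -rowE mxE /v0 scalerA mulfK.
Qed.

(** Where the other arcs stay away, a union of arcs is locally a single one. *)
Lemma arcs_submanifold (s : seq ('rV[R]_n * 'rV[R]_n * 'rV[R]_n * 'cV[R]_n)) (S : set 'rV[R]_n) :
  (0 < n)%N -> (forall q, q \in s -> proper_arc q) ->
  (forall x, S x <-> exists2 q, q \in s & arc_set q x) ->
  (forall q x, q \in s -> S x -> closure (arc_set q) x -> arc_set q x) ->
  (forall q q' x, q \in s -> q' \in s -> arc_set q x -> arc_set q' x ->
    arc_set q = arc_set q') ->
  embedded_submanifold 1 S.
Proof.
move=> n0 sp SE cl eq; split=> // x Sx.
have [q qs qx] := (SE x).1 Sx; apply: (arc_chart (sp q qs) qx).
have near_q : \forall y \near x, forall q', q' \in s -> arc_set q' y -> arc_set q y.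
  have: {subset s <= s} by []. 
  elim: {-2}s => [|q' s' IH] ss; first by near=> y; move=> q'; rewrite in_nil.
  have q's : q' \in s by apply: ss; rewrite inE eqxx.
  have h' : \forall y \near x, forall q', q' \in s' -> arc_set q' y -> arc_set q y.
    by apply: IH => p ps; apply: ss; rewrite inE ps orbT.
  have h : \forall y \near x, arc_set q' y -> arc_set q y.
    have [q'x|nq'x] := pselect (arc_set q' x).
      by near=> y; rewrite (eq q q' x).
    have : ~ closure (arc_set q') x by move/(cl _ _ q's Sx).
    apply: contra_notP => nn B xB; apply: contrapT => nAB; apply: nn.
    by apply: filterS xB => y By q'y; case: nAB; exists y.
  near=> y => p; rewrite inE => /orP[/eqP ->|ps].
    by near: y.
  by move: p ps; near: y.
near=> y; split=> [/SE[q' q's q'y]|qy]; last by apply/SE; exists q.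
by have := q'y; move: q' q's {q'y}; near: y.
Unshelve. all: by end_near.
Qed.

End Arcs.

Section LinesRaysPoints.
Variables (R : realType) (n : nat).

Lemma hausdorff_rV_closed (S : set 'rV[R]_n) : finite_set S -> closed S.
Proof.
apply: (accessible_finite_set_closed.1 _ S).
exact/hausdorff_accessible/norm_hausdorff.
Qed.

Lemma finite_submanifold (S : set 'rV[R]_n) : finite_set S -> embedded_submanifold 0 S.
Proof.
move=> fS; split=> // x Sx; pose U := ~` (S `\ x).
have Uo : open U.
  apply: closed_openC; apply: hausdorff_rV_closed.
  by apply: sub_finite_set fS => y [].
have tr (c y : 'rV[R]_n) : power_map (0 : 'cV[R]_n) 0 1 c 1%:M 0 0 0 y = y + c.
  by rewrite /power_map mulmx1 scaler0 addr0 addrC.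
have sm (A : set 'rV[R]_n) c : open A -> smooth_on A (fun y => y + c).
  move=> Ao; rewrite -(funext (tr c)); apply: power_map_smooth => // y _.
  by rewrite /halfspace /= mul0r add0r.
pose V := (fun y => y + x) @^-1` U.
have Vo : open V.
  apply: open_comp => // y _; apply: (@continuousD _ _ _ id (fun=> x)); first exact: cvg_id.
  exact: cst_continuous.
exists U, V, (fun y => y - x), (fun y => y + x); split.
- by split=> // -[_]; apply.
- by split; apply: sm.
- by split=> y; rewrite /V /= ?subrK.
- by split=> y _; rewrite ?subrK ?addrK.
move=> y Uy; split=> [Sy i _|y0].
  have -> : y = x by apply: contrapT => yx; apply: Uy; split.
  by rewrite subrr mxE.
suff -> : y = x by [].
by apply/eqP; rewrite -subr_eq0; apply/eqP/rowP => i; rewrite y0 // mxE.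
Qed.

Implicit Types V W P : 'rV[R]_n.

Lemma dual_form V : V != 0 -> exists L, dotp L V = 1.
Proof.
move=> V0; have [j Vj] : exists j, V 0 j != 0.
  apply/existsP; apply: contraT; rewrite negb_exists => /forallP h; case/eqP: V0.
  by apply/rowP => j; move/negPn/eqP: (h j) => ->; rewrite mxE.
exists ((V 0 j)^-1 *: delta_mx j 0); rewrite /dotp -scalemxAr mxE -colE mxE mulVf //.
Qed.

Lemma dual_pair V W : (forall c d, c *: V + d *: W = 0 -> c = 0 /\ d = 0) ->
  exists L L', [/\ dotp L V = 1, dotp L W = 0, dotp L' V = 0 & dotp L' W = 1].
Proof.
move=> ind; have /row_freeP[B hB] : row_free (col_mx V W).
  apply/inj_row_free => v; rewrite -[v]hsubmxK mul_row_col.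
  rewrite [lsubmx v]mx11_scalar [rsubmx v]mx11_scalar !mul_scalar_mx => /ind[-> ->].
  by rewrite !raddf0 row_mx0.
have e j X i : X = row i (col_mx V W) -> dotp (col j B) X = (i == j)%:R.
  move=> ->; have := congr1 (fun M : 'M[R]_(1 + 1) => M i j) hB; rewrite /dotp !mxE => <-.
  by apply: eq_bigr => k _; rewrite !mxE.
have eV : V = row (lshift 1 0) (col_mx V W) by apply/rowP => j; rewrite mxE col_mxEu.
have eW : W = row (rshift 1 0) (col_mx V W) by apply/rowP => j; rewrite mxE col_mxEd.
exists (col (lshift 1 0) B), (col (rshift 1 0) B).
by rewrite !(e _ _ _ eV) !(e _ _ _ eW).
Qed.

Lemma closure_line th P V W L x : closure (arc_set 0 1 th (P, V, W, L)) x ->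
  arc_set 0 1 th (P, V, W, L) x.
Proof.
by move=> cx; apply: closure_arc_set => //; rewrite /halfspace /= mul0r add0r.
Qed.

(** On the ray, x = l(x) V + l'(x) W and l(x) >= 0, for the dual forms l and
    l'. These conditions are closed, and with l(x) = 0 only a multiple of W is
    left. *)
Lemma closure_ray th V W L L' x :
  dotp L V = 1 -> dotp L W = 0 -> dotp L' V = 0 -> dotp L' W = 1 ->
  closure (arc_set 1 0 th (0, V, W, L)) x ->
  arc_set 1 0 th (0, V, W, L) x \/ x = dotp L' x *: W.
Proof.
move=> lv lw l'v l'w cx.
pose A : 'M[R]_n := 1%:M - L *m V - L' *m W.
pose C := (dotp L : 'rV[R]_n -> R) @^-1` [set s | 0 <= s] `&` (mulmxr A : 'rV[R]_n -> 'rV[R]_n) @^-1` [set 0].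
have Cc : closed C.
  apply: closedI; apply: closed_comp => [y _|]; [exact: dotp_continuous|exact: closed_ge|exact: mulmxr_continuous|].
  by apply: hausdorff_rV_closed; apply: finite_set1.
have AE y : y *m A = y - dotp L y *: V - dotp L' y *: W.
  by rewrite /A !mulmxBr mulmx1 !dotp_scale.
have sub : arc_set 1 0 th (0, V, W, L) `<=` C.
  move=> y [hy yE]; move: hy; rewrite /halfspace /arc_form /= mul1r addr0 => hy.
  split; first exact: ltW.
  rewrite /= AE; move: yE; rewrite /arc /arc_form /= mul1r addr0 add0r.
  set s := dotp L y; set p := _ `^ _ => yE.
  have -> : dotp L' y = p by rewrite yE dotpD !dotpZ l'v l'w mulr0 mulr1 add0r.
  by rewrite {1}yE [_ + p *: W]addrC addrK subrr.
have [x0 xA] : C x by rewrite (closure_id C).1 //; apply: closure_subset sub _ cx.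
have [x1|] := eqVneq (dotp L x) 0.
  right; move: xA; rewrite /= AE x1 scale0r subr0 => /eqP.
  by rewrite subr_eq0 => /eqP.
move=> x1; left; apply: closure_arc_set => //.
by rewrite /halfspace /= mul1r addr0 lt_neqAle eq_sym x1.
Qed.

End LinesRaysPoints.

(** * The sheets of the group of jets *)

Section LinearParts.
Variable R : realType.
Local Notation C := R[i].
Implicit Types (B G L X V W : formal_map R) (A : 'M[C]_2).

Definition lmul A X : formal_map R := fun l => \sum_j fcst 2 (A l j) * X j.

Lemma lmulM A A' X : lmul (A *m A') X = lmul A (lmul A' X).
Proof.
apply/funext => l; apply/funext => e; rewrite /lmul !fps_sum.
under [RHS]eq_bigr => j _ do rewrite fcstM fps_sum mulr_sumr.
rewrite [RHS]exchange_big /=; apply: eq_bigr => j _; rewrite fcstM mxE mulr_suml.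
by apply: eq_bigr => i _; rewrite fcstM mulrA.
Qed.

Lemma lmul1 X : lmul 1%:M X = X.
Proof.
apply/funext => l; apply/funext => e; rewrite /lmul fps_sum (bigD1 l) //= big1.
  by rewrite fcstM mxE eqxx mul1r addr0.
by move=> j jl; rewrite fcstM mxE eq_sym (negbTE jl) mul0r.
Qed.

Lemma order_ge_lmul d A X : (forall l, order_ge d (X l)) -> forall l, order_ge d (lmul A X l).
Proof. by move=> h l; apply: order_ge_sum => j _; apply: order_geMl. Qed.

Lemma lmul_congr d A X G : (forall l, order_ge d (X l - G l)) ->
  forall l, order_ge d (lmul A X l - lmul A G l).
Proof.
move=> h l; rewrite /lmul -sumrB; apply: order_ge_sum => j _.
by rewrite -mulrBr; apply: order_geMl.
Qed.

Lemma null_lmul A X : null X -> null (lmul A X).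
Proof. by move=> X0 l; rewrite /lmul fps_sum big1 // => j _; rewrite fcstM X0 mulr0. Qed.

Lemma lmul_comp A X L : null L -> mcomp (lmul A X) L = lmul A (mcomp X L).
Proof.
move=> L0; apply/funext => l; rewrite /Defs.map_comp /lmul fps_comp_sum.
by apply: eq_bigr => j _; rewrite fps_compM // fps_comp_cst.
Qed.

(** The matrix A and the map L can be undone without loss of order, so that
    jets of lmul A (X o L) determine those of X. *)
Lemma lmul_cancel d A X L T : A \in unitmx -> null L -> null T ->
  mcomp L T = @formal_id R ->
  (forall l, order_ge d (lmul A (mcomp X L) l)) -> forall l, order_ge d (X l).
Proof.
move=> AU L0 T0 LT h l; have h' := order_ge_lmul (invmx A) h.
have {}h' j : order_ge d (mcomp X L j) by move: (h' j); rewrite -lmulM mulVmx // lmul1.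
have -> : X l = mcomp (mcomp X L) T l by rewrite mcompA // LT mcomp1.
exact: order_ge_comp.
Qed.

Lemma lmul_lin3 A V W s u : lmul A (lin3 (fun=> 0 : fps C 2) V W s u) =
  lin3 (fun=> 0 : fps C 2) (lmul A V) (lmul A W) s u.
Proof.
apply/funext => l; rewrite /lmul /lin3 add0r !mulr_sumr -big_split.
by apply: eq_bigr => j _ /=; rewrite add0r mulrDr; congr (_ + _); ring.
Qed.

Lemma lin3_comp P V W s u L : null L ->
  mcomp (lin3 P V W s u) L = lin3 (mcomp P L) (mcomp V L) (mcomp W L) s u.
Proof.
move=> L0; apply/funext => l; rewrite /Defs.map_comp /lin3 !fps_compD !fps_compM //.
by rewrite !fps_comp_cst.
Qed.

Lemma lin3_null P V W s u : null P -> null V -> null W -> null (lin3 P V W s u).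
Proof. by move=> P0 V0 W0 l; rewrite /lin3 !fpsD !fcstM P0 V0 W0 !mulr0 !addr0. Qed.

Lemma lin_part_order2 B : null B ->
  forall l, order_ge 2 (B l - lmul (jac B) (@formal_id R) l).
Proof.
move=> B0 l e e2; rewrite fpsB /lmul fps_sum.
have [e0|e0] := posnP (mdeg e).
  move/eqP: e0; rewrite mdeg_eq0 => /eqP ->; rewrite B0 big1 ?subrr // => j _.
  by rewrite fcstM [X in _ * X](null_var _ j) mulr0.
have [i ->] : exists i, e = midx1 i by apply: mdeg1E; lia.
rewrite (bigD1 i) //= big1 ?addr0 => [|j ji].
  by rewrite fcstM mxE /formal_id /fps_var eqxx mulr1 subrr.
rewrite fcstM /formal_id /fps_var (_ : _ == _ = false) ?mulr0 //.
by apply: contraNF ji => /eqP/midx1_inj ->.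
Qed.

Lemma fps_comp_lin_map A G l : null G -> fps_comp (lmul A (@formal_id R) l) G = lmul A G l.
Proof.
move=> G0; rewrite /lmul fps_comp_sum; apply: eq_bigr => j _.
by rewrite fps_compM // fps_comp_cst // /formal_id fps_comp_var.
Qed.

(** The linear part of B acts linearly on perturbations of the identity; the
    rest of B has order 2 and feels a perturbation of order k only in order k +
    1. *)
Lemma comp_near_id_l k B V t : null B -> (2 <= k)%N -> (forall l, order_ge k (V l)) ->
  agree k (mcomp B (lin3 (@formal_id R) V (fun=> 0 : fps C 2) t 0))
          (lin3 B (lmul (jac B) V) (fun=> 0 : fps C 2) t 0).
Proof.
move=> B0 k2 Vk; set G := lin3 _ _ _ _ _ => l.
have V0 : null V by move=> j; apply: (Vk j); rewrite mdeg0; lia.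
have G0 : null G by apply: lin3_null => //; exact: null_var.
have Gk j : order_ge k.-1.+1 (G j - fps_var C j).
  rewrite prednK; last lia.
  by rewrite /G /lin3 mulr0 addr0 [_ + fcst _ _ * _]addrC addrK; apply: order_geMl.
have := comp_near_id G0 Gk (lin_part_order2 B0 l).
rewrite (_ : (2 + k.-1)%N = k.+1); last lia.
rewrite fps_compB fps_comp_lin_map //.
suff -> : lmul (jac B) G l = lmul (jac B) (@formal_id R) l + fcst 2 t%:C * lmul (jac B) V l.
  by rewrite /lin3 mulr0 addr0 /Defs.map_comp; congr order_ge; ring.
rewrite /lmul mulr_sumr -big_split; apply: eq_bigr => j _ /=.
by rewrite /G /lin3 mulr0 addr0; ring.
Qed.

Lemma comp_lin_l B G : null B -> null G -> agree 1 (mcomp B G) (lmul (jac B) G).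
Proof.
move=> B0 G0 l; rewrite -(fps_comp_lin_map (jac B) l G0) /Defs.map_comp -fps_compB.
by apply: order_ge_comp => //; apply: lin_part_order2.
Qed.

Lemma jac_lmul A X : jac (lmul A X) = A *m jac X.
Proof.
apply/matrixP => l j; rewrite !mxE /lmul fps_sum; apply: eq_bigr => i _.
by rewrite fcstM mxE.
Qed.

Lemma agree1 X G : null X -> null G ->
  (forall l, X l (mi2 1 0) = G l (mi2 1 0)) ->
  (forall l, X l (mi2 0 1) = G l (mi2 0 1)) -> agree 1 X G.
Proof.
move=> X0 G0 hz hw l e e2; rewrite fpsB; have [e0|e0] := posnP (mdeg e).
  by move/eqP: e0; rewrite mdeg_eq0 => /eqP ->; rewrite X0 G0 subrr.
have [i ->] : exists i, e = midx1 i by apply: mdeg1E; lia.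
by move: i; apply: ord2P; rewrite ?midx1_20 ?midx1_21 ?hz ?hw subrr.
Qed.

Lemma conj_fixed_real (z : C) : z = z^*%R -> exists x : R, z = x%:C.
Proof.
by move=> h; exists (complex.Re z); rewrite RRe_real //; apply/CrealP.
Qed.

End LinearParts.

Section Sheets.
Variables (R : realType) (rho : fps R[i] (2 + 2)) (T : formal_map R).
Variable phi : fps R[i] 3.
Local Notation C := R[i].
Implicit Types (H G K L B V W : formal_map R).
Hypothesis rhoH : formal_hypersurface rho.
Hypothesis Tphi : normal_coordinates rho T phi.
Let r := normal_defining_series phi.
Let phiN : normal_series phi. Proof. by case: Tphi. Qed.

Variables (al n mu : nat) (t' : nat * nat * nat).
Hypotheses (Lt : Lambda phi (al, n, mu)) (Lt' : Lambda phi t').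
Hypotheses (tt' : t' <> (al, n, mu)) (aln : al <> n).

(** k is the common slope, or any positive integer if there is none. *)
Variable k : nat.
Hypotheses (k0 : (0 < k)%N).
Hypothesis slopes : forall k', (0 < k')%N -> common_slope phi al n mu k' -> k' = k.

(** The quotient of H and G agrees with the identity up to order k, so it is
    unipotent and has no term w^k in its second component; the other slopes are
    excluded by hypothesis. *)
Theorem Autf_jet_inj H G : Autf r H -> Autf r G -> agree k H G -> H = G.
Proof.
move=> HA GA HG; have [G' [G'A GG' G'G]] := Autf_inv rhoH Tphi GA.
have [H0 [G0 G'0]] : null H /\ null G /\ null G'.
  by do !split; apply: formal_invertible_null; [case: HA|case: GA|case: G'A].
have KA : Autf r (mcomp G' H) by apply: Autf_comp.
have Kid : agree k (mcomp G' H) (@formal_id R).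
  by rewrite -G'G; apply: agree_comp => // l; apply: agree_refl.
have K1 : mcomp G' H = @formal_id R.
  apply: (unipotent_rigid Tphi Lt Lt' tt' aln KA).
    split; first by rewrite -gam_id; apply: agree_coef Kid _; rewrite mdeg_mi2 addn0.
    by rewrite -del_id; apply: agree_coef Kid _; rewrite mdeg_mi2.
  move=> k' k'2 sl; have kk := slopes (ltnW k'2) sl; rewrite kk in k'2 *.
  rewrite (agree_coef 1 Kid) ?mdeg_mi2 // /formal_id /fps_var midx1_21.
  by case: eqP => // /mi2_inj[_]; lia.
by rewrite -[LHS]m1comp // -GG' mcompA // K1 mcomp1.
Qed.

Section OneParameter.
Hypothesis slk : common_slope phi al n mu k.
Variable H0 : formal_map R.
Hypotheses (H0A : Autf r H0) (H0p : positive H0) (H01 : H0 <> @formal_id R).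

(** The one-parameter group through H0 sweeps out all values of the real
    coefficient of w^k, and this coefficient determines a unipotent
    automorphism. *)
Lemma positive_line : (2 <= k)%N -> exists V, 
  [/\ forall l, order_ge k (V l), V 1 (mi2 0 k) != 0,
      forall H, Autf r H -> positive H ->
        exists t, agree k H (lin3 (@formal_id R) V (fun=> 0 : fps C 2) t 0)
    & forall t, exists H, [/\ Autf r H, positive H &
        agree k H (lin3 (@formal_id R) V (fun=> 0 : fps C 2) t 0)]].
Proof.
move=> k2; have n1 : ~ common_slope phi al n mu 1 by move/slopes => /(_ isT); lia.
have uni H HA Hp := @positive_unipotent _ _ _ _ Tphi _ _ _ _ Lt Lt' tt' aln H HA Hp n1.
have [Hf Hg] := uni _ H0A H0p.
have gz H HA := @Autf_gz _ _ _ _ Tphi _ _ _ _ Lt Lt' tt' H HA.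
have [//|[k' [k'2 sl [v0 vr] Vk fam]]] :=
  tangent_to_identity phiN H0A Hf Hg (gz _ H0A) Lt Lt' tt' aln.
have kk : k' = k by apply: slopes => //; lia.
rewrite {}kk {k' k'2} in sl v0 vr Vk fam.
set V : formal_map R := fun l => H0 l - fps_var C l.
exists V.
have famP t : exists H, [/\ Autf r H, positive H &
    agree k H (lin3 (@formal_id R) V (fun=> 0 : fps C 2) t 0)].
  have [H [HA hH]] := fam t; exists H; split=> //.
    have V0 l e : (mdeg e < 2)%N -> V l e = 0.
      by move=> e2; apply: (Vk l); apply: leq_trans e2 k2.
    exists 0, 0; rewrite expR0 /gam /del !hH ?mdeg_mi2 ?addn0 //.
    rewrite -/(V 0) -/(V 1) (V0 0) ?mdeg_mi2 // (V0 1) ?mdeg_mi2 // !mulr0 !addr0.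
    by rewrite /formal_id /fps_var midx1_20 midx1_21 !eqxx.
  move=> l e ek; rewrite /lin3 mulr0 addr0 !(fpsB, fpsD) fcstM hH //.
  by rewrite subrr.
split=> // H HA Hp; have HU := uni _ HA Hp.
have [c hc] : exists c : R, H 1 (mi2 0 k) = c%:C.
  have [h1 h2] := HU.
  have [->|[k' [k'2 sl' [_ cr] _ _]]] :=
    tangent_to_identity phiN HA h1 h2 (gz _ HA) Lt Lt' tt' aln.
    by apply: conj_fixed_real; rewrite /formal_id /fps_var; case: eqP; rewrite ?rmorph1 ?rmorph0.
  have kk : k' = k by apply: slopes => //; lia.
  have [c hc] := conj_fixed_real cr; exists c.
  rewrite -hc kk fpsB /fps_var midx1_21 (_ : (mi2 0 k == mi2 0 1) = false) ?subr0 //.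
  by apply/eqP => /mi2_inj[_]; lia.
have [v hv] := conj_fixed_real vr.
have [G [GA Gp hG]] := famP (c / v); exists (c / v).
suff -> : H = G by [].
have GU := uni _ GA Gp.
apply: (unipotent_inj rhoH Tphi Lt Lt' tt' aln HA GA HU GU) => k' k'2 sl'.
have -> : k' = k by apply: slopes => //; lia.
rewrite (agree_coef 1 hG) ?mdeg_mi2 // /lin3 mulr0 addr0 fpsD fcstM hc -/(V 1) [V 1 _]hv.
rewrite /formal_id /fps_var midx1_21 (_ : (mi2 0 k == mi2 0 1) = false) ?add0r.
  rewrite -rmorphM divfK //; apply: contraNneq v0 => v0; by rewrite hv v0.
by apply/eqP => /mi2_inj[_]; lia.
Qed.

(** In degree one the group through H0 is diagonal with entries s^th and s up
    to a shear, where s is the value of delta. The weights x and y of any two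
    positive automorphisms are proportional, so all of them lie on this group. *)
Lemma positive_ray : k = 1%N -> exists th V W,
  [/\ null V /\ null W, V 1 (mi2 0 1) = 1 /\ V 0 (mi2 1 0) = 0,
      W 0 (mi2 1 0) = 1 /\ (W 1 = 0),
      forall H, Autf r H -> positive H -> exists2 s, 0 < s &
        agree 1 H (lin3 (fun=> 0 : fps C 2) V W s (s `^ th))
    & forall s, 0 < s -> exists H, [/\ Autf r H, positive H &
        agree 1 H (lin3 (fun=> 0 : fps C 2) V W s (s `^ th))]].
Proof.
move=> k1; have gz := @Autf_gz _ _ _ _ Tphi _ _ _ _ Lt Lt' tt'.
have wt H x y : Autf r H -> gam H = (expR x)%:C -> del H = (expR y)%:C ->
    (al + n)%:R * x = (1 - mu%:R) * y.
  move=> HA hx hy; have [x' [y' [hx' hy' w _]]] := Autf_weights Tphi Lt Lt' tt' aln HA.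
  have ge0 (z : R) : (0 : C) <= (expR z)%:C by rewrite ler0c expR_ge0.
  move: hx' hy'; rewrite hx hy !ger0_norm // => /complexI/expR_inj -> /complexI/expR_inj ->.
  exact: w.
have [al0 n0] := Lambda_gt0 phiN Lt.
have an0 : (al + n)%:R != 0 :> R by rewrite pnatr_eq0; lia.
have uni H : Autf r H -> unipotent H -> H = @formal_id R.
  move=> HA /(unipotent_order2 Tphi Lt Lt' tt' aln HA)[[k' k'2 /slopes]|//].
  by rewrite k1 => /(_ (ltnW k'2)) e; rewrite e in k'2.
have [x [y [hx hy]]] := H0p; have e0 := wt _ _ _ H0A hx hy.
have y0 : y != 0.
  apply/eqP => yE; apply: H01; apply: (uni _ H0A).
  have xE : x = 0 by apply: (mulfI an0); rewrite e0 yE !mulr0.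
  by split; rewrite ?hx ?hy ?xE ?yE expR0.
have xy : x != y.
  apply/eqP => xy; move/eqP: e0; rewrite xy (inj_eq (mulIf y0)) eq_sym subr_eq -natrD.
  by rewrite eq_sym pnatr_eq1; lia.
have exy : (expR x)%:C - (expR y)%:C != 0 :> C.
  by rewrite subr_eq0; apply: contra xy => /eqP/complexI/expR_inj/eqP.
have [E [hE Eexp]] := divdiff_extension x y.
pose fl := flow H0 x y E.
have flA t : Autf r (fl t) := flow_aut phiN H0A hx hy (gz _ H0A) hE Eexp t.
have fll t := flow_lin H0A hx hy (gz _ H0A) hE Eexp t.
pose K := H0 0 (mi2 0 1) / ((expR x)%:C - (expR y)%:C).
pose V : formal_map R := t2 (fcst 2 (- K) * fps_var C 1) (fps_var C 1).
pose W : formal_map R := t2 (fps_var C 0 + fcst 2 K * fps_var C 1) 0.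
have V0 : null V by apply: ord2P; rewrite /V ?t2E0 ?t2E1 ?fcstM null_var ?mulr0.
have W0 : null W by apply: ord2P; rewrite /W ?t2E0 ?t2E1 ?fpsD ?fcstM ?null_var ?mulr0 ?addr0.
have ne01 : (mi2 1 0 == mi2 0 1) = false by apply/eqP => /mi2_inj[].
have ne10 : (mi2 0 1 == mi2 1 0) = false by apply/eqP => /mi2_inj[].
exists (x / y), V, W.
have flE t : agree 1 (fl t) (lin3 (fun=> 0 : fps C 2) V W (expR (y * t)) (expR (y * t) `^ (x / y))).
  have pw : expR (y * t) `^ (x / y) = expR (x * t).
    rewrite /powR gt_eqF ?expR_gt0 // expRK; congr expR; field.
    by [].
  rewrite pw; have [f1 g1 g0 f0] := fll t; rewrite -/(fl t) in f1 g1 g0 f0.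
  apply: agree1.
  - exact: formal_invertible_null (proj1 (flA t)).
  - by apply: lin3_null.
  - apply: ord2P; rewrite /lin3 !fpsD !fcstM /V /W ?t2E0 ?t2E1 ?fpsD ?fcstM ?fps0.
      by rewrite f1 /fps_var midx1_20 midx1_21 eqxx ne01 !mulr0 !add0r addr0 mulr1.
    by rewrite g0 /fps_var midx1_21 ne01 !mulr0 !addr0.
  apply: ord2P; rewrite /lin3 !fpsD !fcstM /V /W ?t2E0 ?t2E1 ?fpsD ?fcstM ?fps0.
    rewrite /fps_var midx1_20 midx1_21 eqxx ne10 !mulr1 !add0r.
    apply: (mulfI exy); rewrite f0 /K; field.
    by [].
  by rewrite g1 /fps_var midx1_21 eqxx !mulr0 mulr1 add0r addr0.
have flp t : positive (fl t).
  by have [f1 g1 _ _] := fll t; exists (x * t), (y * t).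
split=> //.
- by rewrite /V t2E0 t2E1 fcstM /fps_var midx1_21 eqxx ne01 mulr0.
- by rewrite /W t2E0 t2E1 fpsD fcstM /fps_var midx1_20 midx1_21 eqxx ne01 mulr0 addr0.
- move=> H HA [x' [y' [hx' hy']]]; have e1 := wt _ _ _ HA hx' hy'.
  exists (expR y'); first exact: expR_gt0.
  suff -> : H = fl (y' / y).
    have := flE (y' / y); rewrite (_ : y * (y' / y) = y') //; field.
    by [].
  have [G [GA GG' G'G]] := Autf_inv rhoH Tphi (flA (y' / y)).
  have F0 := formal_invertible_null (proj1 (flA (y' / y))).
  have G0 := formal_invertible_null (proj1 GA).
  have Hn := formal_invertible_null (proj1 HA).
  have K1 : mcomp G H = @formal_id R.
    apply: uni; first exact: Autf_comp.
    have [f1 g1 _ _] := fll (y' / y).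
    have xx : x * (y' / y) = x'.
      apply: (mulfI an0); rewrite e1 [LHS]mulrA e0; field.
      by [].
    have yy : y * (y' / y) = y' by field.
    have gf : gam (fl (y' / y)) = (expR x')%:C by rewrite -xx; exact: f1.
    have df : del (fl (y' / y)) = (expR y')%:C by rewrite -[in RHS]yy; exact: g1.
    have gg := gamM Tphi Lt Lt' tt' (flA (y' / y)) GA; rewrite GG' gam_id gf in gg.
    have gd := delM Tphi Lt Lt' tt' (flA (y' / y)) GA; rewrite GG' del_id df in gd.
    split; first by rewrite (gamM Tphi Lt Lt' tt' GA HA) hx' mulrC -gg.
    by rewrite (delM Tphi Lt Lt' tt' GA HA) hy' mulrC -gd.
  by rewrite -[LHS]m1comp // -GG' mcompA // K1 mcomp1.
move=> s s0; exists (fl (ln s / y)); split=> //.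
have := flE (ln s / y); rewrite (_ : y * (ln s / y) = ln s) ?lnK ?posrE //; field.
by [].
Qed.

End OneParameter.
End Sheets.

Section Sheets2.
Variables (R : realType) (rho : fps R[i] (2 + 2)) (T : formal_map R).
Variable phi : fps R[i] 3.
Local Notation C := R[i].
Implicit Types (H G K L B V W : formal_map R).
Hypothesis rhoH : formal_hypersurface rho.
Hypothesis Tphi : normal_coordinates rho T phi.
Let r := normal_defining_series phi.

Variables (al n mu : nat) (t' : nat * nat * nat).
Hypotheses (Lt : Lambda phi (al, n, mu)) (Lt' : Lambda phi t').
Hypotheses (tt' : t' <> (al, n, mu)) (aln : al <> n).
Variable k : nat.
Hypotheses (k0 : (0 < k)%N).
Hypothesis slopes : forall k', (0 < k')%N -> common_slope phi al n mu k' -> k' = k.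

Variables (H0 : formal_map R).
Hypotheses (H0A : Autf r H0) (H0p : positive H0) (H01 : H0 <> @formal_id R).

Definition sheet B L : set 'rV[R]_#|jet_index k| :=
  [set x | exists H, [/\ Autf r H, positive H & x = jet k (mcomp B (mcomp H L))]].

Let zero_map : formal_map R := fun=> 0 : fps C 2.

Let comp0 L : mcomp zero_map L = zero_map.
Proof. by apply/funext => l; apply: fps_comp0. Qed.

Lemma lin3_jet_eq0 P V W s u : P = zero_map ->
  jet k (lin3 P V W s u) = s *: jet k V + u *: jet k W.
Proof. by move=> ->; rewrite jet_lin3 (jet0 R k) add0r. Qed.

(** Composition on the left with B and on the right with L carries the line or
    ray of the positive automorphisms to one in the space of jets. The end
    points of a ray are multiples of the jet of a degenerate map, so they are
    no jets of invertible maps. *)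
Theorem positive_sheet : exists a b th, forall B L, formal_invertible B ->
  formal_invertible L -> exists q,
  [/\ proper_arc q, arc_set a b th q = sheet B L
    & forall x, closure (arc_set a b th q) x -> jet_group x -> arc_set a b th q x].
Proof.
have [k1|k2] : k = 1%N \/ (2 <= k)%N by lia.
  have [th [V [W [[V0 W0] [Vw Vz] [Wz W1] h1 h2]]]] := positive_ray rhoH Tphi Lt Lt' tt' aln k0 slopes H0A H0p H01 k1.
  exists 1, 0, th => B L BI LI; have [B0 L0] := (formal_invertible_null BI, formal_invertible_null LI).
  have [L' [L'I _ LL']] := formal_inverse LI; have L'0 := formal_invertible_null L'I.
  pose V' := lmul (jac B) (mcomp V L); pose W' := lmul (jac B) (mcomp W L).
  have V'0 : null V' by apply/null_lmul/null_mcomp.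
  have W'0 : null W' by apply/null_lmul/null_mcomp.
  have lin s u : lmul (jac B) (mcomp (lin3 zero_map V W s u) L) = lin3 zero_map V' W' s u.
    by rewrite lin3_comp // comp0 lmul_lin3.
  have ind c d : c *: jet k V' + d *: jet k W' = 0 -> c = 0 /\ d = 0.
    rewrite -(@lin3_jet_eq0 zero_map) // -(jet0 R k) => e.
    have ag : agree k (lin3 zero_map V' W' c d) zero_map.
      by apply: jet_agree e => //; apply: lin3_null.
    have o2 : forall l, order_ge 2 (lin3 zero_map V W c d l).
      apply: (lmul_cancel (proj2 BI) L0 L'0 LL') => l; rewrite lin.
      by have := ag l; rewrite k1 subr0.
    have d1 : (mdeg (mi2 0 1) < 2)%N /\ (mdeg (mi2 1 0) < 2)%N by rewrite !mdeg_mi2.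
    have /eqP := o2 1 _ (proj1 d1); have /eqP := o2 0 _ (proj2 d1).
    rewrite /lin3 !fpsD !fcstM Vw Vz Wz W1 !fps0 !mulr0 !mulr1 !add0r addr0 !fmorph_eq0.
    by move=> /eqP -> /eqP ->.
  have [Lf [Lf' [lv lw l'v l'w]]] := dual_pair ind.
  exists (0, jet k V', jet k W', Lf); split.
  - by split=> //; rewrite /dotp mul0mx mxE.
  - have pq : proper_arc (0, jet k V', jet k W', Lf) by split=> //; rewrite /dotp mul0mx mxE.
    have jE H s u : agree 1 H (lin3 zero_map V W s u) -> null H ->
        jet k (mcomp B (mcomp H L)) = s *: jet k V' + u *: jet k W'.
      move=> ag Hn; rewrite -(@lin3_jet_eq0 zero_map) // -lin; apply: agree_jet.
      have HL0 := null_mcomp Hn L0.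
      rewrite k1; apply: agree_trans (comp_lin_l B0 HL0) _ => l.
      apply: lmul_congr => j; apply: agree_comp => //.
      exact: agree_refl.
    have aP x := @arc_setP R _ 1 0 th _ x pq.
    apply/seteqP; split=> [x /aP[s s0 ->]|x [H [HA Hp ->]]].
      have s0' : 0 < s by move: s0; rewrite mul1r addr0.
      have [H [HA Hp ag]] := h2 s s0'; exists H; split=> //.
      rewrite (jE _ _ _ ag); last exact: formal_invertible_null (proj1 HA).
      by rewrite /arc mul1r addr0 add0r.
    have [s s0 ag] := h1 H HA Hp; apply/aP; exists s; first by rewrite mul1r addr0.
    rewrite (jE _ _ _ ag); last exact: formal_invertible_null (proj1 HA).
    by rewrite /arc mul1r addr0 add0r.
  move=> x cx [Hx HxI xE].
  have [//|xW] := closure_ray lv lw l'v l'w cx.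
  exfalso; move: HxI => [Hx0]; rewrite jac_jacobian0 unitmxE unitfE => /negP; apply; apply/eqP.
  set z := dotp Lf' x in xW.
  have -> : jac Hx = jac (lin3 zero_map W' zero_map z 0).
    apply/matrixP => l j; rewrite !mxE; apply: (@jet_coef _ k); last by rewrite mdeg1 k0.
    by rewrite xE xW lin3_jet_eq0 // scale0r addr0.
  have -> : jac (lin3 zero_map W' zero_map z 0) = z%:C *: (jac B *m (jac W *m jac L)).
    apply/matrixP => l j; rewrite -jac_comp // -jac_lmul !mxE /lin3 !fpsD !fcstM.
    by rewrite /zero_map mulr0 add0r addr0.
  rewrite detZ !det_mulmx (det2 (jac W)) !mxE W1 !fps0 !mulr0 subrr mul0r !mulr0 //.
have [V [Vk V1 h1 h2]] := positive_line rhoH Tphi Lt Lt' tt' aln k0 slopes H0A H0p H01 k2.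
exists 0, 1, 0 => B L BI LI; have [B0 L0] := (formal_invertible_null BI, formal_invertible_null LI).
have [L' [L'I _ LL']] := formal_inverse LI; have L'0 := formal_invertible_null L'I.
have V0 : null V by move=> l; apply: (Vk l); rewrite mdeg0; lia.
pose V' := lmul (jac B) (mcomp V L).
have V'0 : null V' by apply/null_lmul/null_mcomp.
pose P := mcomp B L.
have nV : jet k V' != 0.
  apply/eqP; rewrite -(jet0 R k) => e.
  have ag : agree k V' zero_map by apply: jet_agree e.
  have o : forall l, order_ge k.+1 (V l).
    apply: (lmul_cancel (proj2 BI) L0 L'0 LL') => l.
    by have := ag l; rewrite subr0.
  by move/eqP: V1; apply; apply: (o 1); rewrite mdeg_mi2.
have [Lf lf] := dual_form nV.
pose c := dotp Lf (jet k P).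
have jE H t : agree k H (lin3 (@formal_id R) V zero_map t 0) -> null H ->
    jet k (mcomp B (mcomp H L)) = jet k P + t *: jet k V'.
  move=> ag Hn; have GN : null (lin3 (@formal_id R) V zero_map t 0).
    by apply: lin3_null => //; apply: null_var.
  have <- : jet k (lin3 P V' zero_map t 0) = jet k P + t *: jet k V'.
    by rewrite jet_lin3 scale0r addr0.
  apply: agree_jet; rewrite -mcompA //.
  have -> : lin3 P V' zero_map t 0 = mcomp (lin3 B (lmul (jac B) V) zero_map t 0) L.
    by rewrite lin3_comp // lmul_comp // comp0.
  apply: agree_comp => //; last exact: agree_refl.
  apply: agree_trans (comp_near_id_l t B0 k2 Vk); apply: agree_comp => //; exact: agree_refl.
pose q := (jet k P - c *: jet k V', jet k V', 0 : 'rV[R]_#|jet_index k|, Lf).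
have pq : proper_arc q.
  by split=> //; rewrite ?dotpD ?dotpN ?dotpZ ?lf ?mulr1 ?subrr // /dotp mul0mx mxE.
have arcE s : arc 0 1 0 q s = jet k P + (s - c) *: jet k V'.
  by rewrite /arc /q scaler0 addr0 scalerBl addrAC -addrA.
exists q; split=> //; last by move=> x cx _; apply: closure_line.
have aP x := @arc_setP R _ 0 1 0 _ x pq.
apply/seteqP; split=> [x /aP[s _ ->]|x [H [HA Hp ->]]].
  have [H [HA Hp ag]] := h2 (s - c); exists H; split=> //.
  by rewrite arcE (jE _ _ ag) //; apply: formal_invertible_null (proj1 HA).
have [t ag] := h1 H HA Hp; apply/aP; exists (t + c).
  by rewrite mul0r add0r.
by rewrite arcE addrK (jE _ _ ag) //; apply: formal_invertible_null (proj1 HA).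
Qed.

End Sheets2.

(** * Phases and cosets *)

Section FinitelyManyPhases.
Variables (R : realType) (phi : fps R[i] 3).
Local Notation C := R[i].

Lemma nth_roots (m : nat) (c : C) : (0 < m)%N ->
  exists2 s : seq C, size s = m & forall z, z ^+ m = c -> z \in s.
Proof.
move=> m0; have [s hs] := closed_field_poly_normal ('X^m - c%:P : {poly C}).
have mon : ('X^m - c%:P : {poly C}) \is monic by apply: monicXnsubC.
rewrite (monicP mon) scale1r in hs; exists s.
  by have := size_XnsubC c m0; rewrite hs size_prod_XsubC => -[].
by move=> z zm; rewrite -root_prod_XsubC -hs rootE !hornerE zm subrr.
Qed.

(** For each sign d, the equation of the point (al, n, mu) has at most n - al
    solutions g. *)
Lemma N_group_seq al n mu : Lambda phi (al, n, mu) -> (al < n)%N ->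
  exists2 s : seq (C * C), size s = (2 * (n - al))%N
    & forall x, N_group phi x -> x \in s.
Proof.
move=> h aln; pose m := (n - al)%N; have m0 : (0 < m)%N by rewrite subn_gt0.
have [s1 z1 r1] := nth_roots ((1 : C) ^ (mu%:Z - 1))^-1 m0.
have [s2 z2 r2] := nth_roots ((-1 : C) ^ (mu%:Z - 1))^-1 m0.
exists ([seq (z, 1) | z <- s1] ++ [seq (z, -1) | z <- s2]).
  by rewrite size_cat !size_map z1 z2 mul2n addnn.
move=> [g d] /(_ _ _ _ h)[/= g1 d1 gd].
have d0 : d ^ (mu%:Z - 1) != 0.
  by apply: expfz_neq0; case: d1 => ->; rewrite ?oppr_eq0 oner_eq0.
have gm : g ^+ m = (d ^ (mu%:Z - 1))^-1.
  apply: (mulIf d0); rewrite mulVf // -gd exprnP /m; congr (_ ^ _ * _).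
  by rewrite subzn // ltnW.
rewrite mem_cat; case: d1 gm => -> gm; apply/orP; [left|right]; apply/mapP; exists g => //.
  exact: r1.
exact: r2.
Qed.

End FinitelyManyPhases.

Section Cosets.
Variables (R : realType) (rho : fps R[i] (2 + 2)) (T : formal_map R).
Variable phi : fps R[i] 3.
Local Notation C := R[i].
Implicit Types (H G K L A B V W : formal_map R).
Hypothesis rhoH : formal_hypersurface rho.
Hypothesis Tphi : normal_coordinates rho T phi.
Let r := normal_defining_series phi.
Let phiN : normal_series phi. Proof. by case: Tphi. Qed.
Let TI : formal_invertible T. Proof. by case: Tphi. Qed.
Let T0 : null T := formal_invertible_null TI.

Variables (al n mu : nat) (t' : nat * nat * nat).
Hypotheses (Lt : Lambda phi (al, n, mu)) (Lt' : Lambda phi t').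
Hypotheses (tt' : t' <> (al, n, mu)) (aln : al <> n).

Let al_lt_n : (al < n)%N.
Proof. by rewrite ltn_neqAle (Lambda_le phiN Lt) andbT; apply/eqP. Qed.

Let aut_null H : Autf r H -> null H.
Proof. by move=> [/formal_invertible_null]. Qed.

Lemma positive_phase K : Autf r K -> positive K -> phase K = (1, 1).
Proof.
move=> KA [x [y [hx hy]]]; rewrite /phase hx hy.
have e (z : R) : (expR z)%:C / `|(expR z)%:C| = 1 :> C.
  by rewrite ger0_norm ?ler0c ?expR_ge0 // divff // fmorph_eq0 gt_eqF // expR_gt0.
by rewrite !e.
Qed.

Lemma positive_comp_phase A K : Autf r A -> Autf r K -> positive K ->
  phase (mcomp A K) = phase A.
Proof.
move=> AA KA Kp; rewrite (phaseM Tphi Lt Lt' tt' AA KA) (positive_phase KA Kp) /= !mulr1.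
by [].
Qed.

Definition positive_trivial := forall H, Autf r H -> positive H -> H = @formal_id R.

Lemma phase_inj : positive_trivial -> forall H G, Autf r H -> Autf r G ->
  phase H = phase G -> H = G.
Proof.
move=> triv H G HA GA hp.
have [K [KA Kp ->]] := phase_positive rhoH Tphi Lt Lt' tt' HA GA hp.
by rewrite (triv K KA Kp) mcomp1.
Qed.

Lemma no_slope_trivial : (forall k, (0 < k)%N -> ~ common_slope phi al n mu k) ->
  positive_trivial.
Proof.
move=> ns H HA Hp; have HU := positive_unipotent Tphi Lt Lt' tt' aln HA Hp (ns 1%N isT).
apply: (unipotent_rigid Tphi Lt Lt' tt' aln HA HU) => k k2 sl.
by case: (ns k (ltnW k2) sl).
Qed.

Variable L : formal_map R.
Hypotheses (LI : formal_invertible L) (LT : mcomp L T = @formal_id R).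
Hypothesis TL : mcomp T L = @formal_id R.
Hypothesis toN : forall H, Autf rho H -> Autf r (mcomp L (mcomp H T)).
Hypothesis ofN : forall H, Autf r H -> Autf rho (mcomp T (mcomp H L)).
Let L0 : null L := formal_invertible_null LI.

Let rho_null H : Autf rho H -> null H.
Proof. by move=> [/formal_invertible_null]. Qed.

Lemma to_of H : null H -> mcomp L (mcomp (mcomp T (mcomp H L)) T) = H.
Proof.
move=> Hn; have HLn := null_mcomp Hn L0.
by rewrite mcompA // mcompA // LT mcomp1 -mcompA // LT m1comp.
Qed.

Lemma of_to H : null H -> mcomp T (mcomp (mcomp L (mcomp H T)) L) = H.
Proof.
move=> Hn; have HTn := null_mcomp Hn T0.
by rewrite mcompA // mcompA // TL mcomp1 -mcompA // TL m1comp.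
Qed.

Lemma to_comp H G : null H -> null G -> mcomp L (mcomp (mcomp H G) T) =
  mcomp (mcomp L (mcomp H T)) (mcomp L (mcomp G T)).
Proof.
move=> Hn Gn; have GTn := null_mcomp Gn T0; have HTn := null_mcomp Hn T0.
have LGTn := null_mcomp L0 GTn.
rewrite [RHS]mcompA //; congr (mcomp L _).
by rewrite [RHS]mcompA // -(mcompA T) // TL m1comp // mcompA.
Qed.

Lemma to_inj H G : Autf rho H -> Autf rho G ->
  mcomp L (mcomp H T) = mcomp L (mcomp G T) -> H = G.
Proof. by move=> HA GA e; rewrite -(of_to (rho_null HA)) e of_to //; apply: rho_null. Qed.

Theorem phase_embedding : positive_trivial ->
  embeds_in_N_group rho phi /\ (Autf rho #<= `I_(2 * (n - al)))%card.
Proof.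
move=> triv; pose F H := phase (mcomp L (mcomp H T)).
have FN H : Autf rho H -> N_group phi (F H).
  by move=> /toN; apply: (phase_N Tphi Lt Lt' tt').
have Finj H G : Autf rho H -> Autf rho G -> F H = F G -> H = G.
  by move=> HA GA hF; apply: (to_inj HA GA (phase_inj triv (toN HA) (toN GA) hF)).
split.
  exists F; split=> // H G HA GA.
  rewrite /F (to_comp (rho_null HA) (rho_null GA)).
  exact: (phaseM Tphi Lt Lt' tt' (toN HA) (toN GA)).
have [s sz hs] := N_group_seq Lt al_lt_n.
have ci : {in Autf rho &, injective (fun H => index (F H) s)}.
  move=> H G; rewrite !inE => HA GA /(congr1 (nth (0, 0) s)).
  by rewrite !nth_index; [apply: Finj|apply/hs/FN..].
have /card_esym ce := inj_card_eq ci.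
rewrite (card_le_eql ce); apply: subset_card_le => _ [H HA <-] /=.
by rewrite -sz index_mem; apply/hs/FN.
Qed.

Variable k : nat.
Hypotheses (k0 : (0 < k)%N).
Hypothesis slopes : forall k', (0 < k')%N -> common_slope phi al n mu k' -> k' = k.

Let J H := jet k (mcomp T (mcomp H L)).
Let S : set 'rV[R]_#|jet_index k| := [set jet k H | H in Autf rho].

Let SE x : S x <-> exists2 H, Autf r H & x = J H.
Proof.
split=> [[H HA <-]|[H HA ->]]; last by exists (mcomp T (mcomp H L)) => //; apply: ofN.
exists (mcomp L (mcomp H T)); first exact: toN.
by rewrite /J of_to //; apply: rho_null.
Qed.

Let J_inj H G : Autf r H -> Autf r G -> J H = J G -> H = G.
Proof.
move=> HA GA e; have [Hn Gn] := (aut_null HA, aut_null GA).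
have [HLn GLn] := (null_mcomp Hn L0, null_mcomp Gn L0).
have ag : agree k (mcomp T (mcomp H L)) (mcomp T (mcomp G L)).
  by apply: jet_agree => //; apply: null_mcomp.
apply: (Autf_jet_inj rhoH Tphi Lt Lt' tt' aln k0 slopes HA GA).
rewrite -(to_of Hn) -(to_of Gn); apply: agree_comp; try by do !apply: null_mcomp.
  exact: agree_refl.
by apply: agree_comp => //; apply: agree_refl.
Qed.

Lemma rho_inv H : Autf rho H -> exists G,
  [/\ Autf rho G, mcomp H G = @formal_id R & mcomp G H = @formal_id R].
Proof.
move=> HA; have H0 := rho_null HA; have [G [GA e1 e2]] := Autf_inv rhoH Tphi (toN HA).
have Gn := aut_null GA; have G'A := ofN GA; have G'n := rho_null G'A.
have idA : Autf rho (@formal_id R) by apply: Autf_id.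
have LidT : mcomp L (mcomp (@formal_id R) T) = @formal_id R by rewrite m1comp.
exists (mcomp T (mcomp G L)); split=> //.
  by apply: (to_inj (Autf_comp HA G'A) idA); rewrite to_comp // to_of // e1 LidT.
by apply: (to_inj (Autf_comp G'A HA) idA); rewrite to_comp // to_of // e2 LidT.
Qed.

Lemma jets_embed d : closure S `&` @jet_group R k `<=` S -> embedded_submanifold d S ->
  jet_embedding k rho d.
Proof.
move=> cl em; split=> [H G HA GA|H G HA GA e|]; first by apply: jetM; apply: rho_null.
  apply: (to_inj HA GA (J_inj (toN HA) (toN GA) _)).
  by rewrite /J !of_to //; apply: rho_null.
split=> //; split.
- by move=> _ [H HA <-]; exists H => //; case: HA.
- by exists (@formal_id R); [apply: Autf_id|].
- move=> _ _ [H HA <-] [G GA <-]; exists (mcomp H G); first exact: Autf_comp.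
  by apply: jetM; apply: rho_null.
move=> _ [H HA <-]; have [G [GA HG GH]] := rho_inv HA.
have [Hn Gn] := (rho_null HA, rho_null GA).
by exists (jet k G); [exists G|rewrite -!jetM // HG GH].
Qed.

Lemma jet_embedding_finite : positive_trivial -> jet_embedding k rho 0.
Proof.
move=> triv; have [_ /card_le_finite fA] := phase_embedding triv.
have fS : finite_set S by apply: finite_image; apply: fA.
apply: jets_embed; last exact: finite_submanifold.
by move=> x [cx _]; rewrite (closure_id S).1 //; apply: hausdorff_rV_closed.
Qed.

Lemma jet_index_gt0 : (0 < #|jet_index k|)%N.
Proof.
have k1 : (1 < k.+1)%N by rewrite ltnS.
pose b : {ffun 'I_2 -> 'I_k.+1} := [ffun i => if i == 0 then Ordinal k1 else ord0].
apply/card_gt0P; exists (0, b, false); rewrite inE /=.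
have -> : bounded_midx b = mi2 1 0 by apply/ffunP; apply: ord2P; rewrite !ffunE.
by rewrite mdeg_mi2.
Qed.

(** The coset of A under the positive automorphisms is a fibre of the phase
    map. *)
Lemma sheetE A : Autf r A -> sheet phi (mcomp T A) L =
  [set x | exists2 H, Autf r H /\ phase H = phase A & x = J H].
Proof.
move=> AA; apply/seteqP; split=> [x [K [KA Kp ->]]|x [H [HA hp] ->]].
  exists (mcomp A K).
    by split; [apply: Autf_comp|apply: positive_comp_phase].
  by rewrite /J !mcompA //; try apply: null_mcomp => //; apply: aut_null.
have [K [KA Kp HE]] := phase_positive rhoH Tphi Lt Lt' tt' HA AA hp.
exists K; split=> //; rewrite /J HE !mcompA //; try apply: null_mcomp => //; exact: aut_null.
Qed.

(** The group is a finite union of cosets of the positive automorphisms, one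
    for each phase that occurs, and their jets are disjoint arcs. *)
Lemma jet_embedding_arcs : ~ positive_trivial -> jet_embedding k rho 1.
Proof.
move=> ntriv.
have [H0 [H0A H0p H01]] : exists H0, [/\ Autf r H0, positive H0 & H0 <> @formal_id R].
  apply: contrapT => h; apply: ntriv => H HA Hp; apply: contrapT => H1.
  by apply: h; exists H.
have [a [b [th hq]]] := positive_sheet rhoH Tphi Lt Lt' tt' aln k0 slopes H0A H0p H01.
have [s0 _ hs0] := N_group_seq Lt al_lt_n.
pose occurs u := exists2 A, Autf r A & phase A = u.
have /boolp.choice[Q hQ] (u : C * C) : exists q, occurs u ->
    [/\ proper_arc q,
        arc_set a b th q = [set x | exists2 H, Autf r H /\ phase H = u & x = J H]
      & forall x, closure (arc_set a b th q) x -> jet_group x -> arc_set a b th q x].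
  have [[A AA <-]|no] := pselect (occurs u); last by exists (0, 0, 0, 0).
  have TAI := formal_invertible_comp TI (proj1 AA).
  by have [q [q1 q2 q3]] := hq _ _ TAI LI; exists q => _; rewrite -sheetE // -q2.
pose s := [seq Q u | u <- s0 & `[< occurs u >]].
have sP q : q \in s -> exists2 u, occurs u & q = Q u.
  by move=> /mapP[u]; rewrite mem_filter => /andP[/asboolP uo _] ->; exists u.
have sE x : S x <-> exists2 q, q \in s & arc_set a b th q x.
  split=> [/SE[H HA ->]|[q /sP[u uo ->]]]; last first.
    by have [_ -> _] := hQ u uo; move=> [H [HA _] ->]; apply/SE; exists H.
  have uo : occurs (phase H) by exists H.
  exists (Q (phase H)); last by have [_ -> _] := hQ _ uo; exists H.
  apply: map_f; rewrite mem_filter (asboolT uo) /=.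
  by apply/hs0/(phase_N Tphi Lt Lt' tt').
have SJ x : S x -> jet_group x by move=> [H [HI _] <-]; exists H.
apply: jets_embed.
  move=> x [cx jx]; apply/sE; apply: contrapT => nx.
  (* A limit of jets is a limit within one of the finitely many sheets. *)
  have : closed (\bigcup_(q in [set` s]) closure (arc_set a b th q)).
    apply: closed_bigcup => [|q _]; last exact: closed_closure.
    by apply/finite_seqP; exists s.
  move/closure_id => cE.
  have : (\bigcup_(q in [set` s]) closure (arc_set a b th q)) x.
    rewrite cE; apply: closure_subset cx => y /sE[q qs yq]; exists q => //.
    exact: subset_closure.
  move=> [q /= qs cq]; apply: nx; exists q => //.
  by have [u uo qE] := sP _ qs; have [_ _ h] := hQ u uo; rewrite qE in cq *; apply: h.
apply: (@arcs_submanifold _ _ a b th s) => //.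
- exact: jet_index_gt0.
- by move=> q /sP[u uo ->]; have [] := hQ u uo.
- move=> q x /sP[u uo ->] Sx; have [_ _ h] := hQ u uo.
  by move=> cq; apply: h => //; apply: SJ.
move=> q q' x /sP[u uo ->] /sP[u' u'o ->].
have [_ -> _] := hQ u uo; have [_ -> _] := hQ u' u'o.
by move=> [H [HA <-] ->] [H' [H'A <-] /(J_inj HA H'A) ->].
Qed.

End Cosets.

(** * The structure of the automorphism group *)

Theorem theorem1 (R : realType) (rho : fps R[i] (2 + 2))
    (T : formal_map R) (phi : fps R[i] 3) (alpha n mu : nat) :
  formal_hypersurface rho ->
  normal_coordinates rho T phi ->
  Lambda phi (alpha, n, mu) ->
  (exists t', Lambda phi t' /\ t' <> (alpha, n, mu)) ->
  alpha <> n ->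
  exists d : nat,
    [/\ (d <= 1)%N,
        exists k : nat, jet_embedding k rho d,
        (exists alpha' n' mu' : nat,
            [/\ Lambda phi (alpha', n', mu'),
                (alpha', n', mu') <> (alpha, n, mu)
              & (alpha + n = alpha' + n')%N]) \/
        ~ (exists k : nat, (0 < k)%N /\
            forall t', Lambda phi t' -> t' <> (alpha, n, mu) ->
              slope (alpha, n, mu) t' = k%:R) ->
        [/\ finite_set (N_group phi),
            embeds_in_N_group rho phi
          & (Autf rho #<= `I_(2 * (n - alpha)))%card]
      & forall k : nat, (0 < k)%N ->
        (forall alpha' n' mu' : nat, Lambda phi (alpha', n', mu') ->
            (alpha', n', mu') <> (alpha, n, mu) ->
            (alpha + n)%N <> (alpha' + n')%N /\
            slope (alpha, n, mu) (alpha', n', mu') = k%:R) ->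
        jet_embedding k rho d].
Proof.
move=> rhoH Tphi Lt [t' [Lt' tt']] aln.
have phiN : normal_series phi by case: Tphi.
have [L [LI LT TL toN ofN]] := normal_inverse rhoH Tphi.
pose d := `[< ~ positive_trivial phi >] : nat.
have embed k : (0 < k)%N ->
    (forall k', (0 < k')%N -> common_slope phi alpha n mu k' -> k' = k) ->
    jet_embedding k rho d.
  move=> k0 slopes; rewrite /d; case: asboolP => triv.
    exact: (jet_embedding_arcs rhoH Tphi Lt Lt' tt' aln LI LT TL toN ofN k0 slopes triv).
  move/contrapT: triv => triv.
  exact: (jet_embedding_finite rhoH Tphi Lt Lt' tt' aln LI LT TL toN ofN k0 slopes triv).
have slope_uniq k k' : common_slope phi alpha n mu k ->
    common_slope phi alpha n mu k' -> k' = k.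
  by move=> sl sl'; apply: (common_slope_inj Lt' tt' sl' sl).
exists d; split.
- by rewrite /d; case: asboolP.
- have [[k [k0 sl]]|ns] := pselect (exists k, (0 < k)%N /\ common_slope phi alpha n mu k).
    by exists k; apply: embed => // k' _; apply: slope_uniq.
  by exists 1%N; apply: embed => // k' k'0 sl; case: ns; exists k'.
- move=> hyp; have ns k : (0 < k)%N -> ~ common_slope phi alpha n mu k.
    move=> k0 sl; case: hyp => [[al' [n' [mu' [h ne e]]]]|].
      by have [] := sl _ _ _ h ne.
    by apply; exists k; split=> // -[[al' n'] mu'] h ne; have [] := sl _ _ _ h ne.
  have triv := no_slope_trivial Tphi Lt Lt' tt' aln ns.
  have [emb card] := phase_embedding rhoH Tphi Lt Lt' tt' aln LI TL toN triv.
  split=> //; have aln' : (alpha < n)%N.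
    by rewrite ltn_neqAle (Lambda_le phiN Lt) andbT; apply/eqP.
  have [s _ hs] := N_group_seq Lt aln'.
  by apply: sub_finite_set hs _; apply/finite_seqP; exists s.
move=> k k0 sl; apply: embed => // k' _; exact: (slope_uniq k k' sl).
Qed.
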